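(* Let $\delta>0$, $L>0$, $\lambda>0$, let $f,g$ satisfy assumption (A1) with constants $\alpha,\beta,\beta^*$, let $u_0\in\,]0,\alpha[\,$, and let $u=u(t,x)$ be the random solution with constant initial data $u_0$ (all recalled in the context). Then, at every time $t>0$, the expected total variation of $u(t,\cdot)$ over one period $[0,L]$ is bounded by $$E\Big[\mathrm{TV}\{u(t,\cdot)\}\Big]\;\le\;2\alpha\cdot\left(1+e^{\lambda L/(\alpha\beta^* )}\right).$$
   Context: Assumption (A1): $g(u)=\frac{\beta}{2}u(\alpha-u)$ for constants $\alpha,\beta>0$; $f$ is a $\mathcal C^2$ concave function with $f(0)=g(0)=f(\alpha)=g(\alpha)=0$, $f'(0)=g'(0)$, $f'(\alpha)=g'(\alpha)$, $f(u)>g(u)$ for all $u\in\,]0,\alpha[\,$; and for some $\beta^*>0$ one has $f''(u)\le-\beta^*$ and $g''(u)\le-\beta^*$ for all $u\in\,]0,\alpha[\,$. Equation: $u_t+[\theta(u_x)f(u)+(1-\theta(u_x))g(u)]_x=0$, with $\theta(s)=1$ if $s>-\delta$ and $\theta(s)=0$ if $s<-\delta$; spatially $L$-periodic solutions, $u(t,0)=u(t,L)$, with initial data $u(0,x)=u_0$. Weak solution means: $t\mapsto u(t,\cdot)\in L^1_{loc}(\mathbb R)$ is continuous, takes the initial data, and there is a measurable $\Theta$ with values in $[0,1]$, equal to $1$ where $u_x>-\delta$ and to $0$ where $u_x<-\delta$, such that $u_t+[\Theta f(u)+(1-\Theta)g(u)]_x=0$ in the sense of distributions. Functions on $[0,L]$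 are extended by $L$-periodicity. Admissible profiles: $\mathcal S$ is the set of functions $w:[0,L]\to\mathbb R$ such that: (P1) $w$ has finitely many upward jumps, at points $y_k\in[0,L[\,$, and on each open interval $I_k$ between two consecutive jumps $w$ is $\mathcal C^1$ and non-increasing; (P2) $w(0)=w(L)$, $\frac1L\int_0^Lw\,dx=u_0$, $0<\inf w\le\sup w<\alpha$; (P3) if $w_x(x)\le-\delta$ at some $x\in I_k$, then $w_x$ is constant on $I_k$. Random data: $0<t_1<t_2<\cdots$ is a Poisson arrival process with rate $\lambda$ (with $t_0=0$, the increments $t_j-t_{j-1}$ are i.i.d. with $\mathrm{Prob}\{t_j-t_{j-1}>s\}=e^{-\lambda s}$), and the $X_j$ are independent, uniformly distributed on $[0,L]$ (and independent of the times). Random solution: for a.e. sequence $(t_j,X_j)_{j\ge1}$, $u$ is the unique weak solution with $u(t,\cdot)\in\mathcal S$ for all $t\ge0$ satisfying: (I) $u(t,x)=u_0$ on $[0,t_1]$; (II) given $u$ on $[0,t_j]$, if $u_x(t_j,X_j)>-\delta$ then $u$ is prolonged to $[t_j,t_{j+1}]$ by inserting a new $N$-shaped spike at $X_j$ at time $t_j$; if $u_x(t_j,X_j)$ is undefined or $\le-\delta$, then $u$ is prolonged without adding any new spike. Inserting a spike means that for $t>t_j$ close to $t_j$ there are jump curves $y'(t)<y''(t)$, both converging to $X_j$ as $t\to t_j+$, with $u(t,x)=\frac\alpha2-\frac{x-X_j}{\beta(t-t_j)}$ for $y'(t)<x<y''(t)$, while near $X_j$ outside $[y'(t),y''(t)]$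 $u$ is the $\mathcal C^1$ solution of $u_t+f(u)_x=0$ continuing the pre-existing profile. No other new jump curves are created; jumps satisfy the Rankine-Hugoniot condition and two jumps which meet merge into one. The probability on solutions is the push-forward of the law of $(t_j,X_j)_{j\ge1}$.
   Formalization: The random solution is additionally required to have u_x = -δ only on a null set of (t,x); without this, Θ is arbitrary where u_x = -δ, linear pieces could keep slope -δ, and the weak solution called unique would not be unique. *)

(* Defs.v *)
From HB Require Import structures.
From mathcomp Require Import all_boot all_order all_algebra.
From mathcomp Require Import all_classical all_reals all_analysis.

Set Implicit Arguments.
Unset Strict Implicit.
Unset Printing Implicit Defensive.

Import Order.TTheory GRing.Theory Num.Theory.
Import numFieldNormedType.Exports.

Local Open Scope classical_set_scope.
Local Open Scope ring_scope.

(** * Fluxes *)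

(** The profiles take values in [0, alpha]; a C^2 concave function on
    [0, alpha] extends to a C^2 function on the line, so [f] is taken C^2
    everywhere while all the other conditions only concern [0, alpha]. *)
Definition assumption_A1 (R : realType) (alpha beta betas : R) (f g : R -> R) :
    Prop :=
  [/\ [/\ 0 < alpha, 0 < beta & 0 < betas],
      (forall v, g v = beta / 2 * v * (alpha - v)),
      [/\ (forall v, derivable f v 1), (forall v, derivable (derive1 f) v 1),
          continuous (derive1n 2 f)
        & convex_function (E := R^o) [set` `[0, alpha]] (fun v => - f v)],
      [/\ f 0 = 0, g 0 = 0, f alpha = 0, g alpha = 0
        & derive1 f 0 = derive1 g 0 /\ derive1 f alpha = derive1 g alpha]
    & forall v, 0 < v < alpha ->
        [/\ g v < f v, derive1n 2 f v <= - betas & derive1n 2 g v <= - betas]].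

(** * Admissible profiles

    Functions on [0, L] are represented by their L-periodic extensions
    [w : R -> R]. *)

Definition periodic_with (R : realType) (L : R) (w : R -> R) : Prop :=
  forall x, w (x + L) = w x.

(** The value at a jump is irrelevant in the space L^1_loc; it is normalised to
    lie between the one-sided limits, so that the pointwise total variation is
    the one of the L^1 class. *)
Definition upward_jump (R : realType) (w : R -> R) (y : R) : Prop :=
  exists l r, [/\ w z @[z --> y^'-] --> l, w z @[z --> y^'+] --> r,
    l < r & l <= w y <= r].

Definition jump_set (R : realType) (w : R -> R) : set R :=
  [set y | upward_jump w y].

(** Quantifying over jump-free intervals of the line, instead of subintervals of
    [0, L], accounts for the interval between the last jump in [0, L[ and the
    first jump of the next period. *)
Definition jump_free (R : realType) (w : R -> R) (a b : R) : Prop :=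
  `]a, b[ `&` jump_set w = set0.

Definition profile_P1 (R : realType) (L : R) (w : R -> R) : Prop :=
  finite_set (jump_set w `&` `[0, L[) /\
  forall a b, jump_free w a b ->
    [/\ (forall x, a < x < b -> derivable w x 1),
        (forall x, a < x < b -> {for x, continuous (derive1 w)})
      & (forall x z, a < x -> x <= z -> z < b -> w z <= w x)].

Definition profile_P2 (R : realType) (alpha L u0 : R) (w : R -> R) : Prop :=
  [/\ L^-1 * (\int[lebesgue_measure]_(x in `[0, L]) w x) = u0,
      has_lbound (range w), has_ubound (range w),
      0 < inf (range w) & sup (range w) < alpha].

Definition profile_P3 (R : realType) (delta : R) (w : R -> R) : Prop :=
  forall a b x z, jump_free w a b -> a < x < b -> a < z < b ->
    derive1 w x <= - delta -> derive1 w z = derive1 w x.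

Definition admissible_profile (R : realType) (alpha delta L u0 : R)
    (w : R -> R) : Prop :=
  [/\ periodic_with L w, profile_P1 L w, profile_P2 alpha L u0 w
    & profile_P3 delta w].

(** * Weak solutions *)

Definition dt (R : realType) (phi : R -> R -> R) : R -> R -> R :=
  fun t x => derive1 (fun s => phi s x) t.

Definition dx (R : realType) (phi : R -> R -> R) : R -> R -> R :=
  fun t x => derive1 (phi t) x.

Fixpoint class_C (R : realType) (n : nat) (phi : R -> R -> R) : Prop :=
  continuous (fun p : R * R => phi p.1 p.2) /\
  match n with
  | 0%N => True
  | m.+1 =>
    [/\ (forall t x, derivable (fun s => phi s x) t 1),
        (forall t x, derivable (phi t) x 1),
        class_C m (dt phi) & class_C m (dx phi)]
  end.

(** Smooth functions with compact support in ]0, +oo[ x R. *)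
Definition test_function (R : realType) (phi : R -> R -> R) : Prop :=
  (forall n, class_C n phi) /\
  exists a b r, 0 < a /\
    forall t x, phi t x != 0 -> a <= t <= b /\ - r <= x <= r.

Definition weak_solution (R : realType) (delta L : R) (f g : R -> R)
    (init : R -> R) (u : R -> R -> R) : Prop :=
  let mu := @lebesgue_measure R in
  [/\ [/\ forall t, 0 <= t -> periodic_with L (u t),
          measurable_fun [set p : R * R | 0 <= p.1] (fun p => u p.1 p.2)
        & forall t, 0 <= t -> locally_integrable setT (u t)],
      (forall t a b, 0 <= t ->
        (\int[mu]_(x in `[a, b]) `|u s x - u t x|%:E)%E
          @[s --> within `[0, +oo[ (nbhs t)] --> 0%E),
      ae_eq mu setT (u 0) init
    & exists Theta : R * R -> R,
      [/\ measurable_fun setT Theta, forall p, 0 <= Theta p <= 1,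
          (forall t x, 0 < t -> derivable (u t) x 1 ->
            - delta < dx u t x -> Theta (t, x) = 1),
          (forall t x, 0 < t -> derivable (u t) x 1 ->
            dx u t x < - delta -> Theta (t, x) = 0)
        & forall phi, test_function phi ->
          \int[(mu \x mu)%E]_(p in [set p | 0 < p.1])
            (u p.1 p.2 * dt phi p.1 p.2
             + (Theta p * f (u p.1 p.2) + (1 - Theta p) * g (u p.1 p.2))
               * dx phi p.1 p.2) = 0]].

(** * Jump curves and spikes *)

Definition local_flux (R : realType) (delta : R) (f g w : R -> R) (x : R) : R :=
  if - delta < derive1 w x then f (w x) else g (w x).

(** [y] is a jump curve of [u]; the flux on each side is the one in force there. *)
Definition rankine_hugoniot (R : realType) (delta : R) (f g : R -> R)
    (u : R -> R -> R) (y : R -> R) (t : R) : Prop :=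
  derivable y t 1 /\
  exists ul ur Fl Fr,
    [/\ u t x @[x --> (y t)^'-] --> ul, u t x @[x --> (y t)^'+] --> ur,
        local_flux delta f g (u t) x @[x --> (y t)^'-] --> Fl,
        local_flux delta f g (u t) x @[x --> (y t)^'+] --> Fr
      & derive1 y t * (ur - ul) = Fr - Fl].

(** On ]a, b] the jumps of [u] are exactly those on the curves [y 0], ...,
    [y n.-1], up to translations by multiples of L.  A curve which is hit by
    another one coincides with it from then on; [s = a] is excluded because the
    two curves of a new spike start at the same point. *)
Definition jump_curves (R : realType) (delta L : R) (f g : R -> R)
    (u : R -> R -> R) (a b : R) (n : nat) (y : nat -> R -> R) : Prop :=
  [/\ (forall i, (i < n)%N -> [lipschitz (y i) s | s in `[a, b]]),
      (forall t, a < t <= b ->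
        jump_set (u t) =
          [set x | exists i (m : int), (i < n)%N /\ x = y i t + m%:~R * L]),
      (forall i k (m : int) s t, (i < n)%N -> (k < n)%N ->
        a < s -> s <= t -> t <= b ->
        y i s = y k s + m%:~R * L -> y i t = y k t + m%:~R * L)
    & {ae lebesgue_measure, forall t, a < t < b ->
        forall i, (i < n)%N -> rankine_hugoniot delta f g u (y i) t}].

(** Each jump of [u a] in one period is the origin of exactly one of the curves
    [y 0], ..., [y n.-1]. *)
Definition old_curves (R : realType) (L : R) (u : R -> R -> R) (a : R)
    (n : nat) (y : nat -> R -> R) : Prop :=
  set_bij `I_n (jump_set (u a) `&` `[0, L[) (fun i => y i a).

Definition prolonged_without_spike (R : realType) (delta L : R) (f g : R -> R)
    (u : R -> R -> R) (a b : R) : Prop :=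
  exists n y, old_curves L u a n y /\ jump_curves delta L f g u a b n y.

(** [y1] and [y2] bound a spike born at the point [X] at time [a]; [v] is the C^1
    solution of v_t + f(v)_x = 0, in a neighbourhood of (a, X), which continues
    the profile [u a]. *)
Definition spike_at (R : realType) (alpha beta : R) (f : R -> R)
    (u : R -> R -> R) (a X : R) (y1 y2 : R -> R) : Prop :=
  [/\ y1 a = X, y2 a = X
    & exists e r (v : R -> R -> R),
      [/\ 0 < e, 0 < r,
          (forall t x, `|t - a| < e -> `|x - X| < r ->
            [/\ derivable (fun s => v s x) t 1, derivable (v t) x 1,
                {for (t, x), continuous (fun p : R * R => dt v p.1 p.2)},
                {for (t, x), continuous (fun p : R * R => dx v p.1 p.2)}
              & dt v t x + derive1 (fun z => f (v t z)) x = 0]),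
          (forall x, `|x - X| < r -> v a x = u a x)
        & forall t, a < t < a + e ->
          [/\ y1 t < y2 t,
              (forall x, y1 t < x < y2 t ->
                u t x = alpha / 2 - (x - X) / (beta * (t - a)))
            & (forall x, `|x - X| < r -> x < y1 t \/ y2 t < x ->
                u t x = v t x)]]].

Definition prolonged_with_spike (R : realType) (alpha beta delta L : R)
    (f g : R -> R) (u : R -> R -> R) (a b X : R) : Prop :=
  exists n y, [/\ old_curves L u a n y, jump_curves delta L f g u a b n.+2 y
    & spike_at alpha beta f u a X (y n) (y n.+1)].

(** The solution determined by arrival times [0 = t 0 < t 1 < t 2 < ...] and
    positions [X 1, X 2, ...] ([X 0] plays no role).

    The last clause is what makes the equation
    u_t + [theta(u_x) f(u) + (1 - theta(u_x)) g(u)]_x = 0, in which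
    theta(-delta) is undefined, meaningful almost everywhere.  Without it the
    solution would not be unique: on an interval where u_x = -delta one could
    choose Theta so that Theta f(u) + (1 - Theta) g(u) is affine in u, and the
    slope could be kept equal to -delta for a positive time, instead of leaving
    that value at once along u_t + f(u)_x = 0. *)
Definition spike_solution (R : realType) (alpha beta delta L u0 : R)
    (f g : R -> R) (t X : nat -> R) (u : R -> R -> R) : Prop :=
  [/\ weak_solution delta L f g (cst u0) u,
      (forall s, 0 <= s -> admissible_profile alpha delta L u0 (u s)),
      (forall s x, 0 <= s <= t 1%N -> u s x = u0),
      (forall j, (0 < j)%N ->
        let free := derivable (u (t j)) (X j) 1 /\ - delta < dx u (t j) (X j) in
        (free -> prolonged_with_spike alpha beta delta L f g u
                   (t j) (t j.+1) (X j)) /\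
        (~ free -> prolonged_without_spike delta L f g u (t j) (t j.+1)))
    & (@lebesgue_measure R \x @lebesgue_measure R)%E.-negligible
        [set p | [/\ 0 < p.1, derivable (u p.1) p.2 1
                   & dx u p.1 p.2 = - delta]]].

(** * Random data *)

Definition mutually_independent d (T : measurableType d) (R : realType)
    (P : probability T R) (I : eqType) (Z : I -> T -> R) : Prop :=
  forall (s : seq I) (B : I -> set R), uniq s ->
    (forall i, measurable (B i)) ->
    P (\bigcap_(i in [set` s]) (Z i @^-1` B i)) =
      (\prod_(i <- s) P (Z i @^-1` B i))%E.

Definition interarrival (T : Type) (R : realType) (t : nat -> T -> R) (j : nat) :
    T -> R := fun w => t j.+1 w - t j w.

(** The increments [t j.+1 - t j] and the positions [X j.+1], for [j] a natural
    number, are altogether mutually independent. *)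
Definition poisson_data d (T : measurableType d) (R : realType)
    (P : probability T R) (lambda L : R) (L_gt0 : 0 < L)
    (t X : nat -> {RV P >-> R}) : Prop :=
  let increment := interarrival (fun j => t j : T -> R) in
  [/\ (forall w, t 0%N w = 0),
      (forall j s, 0 <= s ->
        P [set w | s < increment j w] = (expR (- (lambda * s)))%:E),
      (forall j B, measurable B ->
        distribution P (X j.+1) B = uniform_prob L_gt0 B)
    & mutually_independent P (fun k : nat + nat =>
        match k with inl j => increment j | inr j => X j.+1 : T -> R end)].

Definition random_solution d (T : measurableType d) (R : realType)
    (P : probability T R) (alpha beta delta L u0 : R) (f g : R -> R)
    (t X : nat -> {RV P >-> R}) (u : T -> R -> R -> R) : Prop :=
  {ae P, forall w, spike_solution alpha beta delta L u0 f g
    (fun j => t j w) (fun j => X j w) (u w)}.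

(* Main.v *)
(** Between two arrival times, each region bounded by jump curves carries either a
    classical solution of [u_t + f(u)_x = 0] or a profile of constant slope, at
    most [-delta], solving [u_t + g(u)_x = 0]; the change can only go from the
    second regime to the first.  Characteristics carrying the values [c1 > c2]
    move apart at speed at least [betas * (c1 - c2)] in both regimes, so that a
    decrease bound [th * (u x - u x') <= x' - x] on a region becomes
    [(th + betas * dt) * (u x - u x') <= x' - x] after a time [dt].  At time [s],
    this gives [betas * tau * (u x - u x') <= x' - x] on every region, except on
    those lying to the right of one of the two jumps produced by each of the [N]
    spikes inserted between [s - tau] and [s], where the decrease is at most [alpha].
    On a period the upward and downward variations are equal, hence
    [TV <= 2 * (L / (betas * tau) + 2 * alpha * N)].  For
    [tau = L / (alpha * betas)] this is [2 * alpha * (1 + 2 * N)].  Cutting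
    this time interval into nine pieces, memorylessness gives
    [E N <= 9 * (expR (lambda * tau / 9) - 1)], which is at most
    [expR (lambda * tau) / 2]. *)

Require Import Defs.
From HB Require Import structures.
From mathcomp Require Import all_boot all_order all_algebra.
From mathcomp Require Import all_classical all_reals all_analysis.
From mathcomp Require Import measurable_realfun ring lra zify.

Set Implicit Arguments.
Unset Strict Implicit.
Unset Printing Implicit Defensive.

Import Order.TTheory GRing.Theory Num.Theory.
Import numFieldNormedType.Exports.

Local Open Scope classical_set_scope.
Local Open Scope ring_scope.

(** * Smooth steps *)

(** The obstacle is time: profiles are regular in [x] at each fixed time, but in time only the weak
    equation and continuity in L^1 are available. Characteristics are recovered by testing the weak
    equation on thin strips moving at the speed [h'(c)], with [h] the flux in force and [c] the
    value carried; at that speed the flux error is quadratic, so the deviation from [c] along the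
    line is bounded by a small multiple of itself. A backward characteristic of [f] does not run
    into a jump, because [g <= f] and the concavity of [f] give the Rankine-Hugoniot speeds the
    right sign. With the flux [g] on the side of the region this sign is lost; characteristics of
    [g] are therefore followed for short times only, and the information is carried by the common
    slope [- k] of the region, through [d(1/k)/dt >= betas]. The value [delta] glues the two
    regimes: [k >= delta] up to the switch, slopes above [- delta] after it. On the probabilistic
    side the laws of the arrival times are never computed: tails and independence of the increments
    suffice. *)

Fixpoint smooth_upto (R : realType) (n : nat) (f : R -> R) : Prop :=
  match n with
  | 0%N => continuous f
  | m.+1 => exists f' : R -> R,
      (forall x : R, is_derive x 1 f (f' x)) /\ smooth_upto m f'
  end.

Lemma is_derive_continuous (R : realType) (f f' : R -> R) :
  (forall x : R, is_derive x 1 f (f' x)) -> continuous f.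
Proof.
move=> df x; apply: differentiable_continuous.
by apply/derivable1_diffP; have [] := df x.
Qed.

Lemma smooth_uptoW (R : realType) n (f : R -> R) :
  smooth_upto n.+1 f -> smooth_upto n f.
Proof.
elim: n f => [|n IH] f /=.
  by case=> f' [df _]; exact: is_derive_continuous df.
by case=> f' [df sf']; exists f'; split => //; exact: IH.
Qed.

Lemma smooth_upto_cst (R : realType) n (c : R) : smooth_upto n (fun=> c).
Proof.
elim: n c => [|n IH] c /=; first by move=> x; exact: cvg_cst.
by exists (fun=> 0); split; [move=> x; exact: is_derive_cst|exact: IH].
Qed.

Lemma smooth_uptoD (R : realType) n (f g : R -> R) :
  smooth_upto n f -> smooth_upto n g -> smooth_upto n (fun x => f x + g x).
Proof.
elim: n f g => [|n IH] f g /=.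
  by move=> cf cg x; apply: cvgD; [exact: cf|exact: cg].
move=> [f' [df sf']] [g' [dg sg']]; exists (fun x => f' x + g' x).
split; last exact: IH.
by move=> x; have := df x; have := dg x => ? ?; exact: is_deriveD.
Qed.

Lemma smooth_uptoM (R : realType) n (f g : R -> R) :
  smooth_upto n f -> smooth_upto n g -> smooth_upto n (fun x => f x * g x).
Proof.
elim: n f g => [|n IH] f g.
  by move=> cf cg x; apply: cvgM; [exact: cf|exact: cg].
move=> sf sg; have sf0 := smooth_uptoW sf; have sg0 := smooth_uptoW sg.
move: sf sg => [f' [df sf']] [g' [dg sg']].
exists (fun x => f x * g' x + g x * f' x).
split; last by apply: smooth_uptoD; exact: IH.
by move=> x; have := df x; have := dg x => ? ?; exact: is_deriveM.
Qed.

Lemma smooth_uptoZ (R : realType) n c (f : R -> R) :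
  smooth_upto n f -> smooth_upto n (fun x => c * f x).
Proof. by move=> sf; apply: smooth_uptoM => //; exact: smooth_upto_cst. Qed.

Lemma smooth_uptoV (R : realType) n (f : R -> R) :
  (forall x, f x != 0) ->
  smooth_upto n f -> smooth_upto n (fun x => (f x)^-1).
Proof.
move=> f0; elim: n => [|n IH].
  by move=> cf x; apply: cvgV; [exact: f0|exact: cf].
move=> sf; have := IH (smooth_uptoW sf); move: sf => [f' [df sf']] sV.
exists (fun x => -1 * f' x * ((f x)^-1 * (f x)^-1)); split.
  move=> x; apply: (is_derive_eq (is_deriveV (f0 x) (df x))).
  rewrite /GRing.scale/= expr2 invfM; ring.
apply: smooth_uptoM; first exact: smooth_uptoZ.
exact: smooth_uptoM.
Qed.

Lemma is_derive_affine (R : realType) (f : R -> R) (c d x df : R) :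
  is_derive (c * x + d) 1 f df -> is_derive x 1 (fun x => f (c * x + d)) (c * df).
Proof.
move=> H.
have H2 : is_derive x 1 (fun x => c * x + d) c.
  apply: is_derive_eq.
  by rewrite /GRing.scale/= mulr1 addr0.
exact: (is_derive_eq (@is_derive1_comp _ f (fun x => c * x + d) _ _ _ H H2) (mulrC _ _)).
Qed.

Lemma smooth_upto_affine (R : realType) n (f : R -> R) (c d : R) :
  smooth_upto n f -> smooth_upto n (fun x => f (c * x + d)).
Proof.
elim: n f => [|n IH] f.
  move=> cf x; apply: (cvg_comp (fun x => c * x + d) f); last exact: cf.
  by apply: cvgD; [apply: cvgM; [exact: cvg_cst|exact: cvg_id]|exact: cvg_cst].
move=> [f' [df sf']]; exists (fun x => c * f' (c * x + d)); split.
  by move=> x; exact: is_derive_affine.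
by apply: smooth_uptoZ; exact: IH.
Qed.

(** The classical flat function, times [x^-k]. The powers are included because differentiation maps
    the span of this family into itself, so that smoothness follows by one induction for all [k]. *)
Definition flat_exp (R : realType) (k : nat) (x : R) : R :=
  if 0 < x then x^-1 ^+ k * expR (- x^-1) else 0.

Lemma flat_exp_gt0 (R : realType) k (x : R) : 0 < x -> 0 < flat_exp k x.
Proof.
by move=> x0; rewrite /flat_exp x0 mulr_gt0 ?expR_gt0// exprn_gt0// invr_gt0.
Qed.

Lemma flat_exp_le0 (R : realType) k (x : R) : x <= 0 -> flat_exp k x = 0.
Proof. by rewrite /flat_exp ltNge => ->. Qed.

Lemma flat_exp_ge0 (R : realType) k (x : R) : 0 <= flat_exp k x.
Proof.
have [x0|x0] := ltP 0 x; first exact/ltW/flat_exp_gt0.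
by rewrite flat_exp_le0.
Qed.

(** One term of the exponential series, [y^(k+2) / (k+2)! <= exp y] at [y = 1/x]. A quadratic bound
    makes the difference quotient at [0] tend to [0]. *)
Lemma flat_exp_le (R : realType) k (x : R) : 0 <= x ->
  flat_exp k x <= k.+2`!%:R * x ^+ 2.
Proof.
rewrite le_eqVlt => /predU1P[<-|x0].
  by rewrite flat_exp_le0// mulr_ge0// sqr_ge0.
rewrite /flat_exp x0 expRN ler_pdivrMr ?expR_gt0//.
have y0 : 0 <= x^-1 by rewrite invr_ge0 ltW.
have := expR_ge1Dxn k.+1 y0 => h.
have xk : x^-1 ^+ k.+2 / k.+2`!%:R <= expR x^-1.
  by apply: le_trans h; rewrite lerDr.
have x2 : 0 < x ^+ 2 by rewrite exprn_gt0.
move: xk; rewrite ler_pdivrMr// -(ler_pM2l x2) => /le_trans xk.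
rewrite [leLHS](_ : _ = x ^+ 2 * x^-1 ^+ k.+2); last first.
  have xV : x * x^-1 = 1 by rewrite mulfV// gt_eqF.
  rewrite [x^-1 ^+ k.+2]exprS [x^-1 ^+ k.+1]exprS expr2 [RHS](_ : _ = (x * x^-1) * (x * x^-1) * x^-1 ^+ k).
    by rewrite !xV !mul1r.
  by ring.
apply: xk; rewrite [leLHS](_ : _ = k.+2`!%:R * x ^+ 2 * expR x^-1)//; ring.
Qed.

Lemma is_derive_flat_exp (R : realType) k (x : R) :
  is_derive x 1 (flat_exp k)
    (- k%:R * flat_exp k.+1 x + flat_exp k.+2 x).
Proof.
have [x0|x0|x0] := ltgtP x 0.
- have -> : - k%:R * flat_exp k.+1 x + flat_exp k.+2 x = 0.
    by rewrite !flat_exp_le0 ?ltW// mulr0 addr0.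
  apply: (@near_eq_is_derive _ _ _ (cst 0)).
  by near=> z; rewrite flat_exp_le0//; apply: ltW; near: z; exact: lt_nbhsl.
- apply: (@near_eq_is_derive _ _ _ (fun z : R => z^-1 ^+ k * expR (- z^-1) : R)).
    near=> z; rewrite /flat_exp ifT//; near: z; exact: lt_nbhsr.
  have xn0 : x != 0 by rewrite gt_eqF.
  have dV : is_derive x 1 (fun z : R => z^-1) (- x ^- 2).
    apply: is_derive_eq.
      by apply: is_deriveV.
    by rewrite scaler1.
  have dE : is_derive x 1 (fun z : R => expR (- z^-1)) (expR (- x^-1) * x ^- 2).
    have dN : is_derive x 1 (fun z : R => - z^-1) (x ^- 2).
      by apply: is_derive_eq; rewrite opprK.
    exact: (is_derive1_comp (is_derive_expR _) dN).
  have dX : is_derive x 1 (fun z : R => z^-1 ^+ k) (k%:R * x^-1 ^+ k.-1 * - x ^- 2).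
    rewrite (_ : (fun z => _) = (fun z : R => z^-1) ^+ k); last by rewrite exprfctE.
    exact: is_deriveX.
  apply: is_derive_eq.
  rewrite /GRing.scale/= /flat_exp x0 -!exprVn.
  case: k {dX} => [|k] /=; rewrite ?expr0 ?exprS; ring.
- rewrite x0 !flat_exp_le0// mulr0 addr0.
  have cv : (fun h : R => h^-1 *: ((flat_exp k \o shift 0) (h *: 1) - flat_exp k 0))
      @ (0 : R)^' --> (0 : R).
    rewrite flat_exp_le0//; apply/cvgrPdist_lep; near=> e.
    near=> h.
    rewrite sub0r normrN subr0 /= addr0 /GRing.scale/= mulr1 normrM normfV.
    rewrite (ger0_norm (flat_exp_ge0 _ _)).
    have [h0|h0] := lerP h 0.
      by rewrite flat_exp_le0// mulr0; near: e; exact: nbhs_right_ge.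
    rewrite (gtr0_norm h0) -[_ <= _]/((h : R)^-1 * flat_exp k h <= e :> R) ler_pdivrMl//.
    apply: (le_trans (flat_exp_le k (ltW h0))).
    rewrite expr2 mulrCA ler_pM2l// -ler_pdivlMl ?ltr0n ?fact_gt0//.
    apply: le_trans (ler_norm _) _; near: h.
    by apply: dnbhs0_le; rewrite mulr_gt0 ?invr_gt0 ?ltr0n ?fact_gt0.
  by apply: DeriveDef; [apply/cvg_ex; exists 0|exact/cvg_lim].
Unshelve. all: by end_near. Qed.

Lemma smooth_flat_exp (R : realType) n k : smooth_upto n (@flat_exp R k).
Proof.
elim: n k => [|n IH] k.
  exact: (@is_derive_continuous _ _ _ (is_derive_flat_exp k)).
exists (fun x => - k%:R * flat_exp k.+1 x + flat_exp k.+2 x); split.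
  by move=> x; exact: is_derive_flat_exp.
by apply: smooth_uptoD => //; exact: smooth_uptoZ.
Qed.

(** The usual quotient [F(x) / (F(x) + F(1 - x))], with [1 - x] written in the form expected by
    [smooth_upto_affine]. *)
Definition smooth_step (R : realType) (x : R) : R :=
  flat_exp 0 x * (flat_exp 0 x + flat_exp 0 (-1 * x + 1))^-1.

Lemma smooth_step_le0 (R : realType) (x : R) : x <= 0 -> smooth_step x = 0.
Proof. by move=> x0; rewrite /smooth_step flat_exp_le0// mul0r. Qed.

Lemma smooth_step_ge1 (R : realType) (x : R) : 1 <= x -> smooth_step x = 1.
Proof.
move=> x1; rewrite /smooth_step [X in _ + X]flat_exp_le0; last lra.
by rewrite addr0 mulfV// gt_eqF// flat_exp_gt0//; lra.
Qed.

Lemma smooth_smooth_step (R : realType) n : smooth_upto n (@smooth_step R).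
Proof.
apply: smooth_uptoM; first exact: smooth_flat_exp.
apply: smooth_uptoV => [x|].
  rewrite gt_eqF//; have [x0|x0] := ltP 0 x.
    by rewrite ltr_wpDr ?flat_exp_ge0 ?flat_exp_gt0.
  by rewrite ltr_wpDl ?flat_exp_ge0// flat_exp_gt0//; lra.
apply: smooth_uptoD; first exact: smooth_flat_exp.
by apply: smooth_upto_affine; exact: smooth_flat_exp.
Qed.

(** * Travelling test functions *)

Definition smooth (R : realType) (f : R -> R) := forall n, smooth_upto n f.

Lemma is_derive_derive1 (R : realType) (f : R -> R) (x l : R) :
  is_derive x 1 f l -> derive1 f x = l.
Proof. by move=> df; rewrite derive1E; case: df. Qed.

Lemma smooth_derivable (R : realType) (f : R -> R) : smooth f ->
  forall x : R, is_derive x 1 f (derive1 f x).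
Proof.
move=> /(_ 1%N) [f' [df _]] x.
by rewrite (is_derive_derive1 (df x)).
Qed.

Lemma smooth_derive1 (R : realType) (f : R -> R) : smooth f ->
  smooth (derive1 f).
Proof.
move=> sf n; have [f' [df sf']] := sf n.+1.
suff -> : derive1 f = f' by [].
by apply/funext => x; exact: is_derive_derive1.
Qed.

Lemma smooth_continuous (R : realType) (f : R -> R) : smooth f -> continuous f.
Proof. by move=> /(_ 0%N). Qed.

Lemma class_CD (R : realType) n (phi psi : R -> R -> R) :
  class_C n phi -> class_C n psi -> class_C n (fun t x => phi t x + psi t x).
Proof.
elim: n phi psi => [|n IH] phi psi /=.
  move=> [cphi _] [cpsi _]; split => // p.
  by apply: cvgD; [exact: cphi|exact: cpsi].
move=> [cphi [p1 p2 p3 p4]] [cpsi [q1 q2 q3 q4]].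
split; first by move=> p; apply: cvgD; [exact: cphi|exact: cpsi].
split.
- by move=> t x; apply: derivableD; [exact: p1|exact: q1].
- by move=> t x; apply: derivableD; [exact: p2|exact: q2].
- rewrite (_ : dt _ = fun t x => dt phi t x + dt psi t x); first exact: IH.
  apply/funext => t; apply/funext => x; rewrite /dt !derive1E.
  by rewrite [LHS]deriveD; [|exact: p1|exact: q1].
- rewrite (_ : dx _ = fun t x => dx phi t x + dx psi t x); first exact: IH.
  apply/funext => t; apply/funext => x; rewrite /dx !derive1E.
  by rewrite [LHS]deriveD; [|exact: p2|exact: q2].
Qed.

Lemma class_CZ (R : realType) n (c : R) (phi : R -> R -> R) :
  class_C n phi -> class_C n (fun t x => c * phi t x).
Proof.
elim: n phi => [|n IH] phi /=.
  move=> [cphi _]; split => // p.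
  by apply: cvgM; [exact: cvg_cst|exact: cphi].
move=> [cphi [p1 p2 p3 p4]].
split; first by move=> p; apply: cvgM; [exact: cvg_cst|exact: cphi].
split.
- by move=> t x; apply: derivableZ; exact: p1.
- by move=> t x; apply: derivableZ; exact: p2.
- rewrite (_ : dt _ = fun t x => c * dt phi t x); first exact: IH.
  apply/funext => t; apply/funext => x; rewrite /dt !derive1E.
  by rewrite [LHS]deriveZ; [|exact: p1].
- rewrite (_ : dx _ = fun t x => c * dx phi t x); first exact: IH.
  apply/funext => t; apply/funext => x; rewrite /dx !derive1E.
  by rewrite [LHS]deriveZ; [|exact: p2].
Qed.

(** A profile [b] carried at speed [sg] and modulated in time by [a]. Both partial derivatives are
    combinations of functions of the same form, whence [class_C n] for every [n] by induction. *)
Definition travelling (R : realType) (a b : R -> R) (sg d : R) : R -> R -> R :=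
  fun t x => a t * b (x - sg * t + d).

Lemma is_derive_travelling_dt (R : realType) (a b : R -> R) (sg d t x : R) :
  smooth a -> smooth b ->
  is_derive t 1 (fun s => travelling a b sg d s x)
    (travelling (derive1 a) b sg d t x + - sg * travelling a (derive1 b) sg d t x).
Proof.
move=> sa sb.
have da := smooth_derivable sa t.
have db : is_derive t 1 (fun s : R => b (x - sg * s + d))
    (- sg * derive1 b (x - sg * t + d)).
  have -> : (fun s : R => b (x - sg * s + d)) = fun s => b (- sg * s + (x + d)).
    by apply/funext => s; congr b; ring.
  have -> : x - sg * t + d = - sg * t + (x + d) by ring.
  by apply: is_derive_affine; exact: smooth_derivable.
apply: (is_derive_eq (is_deriveM da db)).
rewrite /travelling /GRing.scale/=; ring.
Qed.

Lemma is_derive_travelling_dx (R : realType) (a b : R -> R) (sg d t x : R) :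
  smooth b ->
  is_derive x 1 (travelling a b sg d t) (travelling a (derive1 b) sg d t x).
Proof.
move=> sb.
have db : is_derive x 1 (fun y : R => b (y - sg * t + d))
    (derive1 b (x - sg * t + d)).
  have -> : (fun y : R => b (y - sg * t + d)) = fun y => b (1 * y + (- sg * t + d)).
    by apply/funext => s; congr b; ring.
  have -> : x - sg * t + d = 1 * x + (- sg * t + d) by ring.
  rewrite -[X in is_derive _ _ _ X]mul1r.
  by apply: is_derive_affine; exact: smooth_derivable.
exact: (is_deriveZ (a t) db).
Qed.

Lemma dt_travelling (R : realType) (a b : R -> R) (sg d : R) :
  smooth a -> smooth b ->
  dt (travelling a b sg d) = fun t x =>
    travelling (derive1 a) b sg d t x + - sg * travelling a (derive1 b) sg d t x.
Proof.
move=> sa sb; apply/funext => t; apply/funext => x.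
exact/is_derive_derive1/is_derive_travelling_dt.
Qed.

Lemma dx_travelling (R : realType) (a b : R -> R) (sg d : R) :
  smooth b ->
  dx (travelling a b sg d) = travelling a (derive1 b) sg d.
Proof.
move=> sb; apply/funext => t; apply/funext => x.
exact/is_derive_derive1/is_derive_travelling_dx.
Qed.

Lemma continuous_travelling (R : realType) (a b : R -> R) (sg d : R) :
  continuous a -> continuous b ->
  continuous (fun p : R * R => travelling a b sg d p.1 p.2).
Proof.
move=> ca cb p; apply: cvgM.
  by apply: (cvg_comp _ _ cvg_fst); exact: ca.
apply: (cvg_comp (fun p : R * R => p.2 - sg * p.1 + d) b); last exact: cb.
apply: cvgD; last exact: cvg_cst.
apply: cvgB; first exact: cvg_snd.
by apply: cvgM; [exact: cvg_cst|exact: cvg_fst].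
Qed.

Lemma class_C_travelling (R : realType) n (a b : R -> R) (sg d : R) :
  smooth a -> smooth b -> class_C n (travelling a b sg d).
Proof.
elim: n a b => [|n IH] a b sa sb /=.
  by split => //; apply: continuous_travelling; exact: smooth_continuous.
split; first by apply: continuous_travelling; exact: smooth_continuous.
split.
- by move=> t x; have [] := is_derive_travelling_dt sg d t x sa sb.
- by move=> t x; have [] := is_derive_travelling_dx a sg d t x sb.
- rewrite dt_travelling//; apply: class_CD; last apply: class_CZ.
    by apply: IH => //; exact: smooth_derive1.
  by apply: IH => //; exact: smooth_derive1.
- by rewrite dx_travelling//; apply: IH => //; exact: smooth_derive1.
Qed.

Lemma smooth_affine (R : realType) (f : R -> R) (c d : R) :
  smooth f -> smooth (fun x => f (c * x + d)).
Proof. by move=> sf n; exact: smooth_upto_affine. Qed.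

Lemma smoothD (R : realType) (f g : R -> R) :
  smooth f -> smooth g -> smooth (fun x => f x + g x).
Proof. by move=> sf sg n; exact: smooth_uptoD. Qed.

Lemma smoothZ (R : realType) (c : R) (f : R -> R) :
  smooth f -> smooth (fun x => c * f x).
Proof. by move=> sf n; exact: smooth_uptoZ. Qed.

Lemma derive1_smooth_step_out (R : realType) (x : R) :
  x < 0 \/ 1 < x -> derive1 (@smooth_step R) x = 0.
Proof.
move=> x01; apply: is_derive_derive1.
case: x01 => x01.
  apply: (@near_eq_is_derive _ _ _ (cst 0)).
  by near=> z; rewrite smooth_step_le0//; apply: ltW; near: z; exact: lt_nbhsl.
apply: (@near_eq_is_derive _ _ _ (cst (1 : R))).
by near=> z; rewrite smooth_step_ge1//; apply: ltW; near: z; exact: lt_nbhsr.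
Unshelve. all: by end_near. Qed.

Lemma continuous_bounded_segment (R : realType) (f : R -> R) (a b : R) :
  continuous f -> exists2 C : R, 0 <= C & forall x, a <= x <= b -> `|f x| <= C.
Proof.
move=> cf; have [ab|ba] := leP a b; last first.
  exists 0 => // x /andP[ax xb].
  by have := lt_le_trans ba (le_trans ax xb); rewrite ltxx.
have cnf : {within `[a, b], continuous (fun x => `|f x|)}.
  apply: continuous_subspaceT => x.
  by apply: cvg_norm; exact: cf.
have [c _ cmax] := EVT_max ab cnf.
exists `|f c| => // x axb; apply: cmax.
Qed.

Lemma derive_near_cst (R : realType) (f : R -> R) (c x : R) :
  (\forall z \near x, f z = c) -> derive1 f x = 0.
Proof.
move=> fc; apply: is_derive_derive1.
apply: (@near_eq_is_derive _ _ _ (cst c)).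
by near=> z; apply/esym; near: z.
Unshelve. all: by end_near. Qed.

(** Outside [[0, 1]] the step is constant, so compactness suffices. This one constant serves every
    later rescaling of the step. *)
Lemma smooth_step_bounded (R : realType) : exists2 C : R, 0 < C &
  forall x, [/\ `|smooth_step x| <= C, `|derive1 (@smooth_step R) x| <= C &
    `|derive1 (derive1 (@smooth_step R)) x| <= C].
Proof.
have s0 : smooth (@smooth_step R) by move=> n; exact: smooth_smooth_step.
have s1 := smooth_derive1 s0; have s2 := smooth_derive1 s1.
have [C0 C0p H0] := continuous_bounded_segment 0 1 (smooth_continuous s0).
have [C1 C1p H1] := continuous_bounded_segment 0 1 (smooth_continuous s1).
have [C2 C2p H2] := continuous_bounded_segment 0 1 (smooth_continuous s2).
exists (1 + C0 + C1 + C2); first by lra.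
move=> x; have [/andP[x0 x1]|] := boolP (0 <= x <= 1).
  have x01 : 0 <= x <= 1 by rewrite x0.
  by have := H0 _ x01; have := H1 _ x01; have := H2 _ x01; split; lra.
rewrite negb_and -!ltNge => /orP x01.
have d0 := derive1_smooth_step_out x01.
have -> : derive1 (derive1 (@smooth_step R)) x = 0.
  apply: (@derive_near_cst _ _ 0); case: x01 => x01; near=> z.
    by apply: derive1_smooth_step_out; left; near: z; exact: lt_nbhsl.
  by apply: derive1_smooth_step_out; right; near: z; exact: lt_nbhsr.
have C_ge0 : 0 <= 1 + C0 + C1 + C2 :> R by lra.
rewrite d0 normr0; split => //.
case: x01 => x01; [rewrite smooth_step_le0 ?(ltW x01)//|rewrite smooth_step_ge1 ?(ltW x01)//].
  by rewrite normr0; lra.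
by rewrite normr1; lra.
Unshelve. all: by end_near. Qed.

(** * The weak equation tested along a moving strip *)

(** The bound is required almost everywhere on [K] only, because the flux is known off a null
    set. *)
Lemma le_integral_supported d (T : measurableType d) (R : realType)
    (mu : {measure set T -> \bar R}) (D K : set T) (f : T -> R) (M : R) :
  measurable D -> measurable K -> K `<=` D -> measurable_fun D f ->
  (forall x, D x -> ~ K x -> f x = 0) -> 0 <= M ->
  {ae mu, forall x, K x -> `|f x| <= M} ->
  (\int[mu]_(x in D) `|(f x)%:E| <= M%:E * mu K)%E.
Proof.
move=> mD mK KD mf f0 M0 fM.
have -> : (\int[mu]_(x in D) `|(f x)%:E| = \int[mu]_(x in K) `|(f x)%:E|)%E.
  rewrite integral_mkcond [RHS]integral_mkcond; apply: eq_integral => x _.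
  rewrite !patchE; case: ifPn => [|xD]; case: ifPn => //.
    by move=> /negP xK /set_mem xD; rewrite f0 ?abse0// => /mem_set.
  by move=> /set_mem /KD /mem_set; rewrite (negbTE xD).
apply: integral_le_bound => //.
  by apply/measurable_EFinP; exact: measurable_funS mf.
Qed.

(** The line through [(t0, x0)] is the left edge of the strip and not its axis, since the derivative
    of the smooth step lives on [[0, 1]]. *)
Definition strip (R : realType) (l r x0 t0 sg eta : R) : set (R * R) :=
  [set p | l <= p.1 <= r /\
    x0 + sg * (p.1 - t0) <= p.2 <= x0 + sg * (p.1 - t0) + eta].

Section strip.
Context {R : realType}.
Notation mu := (@lebesgue_measure R).

Lemma measurable_affine_fst (x0 t0 sg : R) :
  measurable_fun setT (fun p : measurableTypeR R * measurableTypeR R =>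
    p.2 - (x0 + sg * (p.1 - t0))).
Proof.
apply: measurable_funB; first exact: measurable_snd.
apply: measurable_funD => //; apply: measurable_funM => //.
by apply: measurable_funB => //; exact: measurable_fst.
Qed.

Lemma measurable_strip (l r x0 t0 sg eta : R) :
  measurable (strip l r x0 t0 sg eta : set (measurableTypeR R * measurableTypeR R)).
Proof.
have -> : strip l r x0 t0 sg eta = (fst @^-1` `[l, r]) `&`
    ((fun p => p.2 - (x0 + sg * (p.1 - t0))) @^-1` `[0, eta]).
  apply/seteqP; split => p /=; rewrite /strip /= !in_itv/=.
    by move=> [h1 /andP[h2 h3]]; split => //; apply/andP; split; lra.
  by move=> [h1 /andP[h2 h3]]; split => //; apply/andP; split; lra.
apply: measurableI; rewrite -[X in measurable X]setTI.
  by apply: (measurable_fst measurableT); exact: measurable_itv.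
by apply: (measurable_affine_fst x0 t0 sg measurableT); exact: measurable_itv.
Qed.

Lemma measure_strip (l r x0 t0 sg eta : R) : l <= r -> 0 <= eta ->
  (mu \x mu)%E (strip l r x0 t0 sg eta) = ((r - l) * eta)%:E.
Proof.
move=> lr eta0; rewrite /product_measure1.
under eq_integral => t _.
  rewrite (_ : (mu \o _) t = ((eta * \1_`[l, r] t)%:E))%E; last first.
    rewrite /= indicE; have [tlr|tlr] := boolP (t \in `[l, r]%classic).
      rewrite mulr1 (_ : xsection _ _ =
        `[x0 + sg * (t - t0), x0 + sg * (t - t0) + eta]%classic).
        rewrite lebesgue_measure_itv/= lte_fin; case: ifPn.
          by rewrite -EFinB => _; congr EFin; ring.
        by rewrite -leNgt => h; congr EFin; lra.
      apply/seteqP; split => x; rewrite /xsection /= in_itv/=.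
        by move=> /set_mem [].
      move=> h; apply/mem_set; split => //.
      by move: tlr; rewrite inE/= in_itv.
    rewrite mulr0 (_ : xsection _ _ = set0) ?measure0//.
    rewrite -subset0 => x; rewrite /xsection /= => /set_mem [/= h _].
    by move: tlr => /negP; apply; rewrite inE/= in_itv.
  over.
rewrite /=; under eq_integral do rewrite EFinM.
rewrite integralZl//=; last exact: integrable_indic_itv.
rewrite integral_indic//= setIT lebesgue_measure_itv/= lte_fin.
case: ifPn => [_|]; first by rewrite -EFinB -EFinM mulrC.
rewrite -leNgt => h; have E : r = l by lra.
by rewrite E subrr mul0r mule0.
Qed.

End strip.

Lemma Rintegral_supported d (T : measurableType d) (R : realType)
    (mu : {measure set T -> \bar R}) (D K : set T) (f : T -> R) (M m : R) :
  measurable D -> measurable K -> K `<=` D -> measurable_fun D f ->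
  (forall x, D x -> ~ K x -> f x = 0) -> 0 <= M -> mu K = m%:E ->
  {ae mu, forall x, K x -> `|f x| <= M} ->
  mu.-integrable D (EFin \o f) /\ `|\int[mu]_(x in D) f x| <= M * m.
Proof.
move=> mD mK KD mf f0 M0 muK fM.
have ub := le_integral_supported mD mK KD mf f0 M0 fM.
have intf : mu.-integrable D (EFin \o f).
  apply/integrableP; split; first exact/measurable_EFinP.
  by apply: le_lt_trans ub _; rewrite muK -EFinM ltry.
split => //.
rewrite -lee_fin EFin_normr_Rintegral// EFinM -muK.
apply: le_trans ub; apply: le_abse_integral => //.
exact/measurable_EFinP.
Qed.

Section fubini_travelling.
Context {R : realType}.
Notation mu := (@lebesgue_measure R).

Lemma integral_derive_supported (F f : R -> R) (l r : R) : l < r ->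
  (forall x : R, is_derive x 1 F (f x)) -> continuous f ->
  (forall x, ~ (l <= x <= r) -> f x = 0) ->
  (\int[mu]_x (f x)%:E = (F r - F l)%:E)%E.
Proof.
move=> lr dF cf f0.
have -> : (\int[mu]_x (f x)%:E = \int[mu]_(x in `[l, r]) (f x)%:E)%E.
  rewrite [RHS]integral_mkcond; apply: eq_integral => x _.
  rewrite patchE; case: ifPn => // /negP xlr; rewrite f0// => h; apply: xlr.
  by rewrite inE /= in_itv.
have cF := is_derive_continuous dF.
rewrite (@continuous_FTC2 _ f F)//.
- exact: continuous_subspaceT.
- split.
  + by move=> x _; have [] := dF x.
  + by apply: cvg_at_right_filter; exact: cF.
  + by apply: cvg_at_left_filter; exact: cF.
- by move=> x _; exact: is_derive_derive1.
Qed.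

(** By Fubini the integral in [x] comes first, and it equals [P eta - P 0] on every time slice. The
    lemma is used with [P] a rescaled step, where this is [1], and with [P] a bump vanishing at both
    ends, where it is [0]. *)
Lemma integral_travelling (al P : R -> R) (x0 t0 sg eta l r Ma : R) :
  0 < eta -> 0 < l -> l <= r -> measurable_fun setT al -> smooth P ->
  (forall t, `|al t| <= Ma) ->
  (forall t, ~ (l <= t <= r) -> al t = 0) ->
  (forall y, ~ (0 <= y <= eta) -> derive1 P y = 0) ->
  let f := fun p : R * R =>
    al p.1 * derive1 P (p.2 - (x0 + sg * (p.1 - t0))) in
  (mu \x mu)%E.-integrable [set p : R * R | 0 < p.1] (EFin \o f) /\
  (\int[(mu \x mu)%E]_(p in [set p : R * R | (0 < p.1)%R]) (f p)%:E =
   \int[mu]_t (al t * (P eta - P 0))%:E)%E.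
Proof.
move=> eta0 l0 lr mal sP alM al0 P0 f.
have sP' := smooth_derive1 sP.
have [C0 C00 HC0] := continuous_bounded_segment 0 eta (smooth_continuous sP').
have PC y : `|derive1 P y| <= C0.
  have [/HC0//|/negP h] := boolP (0 <= y <= eta).
  by rewrite P0 ?normr0.
have Ma0 : 0 <= Ma by apply: le_trans (normr_ge0 _) (alM 0).
have mf : measurable_fun setT
    (f : measurableTypeR R * measurableTypeR R -> R).
  apply: measurable_funM.
    exact: (measurableT_comp mal measurable_fst).
  apply: (@measurableT_comp _ _ _ _ _ _ (derive1 P)); last exact: measurable_affine_fst.
  exact: (continuous_measurable_fun (smooth_continuous sP')).
have f0 p : ~ strip l r x0 t0 sg eta p -> f p = 0.
  move=> nK; rewrite /f.
  have [tlr|/negP tlr] := boolP (l <= p.1 <= r); last by rewrite al0 ?mul0r.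
  rewrite P0 ?mulr0// => /andP[h1 h2]; apply: nK; split => //.
  by apply/andP; split; lra.
have fM p : `|f p| <= Ma * C0.
  by rewrite normrM ler_pM.
have mK := measurable_strip l r x0 t0 sg eta.
have muK := measure_strip x0 t0 sg lr (ltW eta0).
have [intT _] : (mu \x mu)%E.-integrable setT (EFin \o f) /\
    `|\int[(mu \x mu)%E]_(x in setT) f x| <= Ma * C0 * ((r - l) * eta).
  apply: (Rintegral_supported measurableT mK _ mf) => //.
  - by move=> p _; exact: f0.
  - exact: mulr_ge0.
  - by apply: aeW => p _; exact: fM.
have mD0 : measurable ([set p : R * R | 0 < p.1] : set (measurableTypeR R * measurableTypeR R)).
  have -> : [set p : R * R | 0 < p.1] = setT `&` (fst @^-1` `]0, +oo[).
    by apply/seteqP; split => p /=; rewrite in_itv/= andbT//; move=> [].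
  exact: (measurable_fst measurableT).
split; first by apply: integrableS intT.
have -> : (\int[(mu \x mu)%E]_(p in [set p : R * R | (0 < p.1)%R]) (f p)%:E =
  \int[(mu \x mu)%E]_p (f p)%:E)%E.
  rewrite integral_mkcond; apply: eq_integral => p _.
  rewrite patchE; case: ifPn => // /negP pD; rewrite f0// => -[/andP[lp _] _].
  by apply: pD; rewrite inE/=; exact: lt_le_trans lp.
rewrite -(@integral12_prod_meas1 _ _ _ _ R mu mu _ intT).
apply: eq_integral => t _; rewrite /fubini_F /f /=.
set xi := x0 + sg * (t - t0).
have dP (y : R) : is_derive y 1 (fun y => al t * P (y - xi)) (al t * derive1 P (y - xi)).
  have := smooth_derivable sP (1 * y - xi) => /is_derive_affine; rewrite !mul1r => h.
  have -> : (fun y => al t * P (y - xi)) = fun y => al t * P (1 * y - xi).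
    by apply/funext => z; rewrite mul1r.
  exact: (is_deriveZ (al t) h).
rewrite (@integral_derive_supported (fun y => al t * P (y - xi)) _ xi (xi + eta))//.
- by rewrite subrr addrAC subrr add0r mulrBr.
- lra.
- move=> y; apply: cvgM; first exact: cvg_cst.
  apply: (cvg_comp (fun y => y - xi) (derive1 P)); last exact: smooth_continuous.
  by apply: cvgB; [exact: cvg_id|exact: cvg_cst].
- move=> y h; rewrite P0 ?mulr0// => /andP[h1 h2]; apply: h.
  by apply/andP; split; lra.
Qed.

End fubini_travelling.

Lemma derive2_smooth_step_out (R : realType) (x : R) :
  x < 0 \/ 1 < x -> derive1 (derive1 (@smooth_step R)) x = 0.
Proof.
move=> x01; apply: (@derive_near_cst _ _ 0); case: x01 => x01; near=> z.
  by apply: derive1_smooth_step_out; left; near: z; exact: lt_nbhsl.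
by apply: derive1_smooth_step_out; right; near: z; exact: lt_nbhsr.
Unshelve. all: by end_near. Qed.

Lemma derive1_smooth_step0 (R : realType) : derive1 (@smooth_step R) 0 = 0.
Proof.
have /smooth_derive1/smooth_continuous c : smooth (@smooth_step R).
  by move=> n; exact: smooth_smooth_step.
have h1 : derive1 (@smooth_step R) @ (0 : R)^'- --> derive1 (@smooth_step R) 0.
  by apply: cvg_at_left_filter; exact: c.
have h2 : (fun=> 0 : R) @ (0 : R)^'- --> (0 : R) by exact: cvg_cst.
rewrite -(cvg_lim _ h1)//; apply: cvg_lim => //; apply: cvg_trans h2; apply: near_eq_cvg; near=> z.
by rewrite derive1_smooth_step_out//; left; near: z; exact: nbhs_left_lt.
Unshelve. all: by end_near. Qed.

Lemma derive1_smooth_step1 (R : realType) : derive1 (@smooth_step R) 1 = 0.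
Proof.
have /smooth_derive1/smooth_continuous c : smooth (@smooth_step R).
  by move=> n; exact: smooth_smooth_step.
have h1 : derive1 (@smooth_step R) @ (1 : R)^'+ --> derive1 (@smooth_step R) 1.
  by apply: cvg_at_right_filter; exact: c.
have h2 : (fun=> 0 : R) @ (1 : R)^'+ --> (0 : R) by exact: cvg_cst.
rewrite -(cvg_lim _ h1)//; apply: cvg_lim => //; apply: cvg_trans h2; apply: near_eq_cvg; near=> z.
by rewrite derive1_smooth_step_out//; right; near: z; exact: nbhs_right_gt.
Unshelve. all: by end_near. Qed.

Lemma smooth_step_smooth (R : realType) : smooth (@smooth_step R).
Proof. by move=> n; exact: smooth_smooth_step. Qed.

Lemma is_derive_mulr_cst (R : realType) (f : R -> R) (c x l : R) :
  is_derive x 1 f l -> is_derive x 1 (fun t => f t * c) (l * c).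
Proof.
move=> df; have h := is_derive_cst c x 1.
apply: (is_derive_eq (is_deriveM df h)).
by rewrite scaler0 add0r /GRing.scale/= mulrC.
Qed.

Lemma measurable_travelling (R : realType) (a b : R -> R) (sg d : R) :
  continuous a -> continuous b ->
  measurable_fun setT (fun p : measurableTypeR R * measurableTypeR R =>
    travelling a b sg d p.1 p.2).
Proof.
move=> ca cb; apply: measurable_funM.
  exact: (measurableT_comp (continuous_measurable_fun ca) measurable_fst).
apply: (@measurableT_comp _ _ _ _ _ _ b); first exact: continuous_measurable_fun.
apply: measurable_funD => //; apply: measurable_funB; first exact: measurable_snd.
by apply: measurable_funM => //; exact: measurable_fst.
Qed.

Section weak_line.
Context {R : realType}.
Notation mu := (@lebesgue_measure R).
Notation S := (@smooth_step R).
Notation D0 := [set p : R * R | 0 < p.1].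

Lemma measurable_pos_time :
  measurable ([set p : R * R | 0 < p.1] : set (measurableTypeR R * measurableTypeR R)).
Proof.
have -> : [set p : R * R | 0 < p.1] = setT `&` (fst @^-1` `]0, +oo[).
  by apply/seteqP; split => p /=; rewrite in_itv/= andbT//; move=> [].
exact: (measurable_fst measurableT).
Qed.

Definition ramp (c e t : R) : R := S (e^-1 * t + - (c / e)).

Lemma smooth_ramp c e : smooth (ramp c e).
Proof. exact/smooth_affine/smooth_step_smooth. Qed.

Lemma ramp_le (c e t : R) : 0 < e -> t <= c -> ramp c e t = 0.
Proof.
move=> e0 tc; rewrite /ramp smooth_step_le0// mulrC -mulrBl.
by rewrite pmulr_lle0 ?invr_gt0//; lra.
Qed.

Lemma ramp_ge (c e t : R) : 0 < e -> c + e <= t -> ramp c e t = 1.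
Proof.
move=> e0 tc; rewrite /ramp smooth_step_ge1// mulrC -mulrBl.
by rewrite ler_pdivlMr// mul1r; lra.
Qed.

Lemma derive1_ramp (c e t : R) :
  derive1 (ramp c e) t = e^-1 * derive1 S (e^-1 * t + - (c / e)).
Proof.
apply: is_derive_derive1; apply: is_derive_affine.
exact/smooth_derivable/smooth_step_smooth.
Qed.

Lemma derive1_ramp_out (c e t : R) : 0 < e -> ~ (c <= t <= c + e) ->
  derive1 (ramp c e) t = 0.
Proof.
move=> e0 tc; rewrite derive1_ramp derive1_smooth_step_out ?mulr0//.
rewrite mulrC -mulrBl; have [ct|ct] := leP c t; last first.
  by left; rewrite pmulr_llt0 ?invr_gt0//; lra.
right; rewrite ltr_pdivlMr// mul1r; have [//|h] := ltP e (t - c).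
by exfalso; apply: tc; rewrite ct; lra.
Qed.

Lemma derive1_scaled_step (e y : R) :
  derive1 (fun y => e^-1 * derive1 S (e^-1 * y + 0)) y =
  e^-1 * (e^-1 * derive1 (derive1 S) (e^-1 * y)).
Proof.
apply: is_derive_derive1.
have h : is_derive y 1 (fun y => derive1 S (e^-1 * y + 0))
   (e^-1 * derive1 (derive1 S) (e^-1 * y)).
  rewrite -[X in derive1 (derive1 S) X]addr0; apply: is_derive_affine.
  exact/smooth_derivable/smooth_derive1/smooth_step_smooth.
exact: (is_deriveZ e^-1 h).
Qed.

(** Each error is a height times the area of a piece of the strip. The area cancels [1 / eps] and
    one factor [1 / eta]; the factor that remains in front of [e2] comes from the second derivative
    of the step. *)
Lemma weak_line_bound (eps eta C0 I1 I2 I3 e1 e2 s1 s2 : R) :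
  0 < eps -> 0 < eta ->
  `|I1| <= e1 * (C0 / eps * (C0 / eta)) * ((s1 - (s1 - eps)) * eta) ->
  `|I2| <= e1 * (C0 / eps * (C0 / eta)) * ((s2 + eps - s2) * eta) ->
  `|I3| <= e2 * (2 * C0 * (C0 / eta / eta)) * ((s2 + eps - (s1 - eps)) * eta) ->
  `|I1 + I2 + I3| <= (2 * C0 * C0) *
    (e1 + e2 / eta * (s2 - s1 + 2 * eps)).
Proof.
move=> eps0 eta0 b1 b2 b3.
have en : eps != 0 by rewrite gt_eqF.
have etn : eta != 0 by rewrite gt_eqF.
rewrite (le_trans (ler_normD _ _))//.
apply: le_trans (lerD (le_trans (ler_normD _ _) (lerD b1 b2)) b3) _.
rewrite le_eqVlt; apply/orP; left; apply/eqP.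
by field; rewrite en etn.
Qed.

(* Tested against a plateau in time times the approximate identity
   [S' ((x - x0 - sg * (t - t0)) / eta) / eta], [S] being the smooth step. *)
Lemma weak_line_estimate : exists2 C : R, 0 < C &
  forall (A B : R -> R -> R) (H w : R -> R)
    (x0 t0 sg s1 s2 eps eta e1 e2 M V1 V2 : R) (N : set (R * R)),
  let K := strip (s1 - eps) (s2 + eps) x0 t0 sg eta in
  0 < eps -> 0 < eta -> s1 < s2 -> 0 < s1 - eps ->
  0 <= e1 -> 0 <= e2 -> 0 <= M ->
  measurable_fun D0 (fun p => A p.1 p.2) ->
  measurable_fun D0 (fun p => B p.1 p.2) ->
  (forall phi, test_function phi ->
    \int[(mu \x mu)%E]_(p in D0)
      (A p.1 p.2 * dt phi p.1 p.2 + B p.1 p.2 * dx phi p.1 p.2) = 0) ->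
  continuous w -> (mu \x mu)%E.-negligible N ->
  (forall p, K p -> `|A p.1 p.2| <= M /\ `|B p.1 p.2| <= M) ->
  (forall p, K p -> ~ N p -> B p.1 p.2 = H (A p.1 p.2)) ->
  (forall p, K p -> p.1 <= s1 -> `|A p.1 p.2 - V1| <= e1) ->
  (forall p, K p -> s2 <= p.1 -> `|A p.1 p.2 - V2| <= e1) ->
  (forall p, K p -> `|H (A p.1 p.2) - sg * A p.1 p.2 - w p.1| <= e2) ->
  `|V1 - V2| <= C * (e1 + e2 / eta * (s2 - s1 + 2 * eps)).
Proof.
have [C0 C00 HC0] := smooth_step_bounded R.
exists (2 * C0 * C0); first by rewrite !mulr_gt0.
move=> A B H w x0 t0 sg s1 s2 eps eta e1 e2 M V1 V2 N K.
move=> eps0 eta0 s12 s10 e10 e20 M0 mA mB weak cw nN boundAB BH A1 A2 Hw.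
have l1 : s1 - eps <= s1 by rewrite gerBl ltW.
have l2 : s2 <= s2 + eps by rewrite lerDl ltW.
have l3 : s1 - eps < s2 by exact: le_lt_trans l1 s12.
have l4 : s1 < s2 + eps by exact: lt_le_trans s12 l2.
have l12 : s1 - eps < s2 + eps by exact: lt_le_trans l3 l2.
have s12' := ltW l12.
pose a1 := ramp (s1 - eps) eps; pose a2 := ramp s2 eps.
pose a := fun t => a1 t + -1 * a2 t.
have sa1 : smooth a1 by exact: smooth_ramp.
have sa2 : smooth a2 by exact: smooth_ramp.
have sa : smooth a by apply: smoothD => //; exact: smoothZ.
pose P := fun y => S (eta^-1 * y + 0).
have sP : smooth P by exact/smooth_affine/smooth_step_smooth.
pose b := fun y => eta^-1 * derive1 S (eta^-1 * y + 0).
have sb : smooth b.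
  by apply: smoothZ; apply: smooth_affine; exact/smooth_derive1/smooth_step_smooth.
have dP : derive1 P = b.
  apply/funext => y; apply: is_derive_derive1; apply: is_derive_affine.
  exact/smooth_derivable/smooth_step_smooth.
have da t : derive1 a t = derive1 a1 t - derive1 a2 t.
  apply: is_derive_derive1.
  apply: is_derive_eq.
    apply: is_deriveD; first exact: smooth_derivable.
    by apply: is_deriveZ; exact: smooth_derivable.
  by rewrite /GRing.scale/= mulN1r.
have aout t : ~ (s1 - eps <= t <= s2 + eps) -> a t = 0.
  move=> h; rewrite /a /a1 /a2; have [t1|t1] := ltP t (s1 - eps).
    by rewrite !ramp_le ?mulr0 ?addr0//; apply: ltW => //; exact: lt_trans l3.
  have t2 : s2 + eps < t by rewrite ltNge; apply/negP => t2; apply: h; rewrite t1.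
  rewrite !ramp_ge ?mulr1 ?subrr ?(ltW t2)// subrK.
  exact: le_trans (ltW l4) (ltW t2).
have a1out t : ~ (s1 - eps <= t <= s1) -> derive1 a1 t = 0.
  move=> h; apply: derive1_ramp_out => // => h2; apply: h.
  by move: h2; rewrite subrK.
have a2out t : ~ (s2 <= t <= s2 + eps) -> derive1 a2 t = 0.
  by move=> h; exact: derive1_ramp_out.
have abd t : `|a t| <= 2 * C0.
  rewrite /a mulN1r (le_trans (ler_normB _ _))//.
  have [h1 _ _] := HC0 (eps^-1 * t + - ((s1 - eps) / eps)).
  have [h2 _ _] := HC0 (eps^-1 * t + - (s2 / eps)).
  rewrite /a1 /a2 /ramp; lra.
have dabd c t : `|derive1 (ramp c eps) t| <= C0 / eps.
  rewrite derive1_ramp normrM gtr0_norm ?invr_gt0// [leLHS]mulrC ler_pM2r ?invr_gt0//.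
  by have [] := HC0 (eps^-1 * t + - (c / eps)).
have bbd y : `|b y| <= C0 / eta.
  rewrite normrM gtr0_norm ?invr_gt0// [leLHS]mulrC ler_pM2r ?invr_gt0//.
  by have [] := HC0 (eta^-1 * y + 0).
have bbd' y : `|derive1 b y| <= C0 / eta / eta.
  rewrite derive1_scaled_step !normrM (@gtr0_norm _ eta^-1) ?invr_gt0//.
  rewrite [leLHS]mulrC ler_pM2r ?invr_gt0// [leLHS]mulrC ler_pM2r ?invr_gt0//.
  by have [] := HC0 (eta^-1 * y).
have bout y : ~ (0 <= y <= eta) -> b y = 0.
  move=> h; rewrite /b derive1_smooth_step_out ?mulr0// addr0 mulrC.
  have [y0|y0] := leP 0 y; last by left; rewrite pmulr_llt0 ?invr_gt0.
  right; rewrite ltr_pdivlMr// mul1r ltNge; apply/negP => h2; apply: h.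
  by rewrite y0.
have bout' y : ~ (0 <= y <= eta) -> derive1 b y = 0.
  move=> h; rewrite derive1_scaled_step derive2_smooth_step_out ?mulr0// mulrC.
  have [y0|y0] := leP 0 y; last by left; rewrite pmulr_llt0 ?invr_gt0.
  right; rewrite ltr_pdivlMr// mul1r ltNge; apply/negP => h2; apply: h.
  by rewrite y0.
pose d := sg * t0 - x0.
have dE t x : x - sg * t + d = x - (x0 + sg * (t - t0)) by rewrite /d; ring.
pose phi := travelling a b sg d.
have phi_test : test_function phi.
  split; first by move=> n; exact: class_C_travelling.
  exists (s1 - eps), (s2 + eps),
    (`|x0| + `|sg| * (`|s1 - eps| + `|s2 + eps| + `|t0|) + eta); split => //.
  move=> t x; rewrite /phi /travelling mulf_eq0 negb_or => /andP[at0 bt0].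
  have tb : s1 - eps <= t <= s2 + eps.
    by apply: contrapT => h; move: at0; rewrite aout ?eqxx.
  split => //.
  have xb : 0 <= x - sg * t + d <= eta.
    by apply: contrapT => h; move: bt0; rewrite bout ?eqxx.
  rewrite -ler_norml; rewrite dE in xb.
  have -> : x = x0 + sg * (t - t0) + (x - (x0 + sg * (t - t0))) by ring.
  rewrite (le_trans (ler_normD _ _))// lerD//; last first.
    by rewrite ger0_norm; case/andP: xb.
  rewrite (le_trans (ler_normD _ _))// lerD2l normrM ler_wpM2l//.
  rewrite (le_trans (ler_normB _ _))// lerD2r.
  case/andP: tb => tb1 tb2; rewrite ler_norml; apply/andP; split.
    have := ler_norm (- (s1 - eps)); rewrite normrN.
    by have := normr_ge0 (s2 + eps); lra.
  by have := ler_norm (s2 + eps); have := normr_ge0 (s1 - eps); lra.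
have := weak phi phi_test.
rewrite /phi dt_travelling// dx_travelling//.
(* The integrand is [(g1 + g2) - (T1 + T2 + T3)]. In [g1] the values [V1] and [V2] replace [A] on
   the two time ramps, which gives the integral [V1 - V2]. In [g2] the relative flux is replaced by
   [w], a function of time only, which integrates to [0] against the derivative of the bump. The
   terms [T1], [T2], [T3] are the errors. *)
pose T1 := fun p : measurableTypeR R * measurableTypeR R =>
  (V1 - A p.1 p.2) * travelling (derive1 a1) b sg d p.1 p.2.
pose T2 := fun p : measurableTypeR R * measurableTypeR R =>
  (A p.1 p.2 - V2) * travelling (derive1 a2) b sg d p.1 p.2.
pose T3 := fun p : measurableTypeR R * measurableTypeR R =>
  (w p.1 - (B p.1 p.2 - sg * A p.1 p.2)) * travelling a (derive1 b) sg d p.1 p.2.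
pose al := fun t => derive1 a1 t * V1 - derive1 a2 t * V2.
pose g1 := fun p : R * R => al p.1 * derive1 P (p.2 - (x0 + sg * (p.1 - t0))).
pose be := fun t => a t * w t.
pose g2 := fun p : R * R => be p.1 * derive1 b (p.2 - (x0 + sg * (p.1 - t0))).
have ca' c : continuous (derive1 (ramp c eps)).
  exact/smooth_continuous/smooth_derive1/smooth_ramp.
have cal : continuous al.
  move=> t; apply: cvgB; (apply: cvgM; last exact: cvg_cst); exact: ca'.
have alout t : ~ (s1 - eps <= t <= s2 + eps) -> al t = 0.
  move=> h; rewrite /al a1out ?a2out ?mul0r ?subrr// => /andP[h1 h2]; apply: h.
    by rewrite h2 (le_trans (ltW l3) h1).
  by rewrite h1 (le_trans h2 (ltW l4)).
have [Ma Ma0 HMa] := continuous_bounded_segment (s1 - eps) (s2 + eps) cal.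
have albd t : `|al t| <= Ma.
  have [/HMa//|/negP h] := boolP (s1 - eps <= t <= s2 + eps).
  by rewrite alout ?normr0.
have cbe : continuous be.
  by move=> t; apply: cvgM; [exact: smooth_continuous|exact: cw].
have [Mb Mb0 HMb] := continuous_bounded_segment (s1 - eps) (s2 + eps) cbe.
have beout t : ~ (s1 - eps <= t <= s2 + eps) -> be t = 0.
  by move=> h; rewrite /be aout ?mul0r.
have bebd t : `|be t| <= Mb.
  have [/HMb//|/negP h] := boolP (s1 - eps <= t <= s2 + eps).
  by rewrite beout ?normr0.
have Pout y : ~ 0 <= y <= eta -> derive1 P y = 0 by rewrite dP; exact: bout.
have [ig1 Ig1] := integral_travelling x0 t0 sg eta0 s10 s12'
   (continuous_measurable_fun cal) sP albd alout Pout.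
have [ig2 Ig2] := integral_travelling x0 t0 sg eta0 s10 s12'
   (continuous_measurable_fun cbe) sb bebd beout bout'.
have {}Ig2 : \int[(mu \x mu)%E]_(p in D0) g2 p = 0.
  rewrite /Rintegral Ig2.
  rewrite (_ : b eta - b 0 = 0); last first.
    rewrite /b mulr0 add0r mulVf ?gt_eqF// addr0 derive1_smooth_step0.
    by rewrite derive1_smooth_step1 mulr0 subrr.
  under eq_integral do rewrite mulr0.
  by rewrite integral0.
have {}Ig1 : \int[(mu \x mu)%E]_(p in D0) g1 p = V1 - V2.
  rewrite /Rintegral Ig1.
  have -> : P eta - P 0 = 1.
    by rewrite /P mulVf ?gt_eqF// mulr0 !addr0 smooth_step_ge1// smooth_step_le0// subr0.
  under eq_integral do rewrite mulr1.
  have dA (t : R) : is_derive t 1 (fun t => a1 t * V1 - a2 t * V2) (al t).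
    have h1 := is_derive_mulr_cst V1 (smooth_derivable sa1 t).
    have h2 := is_derive_mulr_cst V2 (smooth_derivable sa2 t).
    exact: (is_deriveB h1 h2).
  rewrite (integral_derive_supported l12 dA cal alout).
  rewrite /a1 /a2 !(@ramp_ge _ _ (s2 + eps)) ?subrK ?(ltW l4)//.
  rewrite !(@ramp_le _ _ (s1 - eps)) ?(ltW l3)//.
  by rewrite /= !mul0r !mul1r !subr0.
have mD0 := measurable_pos_time.
have mK l r : measurable (strip l r x0 t0 sg eta :
    set (measurableTypeR R * measurableTypeR R)) by exact: measurable_strip.
have KD0 l r : s1 - eps <= l -> strip l r x0 t0 sg eta `<=` D0.
  by move=> h p [/andP[h1 _] _]; exact: (lt_le_trans s10 (le_trans h h1)).
have out l r p : ~ strip l r x0 t0 sg eta p -> ~ (l <= p.1 <= r) \/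
    ~ (0 <= p.2 - sg * p.1 + d <= eta).
  clear -dE.
  move=> nK; apply/not_andP => -[h1 h2]; apply: nK; split => //.
  by move: h2; rewrite dE subr_ge0 lerBlDl.
have mtr a' b' : continuous a' -> continuous b' -> measurable_fun D0
    (fun p : measurableTypeR R * measurableTypeR R => travelling a' b' sg d p.1 p.2).
  by move=> ca cb; apply: measurable_funTS; exact: measurable_travelling.
have mw : measurable_fun D0 (fun p : measurableTypeR R * measurableTypeR R => w p.1).
  apply: measurable_funTS; apply: (@measurableT_comp _ _ _ _ _ _ w).
    exact: continuous_measurable_fun.
  exact: measurable_fst.
have subK l r p : s1 - eps <= l -> r <= s2 + eps -> strip l r x0 t0 sg eta p -> K p.
  move=> h1 h2 [/andP[h3 h3'] h4]; split => //.
  by rewrite (le_trans h1 h3) (le_trans h3' h2).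
have C00' : 0 <= C0 / eps by rewrite ?divr_ge0 ?(ltW C00) ?(ltW eps0) ?(ltW eta0).
have C01' : 0 <= C0 / eta by rewrite ?divr_ge0 ?(ltW C00) ?(ltW eps0) ?(ltW eta0).
have C02' : 0 <= C0 / eta / eta by rewrite ?divr_ge0 ?(ltW C00) ?(ltW eps0) ?(ltW eta0).
have [iT1 bT1] : (mu \x mu)%E.-integrable D0 (EFin \o T1) /\
    `|\int[(mu \x mu)%E]_(p in D0) T1 p| <=
      e1 * (C0 / eps * (C0 / eta)) * ((s1 - (s1 - eps)) * eta).
  apply: (Rintegral_supported mD0 (mK (s1 - eps) s1) (KD0 _ _ _)) => //.
  - apply: measurable_funM; first exact: measurable_funB.
    by apply: mtr; [exact: ca'|exact: smooth_continuous].
  - move=> p _ /out; rewrite /T1 /travelling => -[h|h].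
      by rewrite a1out ?mul0r ?mulr0.
    by rewrite bout ?mulr0.
  - by apply: mulr_ge0 => //; exact: mulr_ge0.
  - by apply: measure_strip => //; exact: ltW.
  - apply: aeW => p Kp; rewrite normrM /travelling normrM.
    apply: ler_pM => //; last by apply: ler_pM => //; exact: dabd.
    have Kp' : K p by apply: subK Kp => //; exact: ltW.
    rewrite distrC; apply: A1 => //; by case: Kp => /andP[].
have [iT2 bT2] : (mu \x mu)%E.-integrable D0 (EFin \o T2) /\
    `|\int[(mu \x mu)%E]_(p in D0) T2 p| <=
      e1 * (C0 / eps * (C0 / eta)) * ((s2 + eps - s2) * eta).
  apply: (Rintegral_supported mD0 (mK s2 (s2 + eps)) (KD0 _ _ (ltW l3))) => //.
  - apply: measurable_funM; first exact: measurable_funB.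
    by apply: mtr; [exact: ca'|exact: smooth_continuous].
  - move=> p _ /out; rewrite /T2 /travelling => -[h|h].
      by rewrite a2out ?mul0r ?mulr0.
    by rewrite bout ?mulr0.
  - by apply: mulr_ge0 => //; exact: mulr_ge0.
  - by apply: measure_strip => //; exact: ltW.
  - apply: aeW => p Kp; rewrite normrM /travelling normrM.
    apply: ler_pM => //; last by apply: ler_pM => //; exact: dabd.
    have Kp' : K p by apply: subK Kp => //; exact: ltW.
    apply: A2 => //; by case: Kp => /andP[].
have [iT3 bT3] : (mu \x mu)%E.-integrable D0 (EFin \o T3) /\
    `|\int[(mu \x mu)%E]_(p in D0) T3 p| <=
      e2 * (2 * C0 * (C0 / eta / eta)) * ((s2 + eps - (s1 - eps)) * eta).
  apply: (Rintegral_supported mD0 (mK (s1 - eps) (s2 + eps)) (KD0 _ _ _)) => //.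
  - apply: measurable_funM.
      apply: measurable_funB => //; apply: measurable_funB => //.
      exact: measurable_funM.
    apply: mtr; first exact: smooth_continuous.
    exact/smooth_continuous/smooth_derive1.
  - move=> p _ /out; rewrite /T3 /travelling => -[h|h].
      by rewrite aout ?mul0r ?mulr0.
    by rewrite bout' ?mulr0.
  - by apply: mulr_ge0 => //; apply: mulr_ge0 => //; rewrite mulr_ge0 ?(ltW C00).
  - by apply: measure_strip => //; exact: ltW.
  - case: nN => N' [mN' N'0 NN']; exists N'; split => // q /= nb.
    apply: NN'; apply: contrapT => Np; apply: nb => Kp.
    rewrite normrM /travelling normrM.
    apply: ler_pM => //; last exact: ler_pM.
    by rewrite (BH _ Kp Np) distrC; exact: Hw.
have iD f g : (mu \x mu)%E.-integrable D0 (EFin \o f) ->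
    (mu \x mu)%E.-integrable D0 (EFin \o g) ->
    (mu \x mu)%E.-integrable D0 (EFin \o (fun p => f p + g p)).
  by move=> hf hg; have := integrableD mD0 hf hg.
rewrite [X in X = _ -> _](_ : _ = \int[(mu \x mu)%E]_(p in D0)
   ((g1 p + g2 p) - (T1 p + T2 p + T3 p))); last first.
  apply: eq_Rintegral => p _; rewrite /g1 /g2 /al /be /T1 /T2 /T3 /travelling dP -!dE da.
  clear; move: (A _ _) (B _ _) (derive1 a1 _) (derive1 a2 _) (a _) (b _)
    (derive1 b _) (w _) => A' B' c1 c2 c3 c4 c5 c6; ring.
have E1 : \int[(mu \x mu)%E]_(p in D0) ((g1 p + g2 p) - (T1 p + T2 p + T3 p)) =
    \int[(mu \x mu)%E]_(p in D0) (g1 p + g2 p) -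
    \int[(mu \x mu)%E]_(p in D0) (T1 p + T2 p + T3 p).
  exact: (RintegralB mD0 (iD _ _ ig1 ig2) (iD _ _ (iD _ _ iT1 iT2) iT3)).
have E2 : \int[(mu \x mu)%E]_(p in D0) (g1 p + g2 p) =
    \int[(mu \x mu)%E]_(p in D0) g1 p + \int[(mu \x mu)%E]_(p in D0) g2 p.
  exact: (RintegralD mD0 ig1 ig2).
have E3 : \int[(mu \x mu)%E]_(p in D0) (T1 p + T2 p + T3 p) =
    \int[(mu \x mu)%E]_(p in D0) (T1 p + T2 p) + \int[(mu \x mu)%E]_(p in D0) T3 p.
  exact: (RintegralD mD0 (iD _ _ iT1 iT2) iT3).
have E4 : \int[(mu \x mu)%E]_(p in D0) (T1 p + T2 p) =
    \int[(mu \x mu)%E]_(p in D0) T1 p + \int[(mu \x mu)%E]_(p in D0) T2 p.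
  exact: (RintegralD mD0 iT1 iT2).
rewrite E1 E2 E3 E4 Ig1 Ig2 addr0 => /subr0_eq ->.
apply: (@weak_line_bound eps eta C0) => //.
Qed.

End weak_line.

(** * Constancy along characteristics, locally *)

Definition clamp (R : realType) (a b t : R) : R := Num.max a (Num.min t b).

Lemma clamp_itv (R : realType) (a b t : R) : a <= b -> a <= clamp a b t <= b.
Proof.
move=> ab; rewrite /clamp le_max lexx/= ge_max ab/=.
by rewrite ge_min lexx orbT.
Qed.

Lemma clamp_id (R : realType) (a b t : R) : a <= t <= b -> clamp a b t = t.
Proof. by move=> /andP[h1 h2]; rewrite /clamp min_l// max_r. Qed.

Lemma continuous_clamp (R : realType) (a b : R) : continuous (clamp a b).
Proof.
move=> t; rewrite /clamp.
have h : (fun x : R => Num.min x b) @ t --> Num.min t b.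
  exact: (continuous_min (@cvg_id _ _) (cvg_cst _)).
exact: (continuous_max (cvg_cst _) h).
Qed.

Lemma mulr_arch_le0 (R : realType) (m Q e0 : R) : 0 < e0 ->
  (forall e, 0 < e -> e < e0 -> m <= Q * e) -> m <= 0.
Proof.
move=> e00 h; rewrite leNgt; apply/negP => m0.
pose Q' := `|Q| + 1.
have Q'0 : 0 < Q' by rewrite /Q' ltr_wpDl.
pose e := Num.min (e0 / 2) (m / (2 * Q')).
have e1 : 0 < e by rewrite lt_min !divr_gt0// mulr_gt0.
have e2 : e < e0 by rewrite gt_min; apply/orP; left; lra.
have := h _ e1 e2; apply/negP; rewrite -ltNge.
have e3 : e <= m / (2 * Q') by rewrite ge_min lexx orbT.
apply: (@le_lt_trans _ _ (Q' * e)).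
  by rewrite ler_wpM2r ?(ltW e1)// /Q' (le_trans (ler_norm _))// lerDl.
apply: (@le_lt_trans _ _ (Q' * (m / (2 * Q')))).
  by rewrite ler_wpM2l ?(ltW Q'0).
have -> : Q' * (m / (2 * Q')) = m / 2 by field; rewrite gt_eqF.
by lra.
Qed.

(** By the smallness of [e'], the variable [m] appears on the right with coefficient at most [1 / 4]
    and is absorbed by the left-hand side. *)
Lemma local_line_arith (R : realType) (C D K m e e' l : R) : 0 < C -> 0 <= D -> 0 <= K ->
  0 <= m -> 0 < e -> 0 <= l -> l <= e' -> 4 * C * K * (D + 1) * e' <= 1 / 2 ->
  m <= C * ((D + 2) * e + K * (2 * (m + e) + D * e) * (D * e) / e * l) + e ->
  m <= 2 * (1 + C * (D + 2) + 1 + D) * e.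
Proof.
move=> C0 D0 K0 m0 e0 l0 le' h1 h2.
have E : K * (2 * (m + e) + D * e) * (D * e) / e = K * (2 * (m + e) + D * e) * D.
  by field; rewrite gt_eqF.
have h3 : C * K * D * l <= 1 / 8.
  have h4 : C * K * D * l <= C * K * (D + 1) * e'.
    rewrite ler_pM ?mulr_ge0 ?(ltW C0)//.
    by rewrite ler_wpM2l ?mulr_ge0 ?(ltW C0)// lerDl.
  have -> : 1 / 8 = (1 / 2) / 4 :> R by field.
  apply: le_trans h4 _; rewrite ler_pdivlMr//.
  by apply: le_trans h1; rewrite le_eqVlt; apply/orP; left; apply/eqP; ring.
have h5 : m <= C * (D + 2) * e + (2 * (m + e) + D * e) * (1 / 8) + e.
  apply: le_trans h2 _; rewrite E lerD2r mulrDr mulrA lerD2l.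
  have -> : C * (K * (2 * (m + e) + D * e) * D * l) = (2 * (m + e) + D * e) * (C * K * D * l).
    by ring.
  by rewrite ler_wpM2l// addr_ge0 ?mulr_ge0 ?addr_ge0 ?(ltW e0).
have h6 : 0 <= D * e by rewrite mulr_ge0 ?(ltW e0).
have h7 : 0 <= C * (D + 2) * e by rewrite !mulr_ge0 ?addr_ge0 ?(ltW e0) ?(ltW C0).
have -> : 2 * (1 + C * (D + 2) + 1 + D) * e = 4 * e + 2 * (C * (D + 2) * e) + 2 * (D * e).
  by ring.
move: h5 h6 h7; move: (C * (D + 2) * e) (D * e) => X Y; lra.
Qed.

Section local_line.
Context {R : realType}.
Notation mu := (@lebesgue_measure R).
Notation D0 := [set p : R * R | 0 < p.1].

(* The supremum of [`|A - c|] over a segment of length [e'] of the line is bounded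
   by itself times a multiple of [K * D * e'], hence vanishes for small [e']. *)
Lemma local_line (A B : R -> R -> R) (H : R -> R) (N : set (R * R))
    (r0 x0 sg eps D K M c : R) :
  0 < eps -> 0 < r0 - eps -> 0 <= D -> 0 <= K -> 0 <= M ->
  measurable_fun D0 (fun p => A p.1 p.2) ->
  measurable_fun D0 (fun p => B p.1 p.2) ->
  (forall phi, test_function phi ->
    \int[(mu \x mu)%E]_(p in D0)
      (A p.1 p.2 * dt phi p.1 p.2 + B p.1 p.2 * dx phi p.1 p.2) = 0) ->
  continuous H -> (mu \x mu)%E.-negligible N ->
  (forall t x, r0 - eps < t <= r0 -> `|x - x0| < eps -> 0 <= A t x <= M) ->
  (forall t x, r0 - eps < t < r0 -> `|x - x0| < eps ->
    `|B t x| <= M /\ (~ N (t, x) -> B t x = H (A t x))) ->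
  (forall t x x', r0 - eps < t < r0 -> `|x - x0| < eps -> `|x' - x0| < eps ->
    `|A t x - A t x'| <= D * `|x - x'|) ->
  (forall t x, r0 - eps < t <= r0 -> `|x - x0| < eps ->
    forall e, 0 < e -> exists2 d, 0 < d &
    forall t' x', r0 - eps < t' <= r0 -> `|x' - x0| < eps ->
      `|t' - t| < d -> `|x' - x| < d -> `|A t' x' - A t x| <= e) ->
  c = A r0 x0 ->
  (forall v v', 0 <= v <= M -> 0 <= v' <= M ->
    `|H v - H v' - sg * (v - v')| <= K * (`|v - c| + `|v' - c|) * `|v - v'|) ->
  exists2 e', 0 < e' &
    forall t, r0 - e' < t <= r0 -> A t (x0 + sg * (t - r0)) = c.
Proof.
move=> eps0 r00 D0_ K0 M0 mA mB weak cH nN Abd HB slope cont cE HK.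
have [C C0 HC] := @weak_line_estimate R.
(* Three requirements: the times stay in the box, the line stays within [eps / 2] of [x0], and the
   bound of the supremum by itself is contracting. *)
pose e' := Num.min (eps / 2) (Num.min (eps / (2 * (`|sg| + 1)))
   ((4 * C * K * (D + 1) + 1)^-1 / 2)).
have CKD : 0 <= 4 * C * K * (D + 1) by rewrite !mulr_ge0 ?addr_ge0// ltW.
have CKD1 : 0 < 4 * C * K * (D + 1) + 1 by rewrite ltr_wpDl.
have e'0 : 0 < e'.
  by rewrite !lt_min !divr_gt0 ?mulr_gt0 ?invr_gt0.
have e'1 : e' <= eps / 2 by rewrite ge_min lexx.
have e'2 : e' * (`|sg| + 1) <= eps / 2.
  rewrite -ler_pdivlMr//.
  have -> : eps / 2 / (`|sg| + 1) = eps / (2 * (`|sg| + 1)) by rewrite invfM mulrA.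
  by rewrite !ge_min lexx orbT.
have e'3 : 4 * C * K * (D + 1) * e' <= 1 / 2.
  have h : e' <= (4 * C * K * (D + 1) + 1)^-1 / 2 by rewrite !ge_min lexx !orbT.
  have h2 : (4 * C * K * (D + 1) + 1) * e' <= 1 / 2.
    rewrite mulrC -ler_pdivlMr//; apply: le_trans h _.
    by rewrite mul1r mulrC.
  by apply: le_trans h2; rewrite ler_wpM2r ?(ltW e'0)// lerDl.
pose xi := fun t : R => x0 + sg * (t - r0).
have xib t : r0 - e' <= t <= r0 -> `|xi t - x0| <= eps / 2.
  move=> /andP[h1 h2]; rewrite /xi addrC addKr normrM.
  apply: le_trans e'2; rewrite mulrC ler_pM// ?lerDl//.
  by rewrite ler_norml; move: h1 h2 (e'0); clear => *; apply/andP; split; lra.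
exists e' => // s /andP[s1 s2].
have [->|sr0] := eqVneq s r0; first by rewrite subrr mulr0 addr0 cE.
have {}s2 : s < r0 by rewrite lt_neqAle sr0.
pose lo := (s + (r0 - e')) / 2.
have lo1 : r0 - e' < lo by rewrite /lo; move: s1; clear; lra.
have lo2 : lo < s by rewrite /lo; move: s1; clear; lra.
have lor0 : lo <= r0 by exact: ltW (lt_trans lo2 s2).
(* The value along the line. Clamping the time makes it continuous on all of [R], as the function
   [w] of [weak_line_estimate] has to be. *)
pose vc := fun t : R => A (clamp lo r0 t) (xi (clamp lo r0 t)).
have vcE t : lo <= t <= r0 -> vc t = A t (xi t).
  by move=> h; rewrite /vc clamp_id.
have inbox t : lo <= t <= r0 -> r0 - eps < t <= r0 /\ `|xi t - x0| < eps.
  move=> /andP[h1 h2]; split; first by rewrite h2 andbT; move: h1 lo1 e'1 eps0; clear; lra.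
  apply: (@le_lt_trans _ _ (eps / 2)); last by move: eps0; clear; lra.
  by apply: xib; rewrite h2 andbT; apply: ltW; exact: lt_le_trans lo1 h1.
have cxi : continuous xi.
  move=> t; apply: cvgD; first exact: cvg_cst.
  apply: cvgM; first exact: cvg_cst.
  by apply: cvgB; [exact: cvg_id|exact: cvg_cst].
have cvc : continuous vc.
  move=> t; apply/cvgrPdist_lep; near=> e.
  have e0 : 0 < e by near: e; exact: nbhs_right_gt.
  have [h1 h2] := inbox _ (clamp_itv t lor0).
  have [d d0 Hd] := cont _ _ h1 h2 e e0.
  have := @continuous_clamp R lo r0 t.
  move=> /cvgrPdist_lt/(_ d d0) c1.
  have : (xi \o clamp lo r0) z @[z --> t] --> xi (clamp lo r0 t).
    exact: (@cvg_comp _ _ _ (clamp lo r0) xi _ _ _ (@continuous_clamp R lo r0 t) (cxi _)).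
  move=> /cvgrPdist_lt/(_ d d0) c2.
  near=> z; rewrite distrC.
  have [h3 h4] := inbox _ (clamp_itv z lor0).
  apply: Hd => //; rewrite distrC; near: z; [exact: c1|exact: c2].
pose g := fun t => `|vc t - c|.
have cg : continuous g.
  by move=> t; apply: cvg_norm; apply: cvgB; [exact: cvc|exact: cvg_cst].
have [ss] := EVT_max (ltW s2) (continuous_subspaceT cg).
rewrite in_itv/= => /andP[ss1 ss2] gmax.
have vr0 : vc r0 = c.
  by rewrite vcE ?lexx ?lor0// /xi subrr mulr0 addr0.
suff m0 : g ss <= 0.
  have : g s <= 0 by apply: le_trans m0; apply: gmax; rewrite in_itv/= lexx ltW.
  rewrite /g normr_le0 subr_eq0 => /eqP.
  by rewrite vcE//; apply/andP; split; apply: ltW.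
have [->|ssr0] := eqVneq ss r0; first by rewrite /g vr0 subrr normr0.
have {}ss2 : ss < r0 by rewrite lt_neqAle ssr0.
set m := g ss.
have m0 : 0 <= m by exact: normr_ge0.
apply: (@mulr_arch_le0 _ _ (2 * (1 + C * (D + 2) + 1 + D)) (Num.min 1 (eps / 2))).
  by rewrite lt_min ltr01/= divr_gt0.
move=> e e0; rewrite lt_min => /andP[e1 e2].
have ss3 : lo < ss by exact: lt_le_trans lo2 ss1.
have /cvgrPdist_le/(_ e e0) [d1 /= d10 Hd1] := cvc ss.
have /cvgrPdist_le/(_ e e0) [d2 /= d20 Hd2] := cvc r0.
(* A time at which the value is within [e] of [c]; it replaces [r0] so that the second ramp ends
   before [r0]. *)
pose z2 := Num.max ((ss + r0) / 2) (r0 - d2 / 2).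
have z2r0 : z2 < r0 by rewrite gt_max; move: d20 ss2; clear => *; apply/andP; split; lra.
have z21 : (ss + r0) / 2 <= z2 by rewrite le_max lexx.
have z22 : r0 - d2 / 2 <= z2 by rewrite le_max lexx orbT.
have ssz2 : ss < z2 by move: z21 ss2; clear; lra.
pose ep := Num.min (d1 / 2) (Num.min ((r0 - z2) / 2) ((ss - lo) / 2)).
have ep0 : 0 < ep by rewrite !lt_min !divr_gt0// subr_gt0.
have ep1 : ep <= d1 / 2 by rewrite ge_min lexx.
have ep2 : ep <= (r0 - z2) / 2 by rewrite !ge_min lexx orbT.
have ep3 : ep <= (ss - lo) / 2 by rewrite !ge_min lexx !orbT.
have len : z2 - ss + 2 * ep <= e' by move: ep2 ss3 lo1 z2r0; clear; lra.
have ssep : 0 < ss - ep by move: ep3 ss3 lo1 e'1 r00 eps0; clear; lra.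
pose w := fun t => H (vc t) - sg * vc t.
have cw : continuous w.
  move=> t; apply: cvgB; last by apply: cvgM; [exact: cvg_cst|exact: cvc].
  by apply: (cvg_comp vc H); [exact: cvc|exact: cH].
have tK t : ss - ep <= t <= z2 + ep -> lo <= t < r0.
  by move=> /andP[]; move: ep2 ep3 ss3 z2r0; clear => *; apply/andP; split; lra.
have tb t : ss - ep <= t <= z2 + ep -> [/\ r0 - eps < t < r0, `|xi t - x0| <= eps / 2,
    vc t = A t (xi t) & `|vc t - c| <= m + e].
  move=> h; have /andP[h1 h2] := tK t h.
  have ht : lo <= t <= r0 by rewrite h1 ltW.
  have [/andP[h3 _] _] := inbox _ ht.
  split.
  - by rewrite h3.
  - apply: xib; rewrite (ltW h2) andbT; apply: ltW; exact: lt_le_trans lo1 h1.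
  - exact: vcE.
  - have [st|ts] := leP ss t.
      have : g t <= m by apply: gmax; rewrite in_itv/= (le_trans ss1 st) ltW.
      by rewrite /g => /le_trans; apply; rewrite lerDl ltW.
    have h5 : `|vc ss - vc t| <= e.
      apply: Hd1 => /=; rewrite ltr_norml; apply/andP; split.
        by move: ts d10; clear; lra.
      by move: h ep1 d10 => /andP[+ _]; clear; lra.
    have -> : vc t - c = (vc ss - c) - (vc ss - vc t) by ring.
    by rewrite (le_trans (ler_normB _ _))// lerD.
have pK p : strip (ss - ep) (z2 + ep) x0 r0 sg e p ->
  [/\ ss - ep <= p.1 <= z2 + ep, `|p.2 - x0| < eps, `|xi p.1 - x0| < eps &
     `|p.2 - xi p.1| <= e].
  move=> [h1 /andP[h2 h3]]; have [_ h4 _ _] := tb _ h1.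
  have h5 : `|p.2 - xi p.1| <= e.
    rewrite ler_norml; move: h2 h3 e0; rewrite /xi; clear; move=> h2 h3 e0.
    by apply/andP; split; lra.
  split => //.
    have -> : p.2 - x0 = (p.2 - xi p.1) + (xi p.1 - x0) by ring.
    apply: le_lt_trans (ler_normD _ _) _.
    by move: h4 h5 e2; clear; lra.
  by move: h4 eps0; clear; lra.
have pA p : strip (ss - ep) (z2 + ep) x0 r0 sg e p ->
    `|A p.1 p.2 - vc p.1| <= D * e.
  move=> /pK[h1 h2 h3 h4]; have [h5 _ -> _] := tb _ h1.
  apply: le_trans (slope _ _ _ h5 h2 h3) _.
  by rewrite ler_wpM2l.
(* The strip has width [e], so that [A] differs from its value on the line by at most [D * e], and
   the hypothesis on [H] bounds the flux error by this times [K * (2 * (m + e) + D * e)]. Division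
   by the width leaves a multiple of [m], up to terms of order [e]. *)
have key : `|vc ss - vc z2| <=
    C * ((D + 2) * e + K * (2 * (m + e) + D * e) * (D * e) / e * (z2 - ss + 2 * ep)).
  apply: (HC A B H w x0 r0 sg ss z2 ep e _ _ M _ _ N) => //.
  - by rewrite mulr_ge0 ?addr_ge0 ?(ltW e0).
  - by rewrite !mulr_ge0 ?addr_ge0 ?mulr_ge0 ?addr_ge0 ?(ltW e0).
  - move=> p /pK[h1 h2 h3 h4]; have [h5 _ _ _] := tb _ h1.
    have [h6 _] := HB _ _ h5 h2; split => //.
    have h5' : r0 - eps < p.1 <= r0 by case/andP: h5 => -> /ltW ->.
    by have /andP[h7 h8] := Abd _ _ h5' h2; rewrite ger0_norm.
  - move=> [p1 p2] /pK[h1 h2 h3 h4] Np; have [h5 _ _ _] := tb _ h1.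
    by have [_] := HB _ _ h5 h2; apply.
  - move=> p Kp ps; have h := pA p Kp; have [/andP[h1 _] _ _ _] := pK _ Kp.
    have h5 : `|vc ss - vc p.1| <= e.
      apply: Hd1 => /=; rewrite ltr_norml; move: ps h1 ep1 d10; clear => *.
      by apply/andP; split; lra.
    have -> : A p.1 p.2 - vc ss = (A p.1 p.2 - vc p.1) - (vc ss - vc p.1) by ring.
    apply: le_trans (ler_normB _ _) _.
    by move: h h5 e0; clear; lra.
  - move=> p Kp ps; have h := pA p Kp; have [h1 _ _ _] := pK _ Kp.
    have h5 t : z2 <= t < r0 -> `|c - vc t| <= e.
      move=> /andP[h6 h7]; rewrite -vr0; apply: Hd2 => /=.
      by rewrite ltr_norml; apply/andP; split; move: h6 h7 z22 d20; clear; lra.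
    have h8 : `|c - vc p.1| <= e.
      by apply: h5; rewrite ps; have /andP[] := tK _ h1.
    have h9 : `|c - vc z2| <= e by apply: h5; rewrite lexx.
    have -> : A p.1 p.2 - vc z2 = (A p.1 p.2 - vc p.1) - (c - vc p.1) + (c - vc z2).
      by ring.
    apply: le_trans (ler_normD _ _) _.
    apply: le_trans (lerD (ler_normB _ _) (lexx _)) _.
    by move: h h8 h9; clear; lra.
  - move=> p Kp; have h := pA p Kp; have [h1 h2 h3 h4] := pK _ Kp.
    have [h5 _ vE h6] := tb _ h1.
    have h5' : r0 - eps < p.1 <= r0 by case/andP: h5 => -> /ltW ->.
    have b1 := Abd _ _ h5' h2.
    have b2 : 0 <= vc p.1 <= M by rewrite vE; exact: Abd.
    have -> : H (A p.1 p.2) - sg * A p.1 p.2 - w p.1 =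
       H (A p.1 p.2) - H (vc p.1) - sg * (A p.1 p.2 - vc p.1) by rewrite /w; ring.
    apply: le_trans (HK _ _ b1 b2) _.
    apply: ler_pM => //; first by rewrite mulr_ge0// addr_ge0.
    rewrite ler_wpM2l//.
    have -> : A p.1 p.2 - c = (A p.1 p.2 - vc p.1) + (vc p.1 - c) by ring.
    apply: le_trans (lerD (ler_normD _ _) (lexx _)) _.
    by move: h h6; clear; lra.
have h9 : `|c - vc z2| <= e.
  rewrite -vr0; apply: Hd2 => /=.
  by rewrite ltr_norml; apply/andP; split; move: z2r0 z22 d20; clear; lra.
have mE : m <= `|vc ss - vc z2| + e.
  rewrite /m /g.
  have -> : vc ss - c = (vc ss - vc z2) - (c - vc z2) by ring.
  by apply: le_trans (ler_normB _ _) _; rewrite lerD2l.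
apply: (@local_line_arith _ C D K m e e' (z2 - ss + 2 * ep)) => //.
- by rewrite addr_ge0 ?subr_ge0 ?mulr_ge0 ?(ltW ep0) ?(ltW ssz2).
- exact: le_trans mE (lerD key (lexx _)).
Unshelve. all: by end_near. Qed.
End local_line.

(** * Real induction and a Gronwall inequality *)

(** The supremum of the times up to which [P] holds without interruption is attained by the closure
    condition, and is not below [b] by the extension condition. *)
Lemma right_induction (R : realType) (a b : R) (P : R -> Prop) :
  a <= b -> P a ->
  (forall t, a <= t < b -> (forall s, a <= s <= t -> P s) ->
    exists2 e, 0 < e & forall s, t < s < t + e -> s <= b -> P s) ->
  (forall t, a < t <= b -> (forall s, a <= s < t -> P s) -> P t) ->
  forall t, a <= t <= b -> P t.
Proof.
move=> ab Pa Pright Pleft.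
pose S := [set t | a <= t <= b /\ forall s, a <= s <= t -> P s].
have Sa : S a.
  by split; [rewrite lexx|move=> s; rewrite -eq_le => /eqP <-].
have Sub : ubound S b by move=> t [/andP[]].
have hS : has_sup S by split; [exists a|exists b].
have aS : a <= sup S by exact: ub_le_sup (proj2 hS) _ Sa.
have Sb : sup S <= b by apply: ge_sup => //; exists a.
have Plt s : a <= s < sup S -> P s.
  move=> /andP[as_ ss]; have d0 : 0 < sup S - s by rewrite subr_gt0.
  have [t [_ Pt]] := sup_adherent d0 hS; rewrite subKr => st.
  by apply: Pt; rewrite as_ ltW.
have SS : forall s, a <= s <= sup S -> P s.
  move=> s /andP[as_]; rewrite le_eqVlt => /predU1P[->|ss]; last first.
    by apply: Plt; rewrite as_.
  have [<-//|aS'] := eqVneq a (sup S).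
  by apply: Pleft => //; rewrite Sb andbT lt_neqAle aS'.
have [Sbl|bS] := ltP (sup S) b; last first.
  by move=> t /andP[h1 h2]; apply: SS; rewrite h1 (le_trans h2).
have [e e0 He] := Pright (sup S) (introT andP (conj aS Sbl)) SS.
pose t := Num.min (sup S + e / 2) b.
have t1 : sup S < t by rewrite lt_min Sbl andbT ltrDl divr_gt0.
have t2 : t < sup S + e by rewrite gt_min; apply/orP; left; move: e0; clear; lra.
have t3 : t <= b by rewrite ge_min lexx orbT.
have : S t.
  split; first by rewrite t3 andbT (le_trans aS) ?(ltW t1).
  move=> s /andP[h1 h2]; have [h3|h3] := leP s (sup S).
    by apply: SS; rewrite h1.
  by apply: He; [rewrite h3 (le_lt_trans h2)|exact: le_trans h2 t3].
by move=> /(ub_le_sup (proj2 hS)); rewrite leNgt t1.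
Qed.

Lemma left_induction (R : realType) (a b : R) (P : R -> Prop) :
  a <= b -> P b ->
  (forall t, a < t <= b -> (forall s, t <= s <= b -> P s) ->
    exists2 e, 0 < e & forall s, t - e < s < t -> a <= s -> P s) ->
  (forall t, a <= t < b -> (forall s, t < s <= b -> P s) -> P t) ->
  forall t, a <= t <= b -> P t.
Proof.
move=> ab Pb Pl Pr t tab.
rewrite -[t]opprK.
apply: (@right_induction R (- b) (- a) (fun s => P (- s))).
- by rewrite lerN2.
- by rewrite opprK.
- move=> s /andP[h1 h2] Ps.
  have h3 : a < - s <= b by rewrite ltrNr h2 lerNl.
  have [|e e0 He] := Pl _ h3.
    move=> r /andP[h4 h5]; rewrite -[r]opprK; apply: Ps.
    by rewrite lerN2 h5 lerNl.
  exists e => // r /andP[h4 h5] h6; apply: He; last by rewrite lerNr.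
  by move: h4 h5; clear => *; apply/andP; split; lra.
- move=> s /andP[h1 h2] Ps; apply: Pr.
    by rewrite lerNr h2 ltrNl.
  move=> r /andP[h4 h5]; rewrite -[r]opprK; apply: Ps.
  by rewrite lerN2 h5 ltrNl.
- by move: tab => /andP[h1 h2]; rewrite !lerN2 h2 h1.
Qed.

Lemma derivable_increment (R : realType) (f : R -> R) (x : R) :
  derivable f x 1 -> forall e, 0 < e -> exists2 d, 0 < d &
    forall z, `|z - x| < d ->
      `|f z - f x - derive1 f x * (z - x)| <= e * `|z - x|.
Proof.
move=> df e e0.
have : h^-1 *: ((f \o shift x) (h *: 1) - f x) @[h --> (0:R)^'] --> derive1 f x.
  by rewrite derive1E; exact: df.
move=> /cvgrPdist_le/(_ e e0) [d /= d0 Hd]; exists d => // z zd.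
have [->|zx] := eqVneq z x; first by rewrite !subrr mulr0 subr0 normr0 mulr0.
have zx0 : z - x != 0 by rewrite subr_eq0.
have := Hd (z - x); rewrite /= sub0r normrN => /(_ zd zx0).
rewrite [(z - x) *: 1]mulr1 subrK => h.
have -> : f z - f x - derive1 f x * (z - x) =
    - ((derive1 f x - (z - x)^-1 * (f z - f x)) * (z - x)) by field.
by rewrite normrN normrM ler_wpM2r.
Qed.

Section ae_derivative.
Context {R : realType}.
Notation mu := (@lebesgue_measure R).

(* The exceptional null set is covered by an open set of small measure, on which
   the Lipschitz bound is charged to the measure of the covered part. *)
Lemma lipschitz_ae_derive_le (y : R -> R) (a b K c : R) :
  a <= b -> 0 <= K ->
  (forall s t, a <= s <= b -> a <= t <= b -> `|y s - y t| <= K * `|s - t|) ->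
  {ae mu, forall t, a < t < b -> derivable y t 1 /\ derive1 y t <= c} ->
  y b - y a <= c * (b - a).
Proof.
move=> ab K0 ylip [E [mE muE HE]].
(* The derivative is controlled on the open interval only, so the starting point joins the
   exceptional set. *)
pose E' := E `|` [set a].
have mE' : measurable E' by apply: measurableU => //; exact: measurable_set1.
have muE' : mu E' = 0%E.
  have h := @measureU0 _ _ _ mu _ _ mE (measurable_set1 a) (lebesgue_measure_set1 a).
  exact: etrans h muE.
apply/ler_addgt0Pr => e e0.
pose K' := K + `|c|.
have K'0 : 0 <= K' by rewrite addr_ge0.
pose e1 := e / (b - a + K' + 1).
have den : 0 < b - a + K' + 1 by rewrite ltr_wpDl// addr_ge0// subr_ge0.
have e10 : 0 < e1 by rewrite divr_gt0.
have muE'oo : (mu E' < +oo)%E by rewrite muE' ltry.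
have [U [oU EU muU]] := lebesgue_regularity_outer mE' muE'oo e10.
have mU : measurable U by exact: open_measurable.
have muUe : (mu U < e1%:E)%E.
  have h := @measureU0 _ _ _ mu _ _ (measurableD mU mE') mE' muE'.
  by have -> : mu U = mu (U `\` E') by rewrite -[RHS]h setUC setDUK.
have le_mu X Y : measurable X -> measurable Y -> X `<=` Y -> (mu X <= mu Y)%E.
  by move=> mX mY XY; apply: le_measure => //; rewrite inE.
pose A t := U `&` `[a, t].
have mA t : measurable (A t) by apply: measurableI => //; exact: measurable_itv.
have fA t : mu (A t) \is a fin_num.
  rewrite ge0_fin_numE//; apply: (@le_lt_trans _ _ (mu U)).
    by apply: le_mu; [exact: mA|exact: mU|exact: subIsetl].
  by apply: lt_trans muUe _; rewrite ltry.
pose psi t := fine (mu (A t)).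
have psi_le s t : s <= t -> psi s <= psi t.
  move=> st; apply: fine_le => //; apply: le_mu; [exact: mA|exact: mA|].
  apply: setIS => z /=; rewrite !in_itv/= => /andP[-> h].
  exact: le_trans h st.
have psi_jump s t : a <= s -> s <= t -> (forall z, s < z <= t -> U z) ->
    psi s + (t - s) <= psi t.
  move=> as_ st Uz; rewrite -lee_fin EFinD /psi !fineK//.
  have -> : (t - s)%:E = mu `]s, t]%classic.
    rewrite lebesgue_measure_itv/= lte_fin; case: ifPn => //.
    rewrite -leNgt => h; have -> : t = s by apply/eqP; rewrite eq_le h.
    by rewrite subrr.
  rewrite -measureU; [|exact: mA|exact: measurable_itv|]; last first.
    rewrite -subset0 => z [[_ /=]]; rewrite !in_itv/= => /andP[_ h1] /andP[h2 _].
    by have := lt_le_trans h2 h1; rewrite ltxx.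
  apply: le_mu; [|exact: mA|].
    by apply: measurableU; [exact: mA|exact: measurable_itv].
  move=> z [[h1 /=]|/=]; rewrite !in_itv/=.
    by move=> /andP[h2 h3]; split => //=; rewrite in_itv/= h2 (le_trans h3).
  move=> /andP[h2 h3]; split; first by apply: Uz; rewrite h2.
  by rewrite /= in_itv/= h3 (le_trans as_ (ltW h2)).
pose Q t := y t - y a <= (c + e1) * (t - a) + K' * psi t.
suff Qb : Q b.
  apply: le_trans Qb _.
  have h1 : psi b <= e1.
    rewrite -lee_fin /psi fineK//; apply: le_trans (ltW muUe).
    by apply: le_mu; [exact: mA|exact: mU|exact: subIsetl].
  have h2 : e1 * (b - a + K' + 1) = e by rewrite /e1 divfK// gt_eqF.
  rewrite mulrDl -addrA lerD2l -[leRHS]h2 -addrA [leRHS]mulrDr lerD2l.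
  rewrite mulrDr mulr1 ler_wpDr ?(ltW e10)//.
  by rewrite [leRHS]mulrC ler_wpM2l.
apply: (@right_induction R a b Q) => //; last by rewrite lexx ab.
- by rewrite /Q !subrr mulr0 add0r mulr_ge0// fine_ge0.
- move=> t /andP[at_ tb] Qs; have Qt : Q t by apply: Qs; rewrite at_ lexx.
  have step (s : R) : t <= s -> y s - y t <= (c + e1) * (s - t) + K' * (psi s - psi t) -> Q s.
    move=> ts h; move: Qt; rewrite /Q => Qt.
    have -> : y s - y a = (y s - y t) + (y t - y a) by ring.
    apply: le_trans (lerD h Qt) _.
    by rewrite le_eqVlt; apply/orP; left; apply/eqP; ring.
  have [Ut|nUt] := pselect (U t).
    have /nbhs_ballP [d /= d0 Hd] : nbhs t U by exact: open_nbhs_nbhs.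
    exists d => // s /andP[ts std] sb; apply: step; first exact: ltW.
    have h1 : `|y s - y t| <= K * `|s - t|.
      by apply: ylip; rewrite ?at_ ?sb ?(ltW tb) ?(le_trans at_ (ltW ts)).
    have st0 : 0 < s - t by rewrite subr_gt0.
    rewrite (gtr0_norm st0) in h1.
    have h2 : psi t + (s - t) <= psi s.
      apply: psi_jump => //; first exact: ltW.
      move=> z /andP[tz zs]; apply: Hd; rewrite /ball/= distrC gtr0_norm ?subr_gt0//.
      by rewrite ltrBlDl; exact: le_lt_trans zs std.
    apply: le_trans (ler_norm _) _; apply: le_trans h1 _.
    have h3 : K' * (s - t) <= K' * (psi s - psi t).
      by rewrite ler_wpM2l// lerBrDl.
    rewrite -subr_ge0; apply: (@le_trans _ _ ((c + `|c| + e1) * (s - t))).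
      rewrite mulr_ge0 ?(ltW st0)// addr_ge0 ?(ltW e10)//.
      by have := ler_norm (- c); rewrite normrN; move=> *; rewrite -[c]opprK -lerBlDl sub0r opprK.
    rewrite lerBrDl; apply: le_trans (lerD (lexx _) h3).
    by rewrite /K' le_eqVlt; apply/orP; left; apply/eqP; ring.
  have tE : ~ E t by move=> Et; apply: nUt; apply: EU; left.
  have ta : t != a by apply/eqP => ta; apply: nUt; apply: EU; right.
  have att : a < t by rewrite lt_neqAle eq_sym ta.
  have [dy dyc] : derivable y t 1 /\ derive1 y t <= c.
    by apply: contrapT => h; apply: tE; apply: HE => /= /(_ (introT andP (conj att tb))).
  have [d d0 Hd] := derivable_increment dy e10.
  exists d => // s /andP[ts std] sb; apply: step; first exact: ltW.
  have st0 : 0 < s - t by rewrite subr_gt0.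
  have := Hd s; rewrite (gtr0_norm st0) ltrBlDl => /(_ std) h1.
  have h2 : y s - y t - derive1 y t * (s - t) <= e1 * (s - t) by exact: le_trans (ler_norm _) h1.
  have h3 : 0 <= K' * (psi s - psi t).
    by rewrite mulr_ge0// subr_ge0 psi_le ?(ltW ts).
  have h4 : derive1 y t * (s - t) <= c * (s - t) by rewrite ler_wpM2r// ltW.
  by move: h2 h3 h4; clear; lra.
- move=> t /andP[at_ tb] Qs; rewrite /Q.
  apply/ler_addgt0Pr => r r0.
  pose C := K + `|c + e1| + 1.
  have C0 : 0 < C by rewrite /C ltr_wpDl// addr_ge0.
  pose s := Num.max ((a + t) / 2) (t - r / C).
  have rC : 0 < r / C by rewrite divr_gt0.
  have s1 : a <= s by rewrite le_max; apply/orP; left; move: at_; clear; lra.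
  have s2 : s < t by rewrite gt_max; move: at_ rC; clear => *; apply/andP; split; lra.
  have s3 : t - s <= r / C by rewrite lerBlDr -lerBlDl le_max lexx orbT.
  have Qs' : Q s by apply: Qs; rewrite s1.
  have h1 : `|y t - y s| <= K * `|t - s|.
    by apply: ylip; rewrite ?tb ?(ltW at_) ?s1 ?(le_trans (ltW s2) tb).
  have ts0 : 0 < t - s by rewrite subr_gt0.
  rewrite (gtr0_norm ts0) in h1.
  have h2 : K' * psi s <= K' * psi t by rewrite ler_wpM2l// psi_le ?(ltW s2).
  have h3 : - (c + e1) * (t - s) <= `|c + e1| * (t - s).
    by rewrite ler_wpM2r ?(ltW ts0)// -normrN ler_norm.
  have h4 : C * (t - s) <= r by rewrite mulrC -ler_pdivlMr.
  have h5 : (K + `|c + e1|) * (t - s) <= r.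
    by apply: le_trans h4; rewrite ler_wpM2r ?(ltW ts0)// lerDl.
  have h6 := ler_norm (y t - y s).
  move: Qs'; rewrite /Q => Qs'.
  have -> : (c + e1) * (t - a) = (c + e1) * (s - a) - (- (c + e1) * (t - s)) by ring.
  move: h5; rewrite mulrDl.
  move: h1 h2 h3 h6 Qs'; clear.
  by lra.
Qed.

(** On an interval with [C * (b' - a) <= 1 / 2], the increment of [y] from [a] to a point of maximum
    is at most half of the maximum, which is positive. *)
Lemma lipschitz_ae_gronwall (y : R -> R) (a b K C : R) :
  a < b -> 0 <= K -> 0 <= C ->
  (forall s t, a <= s <= b -> a <= t <= b -> `|y s - y t| <= K * `|s - t|) ->
  y a = 0 -> (forall t, a < t <= b -> 0 < y t) ->
  {ae mu, forall t, a < t < b -> derivable y t 1 /\ derive1 y t <= C * y t} ->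
  False.
Proof.
move=> ab K0 C0 ylip ya yp dy.
pose b' := Num.min b (a + (2 * (C + 1))^-1).
have i0 : 0 < (2 * (C + 1))^-1 by rewrite invr_gt0 mulr_gt0// ltr_wpDl.
have ab' : a < b' by rewrite lt_min ab ltrDl.
have b'b : b' <= b by rewrite ge_min lexx.
have b'a : C * (b' - a) <= 1 / 2.
  apply: (@le_trans _ _ (C * (2 * (C + 1))^-1)).
    by rewrite ler_wpM2l// lerBlDl ge_min lexx orbT.
  rewrite -ler_pdivlMr ?invr_gt0 ?mulr_gt0 ?ltr_wpDl// invrK.
  by move: C0; clear; lra.
have itv t : a <= t <= b' -> a <= t <= b.
  by move=> /andP[-> h]; exact: le_trans h b'b.
have cy : {within `[a, b'], continuous y}.
  apply/subspace_continuousP => t /= tab; apply/cvgrPdist_le => e e0.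
  have K1 : 0 < K + 1 by rewrite ltr_wpDl.
  rewrite in_itv/= in tab.
  apply/nbhs_ballP; exists (e / (K + 1)); first exact: divr_gt0.
  move=> z /= zt zab; rewrite in_itv/= in zab.
  apply: le_trans (ylip _ _ (itv _ tab) (itv _ zab)) _.
  apply: (@le_trans _ _ ((K + 1) * `|t - z|)).
    by rewrite ler_wpM2r// lerDl.
  by rewrite mulrC -ler_pdivlMr//; apply: ltW.
have [m mab mmax] := EVT_max (ltW ab') cy.
rewrite in_itv/= in mab.
have am : a < m.
  rewrite lt_neqAle; case/andP: (mab) => -> _; rewrite andbT.
  apply/eqP => am; have := mmax b'; rewrite in_itv/= lexx (ltW ab') => /(_ isT).
  by rewrite -am ya leNgt yp// ab'.
have ym : 0 < y m by apply: yp; rewrite am; case/andP: (itv _ mab).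
have /andP[_ mb'] := mab.
have : y m - y a <= C * y m * (m - a).
  apply: (@lipschitz_ae_derive_le y a m K) => //; first exact: ltW.
    move=> s t /andP[h1 h2] /andP[h3 h4]; apply: ylip; rewrite ?h1 ?h3/=.
      exact: le_trans h2 (le_trans mb' b'b).
    exact: le_trans h4 (le_trans mb' b'b).
  case: dy => E [mE muE HE]; exists E; split => // t /= nt; apply: HE => /= Ht.
  apply: nt => /andP[h1 h2]; have [|h3 h4] := Ht.
    by rewrite h1 (lt_le_trans h2)// (le_trans mb').
  split => //; apply: le_trans h4 _; rewrite ler_wpM2l//; apply: mmax.
  by rewrite in_itv/= (ltW h1) (le_trans (ltW h2)).
apply/negP; rewrite -ltNge ya subr0 mulrAC.
apply: (@le_lt_trans _ _ (1 / 2 * y m)); last by move: ym; clear; lra.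
rewrite ler_wpM2r ?(ltW ym)//; apply: le_trans b'a.
by rewrite ler_wpM2l// lerD2r.
Qed.

End ae_derivative.

(** * Regions between lifted jump curves *)

Lemma lipschitz_itv (R : realType) (f : R -> R) (a b : R) :
  [lipschitz f s | s in `[a, b]] ->
  exists2 K, 0 <= K & forall s t, a <= s <= b -> a <= t <= b ->
    `|f s - f t| <= K * `|s - t|.
Proof.
case=> M [_ HM]; exists (`|M| + 1); first by rewrite addr_ge0.
move=> s t sab tab; have := HM (`|M| + 1).
rewrite (le_lt_trans (ler_norm _)) ?ltrDl// => /(_ isT) h.
by have := h (s, t); rewrite /= !in_itv/=; apply; split.
Qed.

Lemma finite_min_pos (R : realType) (n : nat) (P : nat -> R -> Prop) :
  (forall i e e', P i e -> e' <= e -> P i e') ->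
  (forall i, (i < n)%N -> exists2 e, 0 < e & P i e) ->
  exists2 e, 0 < e & forall i, (i < n)%N -> P i e.
Proof.
move=> mono; elim: n => [|n IH] H; first by exists 1.
have [e e0 He] := IH (fun i h => H i (leqW h)).
have [e' e'0 He'] := H n (leqnn _).
exists (Num.min e e'); first by rewrite lt_min e0.
move=> i; rewrite ltnS leq_eqVlt => /predU1P[->|ilt].
  by apply: mono He' _; rewrite ge_min lexx orbT.
by apply: mono (He _ ilt) _; rewrite ge_min lexx.
Qed.

Lemma finite_max_bound (R : realType) (n : nat) (P : nat -> R -> Prop) :
  (forall i e e', P i e -> e <= e' -> P i e') ->
  (forall i, (i < n)%N -> exists2 e, 0 <= e & P i e) ->
  exists2 e, 0 <= e & forall i, (i < n)%N -> P i e.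
Proof.
move=> mono; elim: n => [|n IH] H; first by exists 0.
have [e e0 He] := IH (fun i h => H i (leqW h)).
have [e' e'0 He'] := H n (leqnn _).
exists (Num.max e e'); first by rewrite le_max e0.
move=> i; rewrite ltnS leq_eqVlt => /predU1P[->|ilt].
  by apply: mono He' _; rewrite le_max lexx orbT.
by apply: mono (He _ ilt) _; rewrite le_max lexx.
Qed.

Lemma lattice_sep (R : realType) (L z : R) : 0 < L ->
  (forall m : int, z <> m%:~R * L) ->
  exists2 e, 0 < e & forall m : int, e <= `|z - m%:~R * L|.
Proof.
move=> L0 zm.
pose k : int := Num.floor (z / L).
have /andP[k1 k2] : k%:~R <= z / L < (k + 1)%:~R.
  exact: floor_itv.
have k3 : k%:~R * L < z.
  rewrite lt_neqAle -ler_pdivlMr// k1 andbT; apply/eqP => h.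
  exact: (zm k).
have k4 : z < (k + 1)%:~R * L by rewrite -ltr_pdivrMr.
exists (Num.min (z - k%:~R * L) ((k + 1)%:~R * L - z)).
  by rewrite lt_min !subr_gt0 k3.
move=> m; have [mk|km] := leP m k.
  rewrite ge_min; apply/orP; left; apply: le_trans (ler_norm _).
  by rewrite lerD2l lerN2 ler_wpM2r ?ler_int// ltW.
rewrite ge_min; apply/orP; right; rewrite distrC; apply: le_trans (ler_norm _).
by rewrite lerD2r ler_wpM2r ?(ltW L0)// ler_int lezD1.
Qed.

Lemma half_gap_lt (R : realFieldType) (l l' x x' eta : R) : l < x ->
  eta <= `|l - x| -> `|x' - x| < eta / 2 -> `|l' - l| < eta / 2 -> l' < x'.
Proof.
move=> lx; rewrite ltr0_norm ?subr_lt0// !ltr_norml => h1 /andP[h2 h3] /andP[h4 h5].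
lra.
Qed.

Lemma half_gap_gt (R : realFieldType) (l l' x x' eta : R) : x < l ->
  eta <= `|l - x| -> `|x' - x| < eta / 2 -> `|l' - l| < eta / 2 -> x' < l'.
Proof.
move=> lx; rewrite gtr0_norm ?subr_gt0// !ltr_norml => h1 /andP[h2 h3] /andP[h4 h5].
lra.
Qed.

Section region.
Context (R : realType) (delta L : R) (f g : R -> R) (u : R -> R -> R) (a b : R)
  (n : nat) (y : nat -> R -> R).
Context (L_gt0 : 0 < L) (JC : jump_curves delta L f g u a b n y).

(* Periodicity is handled by following all the translates of the jump curves. *)
Definition lift_curve (p : nat * int) (r : R) : R := y p.1 r + p.2%:~R * L.

(* The points which, at time [r], are on the same side as [x0] at time [s] of every
   jump curve: the part of the domain, delimited by jump curves, in which the
   solution is followed backward from [(s, x0)]. *)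
Definition region (s x0 r x : R) : Prop := forall p, (p.1 < n)%N ->
  (lift_curve p s < x0 -> lift_curve p r < x) /\
  (x0 < lift_curve p s -> x < lift_curve p r).

Lemma lift_lipschitz : exists2 K, 0 <= K & forall p s t, (p.1 < n)%N ->
  a <= s <= b -> a <= t <= b ->
  `|lift_curve p s - lift_curve p t| <= K * `|s - t|.
Proof.
have [lip _ _ _] := JC.
have [|i ilt|K K0 HK] := @finite_max_bound R n (fun i K => forall s t,
    a <= s <= b -> a <= t <= b -> `|y i s - y i t| <= K * `|s - t|).
- move=> i e e' He ee' s t sab tab; apply: le_trans (He _ _ sab tab) _.
  by rewrite ler_wpM2r.
- exact: lipschitz_itv (lip _ ilt).
exists K => // p s t plt sab tab; rewrite /lift_curve opprD addrACA subrr addr0.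
exact: HK.
Qed.

Lemma jump_setE t x : a < t <= b ->
  jump_set (u t) x <-> exists2 p, (p.1 < n)%N & x = lift_curve p t.
Proof.
move=> tab; have [_ -> // _ _] := JC; split=> /=.
  by move=> [i [m [ilt ->]]]; exists (i, m).
by move=> [[i m] /= ilt ->]; exists i, m.
Qed.

(** There are infinitely many lifts, but they form finitely many translates of the lattice of
    multiples of [L]. *)
Lemma lift_sep r x : a < r <= b -> ~ jump_set (u r) x ->
  exists2 e, 0 < e & forall p, (p.1 < n)%N -> e <= `|lift_curve p r - x|.
Proof.
move=> rab nj.
have [|i ilt|e e0 He] := @finite_min_pos R n (fun i e =>
    forall m : int, e <= `|(x - y i r) - m%:~R * L|).
- by move=> i e e' He ee' m; exact: le_trans ee' (He m).
- apply: lattice_sep => // m h; apply: nj; apply/(jump_setE x rab).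
  by exists (i, m) => //; rewrite /lift_curve /= -h addrC subrK.
exists e => // p plt; apply: le_trans (He _ plt p.2) _.
by rewrite /lift_curve [leRHS]distrC opprD addrA.
Qed.

Lemma lift_merge p q s t : (p.1 < n)%N -> (q.1 < n)%N ->
  a < s -> s <= t -> t <= b -> lift_curve p s = lift_curve q s ->
  lift_curve p t = lift_curve q t.
Proof.
move=> plt qlt as_ st tb; rewrite /lift_curve => h.
have [_ _ merge _] := JC.
have := merge p.1 q.1 (q.2 - p.2) s t plt qlt as_ st tb.
rewrite intrB mulrBl => h2.
have h1 : y p.1 s = y q.1 s + (q.2%:~R * L - p.2%:~R * L) by rewrite addrA -h addrK.
by rewrite (h2 h1) addrA subrK.
Qed.

Lemma lift_continuous p r s : (p.1 < n)%N -> a <= r -> s <= b ->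
  {within `[r, s], continuous (lift_curve p)}.
Proof.
move=> plt ar sb; have [K K0 HK] := lift_lipschitz.
apply/subspace_continuousP => t /= tab; apply/cvgrPdist_le => e e0.
have K1 : 0 < K + 1 by rewrite ltr_wpDl.
have itv z : `[r, s]%classic z -> a <= z <= b.
  by rewrite /= in_itv/= => /andP[h1 h2]; rewrite (le_trans ar h1) (le_trans h2 sb).
apply/nbhs_ballP; exists (e / (K + 1)); first exact: divr_gt0.
move=> z /= zt zab.
apply: le_trans (HK _ _ _ plt (itv _ tab) (itv _ zab)) _.
apply: (@le_trans _ _ ((K + 1) * `|t - z|)).
  by rewrite ler_wpM2r// lerDl.
by rewrite mulrC -ler_pdivlMr//; apply: ltW.
Qed.

(** Were the order different at [r], the difference would vanish in between and the curves would
    have merged by [s]. The order is transported backward in time only: curves that are apart at [r]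
    may coincide at [s]. *)
Lemma lift_no_cross p q r s : (p.1 < n)%N -> (q.1 < n)%N ->
  a < r -> r <= s -> s <= b -> lift_curve p s < lift_curve q s ->
  lift_curve p r < lift_curve q r.
Proof.
move=> plt qlt ar rs sb pq; rewrite ltNge; apply/negP => qp.
pose d t := lift_curve p t - lift_curve q t.
have cd : {within `[r, s], continuous d}.
  move=> t; apply: cvgB; exact: (lift_continuous _ (ltW ar) sb).
have [t] : exists2 t, t \in `[r, s] & d t = 0.
  apply: IVT => //.
  by rewrite ge_min le_max !subr_le0 !subr_ge0 qp (ltW pq) orbT.
rewrite in_itv/= => /andP[rt ts] /subr0_eq dt.
have := lift_merge plt qlt (lt_le_trans ar rt) ts sb dt.
by move=> E; rewrite E ltxx in pq.
Qed.

Lemma region_refl s x0 : region s x0 s x0.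
Proof. by []. Qed.

Lemma region_convex s x0 r x z w : region s x0 r x -> region s x0 r z ->
  x <= w -> w <= z -> region s x0 r w.
Proof.
move=> rx rz xw wz p plt; have [h1 _] := rx p plt; have [_ h2] := rz p plt.
split=> h; first exact: lt_le_trans (h1 h) xw.
exact: le_lt_trans wz (h2 h).
Qed.

Lemma region_side s x0 p : a < s <= b -> ~ jump_set (u s) x0 -> (p.1 < n)%N ->
  lift_curve p s < x0 \/ x0 < lift_curve p s.
Proof.
move=> sab nj plt; have [h|h|h] := ltgtP (lift_curve p s) x0; [by left|by right|].
by exfalso; apply: nj; apply/(jump_setE _ sab); exists p.
Qed.

Lemma region_nojump s x0 r x : a < s <= b -> a < r <= b ->
  ~ jump_set (u s) x0 -> region s x0 r x -> ~ jump_set (u r) x.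
Proof.
move=> sab rab nj rx /(jump_setE _ rab) [p plt xE].
have [h1 h2] := rx p plt.
case: (region_side sab nj plt) => h.
  by have := h1 h; rewrite -xE ltxx.
by have := h2 h; rewrite -xE ltxx.
Qed.

Lemma region_open s x0 r x : a < s <= b -> a < r <= b ->
  ~ jump_set (u s) x0 -> region s x0 r x ->
  exists2 e, 0 < e & forall r' x', a <= r' <= b -> `|r' - r| < e ->
    `|x' - x| < e -> region s x0 r' x'.
Proof.
move=> sab rab nj rx; have njx := region_nojump sab rab nj rx.
have [eta eta0 Heta] := lift_sep rab njx.
have [K K0 HK] := lift_lipschitz.
have K1 : 0 < 2 * (K + 1) by rewrite mulr_gt0// ltr_wpDl.
exists (Num.min (eta / 2) (eta / (2 * (K + 1)))).
  by rewrite lt_min !divr_gt0.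
move=> r' x' r'ab; rewrite !lt_min => /andP[_ h1] /andP[h2 _] p plt.
have rab' : a <= r <= b by case/andP: rab => /ltW ->.
have h3 : `|lift_curve p r' - lift_curve p r| < eta / 2.
  apply: le_lt_trans (HK _ _ _ plt r'ab rab') _.
  apply: (@le_lt_trans _ _ ((K + 1) * `|r' - r|)); first by rewrite ler_wpM2r// lerDl.
  rewrite mulrC -ltr_pdivlMr ?ltr_wpDl//; apply: lt_le_trans h1 _.
  by rewrite invfM mulrA.
have h4 := Heta p plt; have [h5 h6] := rx p plt.
split=> h; first exact: half_gap_lt (h5 h) h4 h2 h3.
exact: half_gap_gt (h6 h) h4 h2 h3.
Qed.

(** Any point of a region may serve as its base point, which lets a backward line be restarted from
    an intermediate time. *)
Lemma region_rebase s x0 r x r' z : a < s <= b -> a < r <= b ->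
  ~ jump_set (u s) x0 -> region s x0 r x ->
  region s x0 r' z <-> region r x r' z.
Proof.
move=> sab rab nj rx.
have key p : (p.1 < n)%N -> (lift_curve p s < x0 <-> lift_curve p r < x) /\
    (x0 < lift_curve p s <-> x < lift_curve p r).
  move=> plt; have [h1 h2] := rx p plt.
  case: (region_side sab nj plt) => h.
    have h' := h1 h; split; split => //.
    by move=> k; have := lt_trans h' k; rewrite ltxx.
  have h' := h2 h; split; split => //.
  by move=> k; have := lt_trans h' k; rewrite ltxx.
split=> rz p plt; have [h1 h2] := rz p plt; have [k1 k2] := key p plt.
  by split => [/k1|/k2].
by split => [/k1|/k2].
Qed.

(** Admissibility speaks of open jump-free intervals; the margins beyond [x] and [z] make it
    applicable at these two points. *)
Lemma region_jump_free s x0 r x z : a < s <= b -> a < r <= b ->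
  ~ jump_set (u s) x0 -> region s x0 r x -> region s x0 r z -> x <= z ->
  exists A B, [/\ A < x, z < B, jump_free (u r) A B &
    forall w, A < w < B -> region s x0 r w].
Proof.
move=> sab rab nj rx rz xz.
have rab' : a <= r <= b by case/andP: rab => /ltW ->.
have [e e0 He] := region_open sab rab nj rx.
have [e' e'0 He'] := region_open sab rab nj rz.
have inr w : x - e < w < z + e' -> region s x0 r w.
  move=> /andP[h1 h2]; have [wx|xw] := ltP w x.
    apply: He => //; rewrite ?subrr ?normr0//.
    by rewrite ltr0_norm ?subr_lt0// opprB ltrBlDr -ltrBlDl.
  have [zw|wz] := ltP z w.
    apply: He' => //; rewrite ?subrr ?normr0//.
    by rewrite gtr0_norm ?subr_gt0// ltrBlDl.
  exact: region_convex rx rz xw wz.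
exists (x - e), (z + e'); split => //.
- by rewrite gtrBl.
- by rewrite ltrDl.
- rewrite /jump_free -subset0 => w [/=]; rewrite in_itv/= => wi.
  exact: region_nojump sab rab nj (inr _ wi).
Qed.

Lemma jump_free_region s x0 A B x : a < s <= b -> jump_free (u s) A B ->
  A < x0 < B -> A < x < B -> region s x0 s x.
Proof.
move=> sab jf /andP[Ax0 x0B] /andP[Ax xB] p plt.
have nj : ~ (A < lift_curve p s < B).
  move=> h; have : (`]A, B[ `&` jump_set (u s)) (lift_curve p s).
    by split; [rewrite /= in_itv|apply/(jump_setE _ sab); exists p].
  by rewrite jf.
split=> h.
  rewrite ltNge; apply/negP => k; apply: nj.
  by rewrite (lt_le_trans Ax k) (lt_trans h x0B).
rewrite ltNge; apply/negP => k; apply: nj.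
by rewrite (lt_trans Ax0 h) (le_lt_trans k xB).
Qed.

End region.

(** * Regularity of profiles and fluxes *)

Lemma MVT_open (R : realType) (h : R -> R) (x z : R) : x < z ->
  (forall w, x <= w <= z -> derivable h w 1) ->
  exists2 w, x < w < z & h z - h x = derive1 h w * (z - x).
Proof.
move=> xz dh.
have [||w wxz E] := @MVT R h (derive1 h) x z xz.
- move=> w; rewrite in_itv/= => /andP[h1 h2].
  by rewrite derive1E; apply: derivableP; apply: dh; rewrite !ltW.
- apply: derivable_within_continuous => w; rewrite in_itv/=; exact: dh.
- by exists w; [move: wxz; rewrite in_itv|].
Qed.

Lemma derive_lipschitz (R : realType) (h : R -> R) (M : R) :
  (forall v, derivable h v 1) -> continuous (derive1 h) ->
  exists2 K, 0 <= K & forall v v', 0 <= v <= M -> 0 <= v' <= M ->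
    `|h v - h v'| <= K * `|v - v'|.
Proof.
move=> dh ch; have [K K0 HK] := continuous_bounded_segment 0 M ch.
exists K => //.
have wl v v' : 0 <= v -> v < v' -> v' <= M -> `|h v' - h v| <= K * `|v' - v|.
  move=> v0 vv vM; have [w /andP[w1 w2] ->] := @MVT_open _ h _ _ vv (fun w _ => dh w).
  rewrite normrM ler_wpM2r//; apply: HK.
  by rewrite (le_trans v0 (ltW w1)) (le_trans (ltW w2) vM).
move=> v v' /andP[h1 h2] /andP[h3 h4].
have [vv|vv|->] := ltgtP v v'; last by rewrite !subrr normr0 mulr0.
  by rewrite distrC [X in _ * X]distrC; exact: wl.
exact: wl.
Qed.

(** By the mean value theorem the last left-hand side is [|h'(w) - h'(c)|] times [|v - v'|] for some
    [w] between [v] and [v']. This is the quadratic flux error wanted by [local_line] at the speed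
    [h'(c)]. *)
Lemma C2_line_bound (R : realType) (h : R -> R) (M : R) :
  (forall v, derivable h v 1) -> (forall v, derivable (derive1 h) v 1) ->
  continuous (derive1n 2 h) ->
  exists2 K, 0 <= K & (forall v v', 0 <= v <= M -> 0 <= v' <= M ->
      `|derive1 h v - derive1 h v'| <= K * `|v - v'|) /\
    (forall c v v', 0 <= c <= M -> 0 <= v <= M -> 0 <= v' <= M ->
    `|h v - h v' - derive1 h c * (v - v')| <= K * (`|v - c| + `|v' - c|) * `|v - v'|).
Proof.
move=> dh dh' ch2.
have [K K0 HK] := derive_lipschitz M dh' ch2.
exists K => //; split => // c v v' cM.
have wl z z' : 0 <= z <= M -> 0 <= z' <= M -> z < z' ->
    `|h z' - h z - derive1 h c * (z' - z)| <= K * (`|z' - c| + `|z - c|) * `|z' - z|.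
  move=> /andP[z0 _] /andP[_ z'M] zz.
  have [w /andP[w1 w2] ->] := @MVT_open _ h _ _ zz (fun w _ => dh w).
  rewrite -mulrBl normrM ler_wpM2r//.
  apply: le_trans (HK _ _ _ cM) _.
    by rewrite (le_trans z0 (ltW w1)) (le_trans (ltW w2) z'M).
  rewrite ler_wpM2l//.
  have [wc|cw] := leP w c.
    rewrite ler0_norm ?subr_le0// opprB.
    have := ler_norm (- (z - c)); rewrite normrN; have := normr_ge0 (z' - c).
    by move: w1; clear; lra.
  rewrite gtr0_norm ?subr_gt0//.
  have := ler_norm (z' - c); have := normr_ge0 (z - c).
  by move: w2; clear; lra.
move=> vM v'M; have [vv|vv|->] := ltgtP v v'.
- have := wl _ _ vM v'M vv.
  rewrite [`|v' - c| + _]addrC [`|v' - v|]distrC.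
  have -> : h v' - h v - derive1 h c * (v' - v) = - (h v - h v' - derive1 h c * (v - v')).
    by ring.
  by rewrite normrN.
- exact: wl.
- by rewrite !subrr mulr0 subrr normr0 mulr0.
Qed.

Section joint_continuity.
Context {R : realType}.
Notation mu := (@lebesgue_measure R).

Lemma integral_abs_ge (w : R -> R) (l r A B e : R) :
  measurable_fun setT w -> A <= l -> l <= r -> r <= B -> 0 <= e ->
  (forall z, l <= z <= r -> e <= `|w z|) ->
  ((e * (r - l))%:E <= \int[mu]_(z in `[A, B]) `|w z|%:E)%E.
Proof.
move=> mw Al lr rB e0 we.
have mw' D : measurable D -> measurable_fun D (fun z => `|w z|%:E).
  move=> mD; apply/measurable_EFinP; apply: (@measurableT_comp _ _ _ _ _ _ (@Num.norm _ R)); first exact: normr_measurable.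
  exact: measurable_funTS.
apply: (@le_trans _ _ (\int[mu]_(z in `[l, r]) `|w z|%:E)%E); last first.
  apply: ge0_subset_integral => //; first exact: mw'.
  by move=> z /=; rewrite !in_itv/= => /andP[h1 h2]; rewrite (le_trans Al h1) (le_trans h2 rB).
apply: (@le_trans _ _ (\int[mu]_(z in `[l, r]) (cst e%:E z))%E).
  rewrite integral_cst//= lebesgue_measure_itv/= lte_fin; case: ifPn => [_|].
    by rewrite -EFinB -EFinM.
  rewrite -leNgt => h; have -> : r = l by apply/eqP; rewrite eq_le h.
  by rewrite subrr mulr0 mule0.
by apply: ge0_le_integral => //; exact: mw'.
Qed.

(* Monotone functions converging in L^1 to a continuous function converge
   locally uniformly. *)
Lemma monotone_joint_continuity (u : R -> R -> R) (T : set R) (r x e : R) :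
  0 < e -> 0 <= r ->
  (forall t, 0 <= t -> measurable_fun setT (u t)) ->
  (forall A B, (\int[mu]_(z in `[A, B]) `|u s z - u r z|%:E)%E
     @[s --> within `[0, +oo[ (nbhs r)] --> 0%E) ->
  T `<=` [set t | 0 <= t] ->
  (forall t, T t -> forall z z', x - e < z -> z <= z' -> z' < x + e ->
    u t z' <= u t z) ->
  {for x, continuous (u r)} ->
  forall eta, 0 < eta -> exists2 d, 0 < d & forall t z, T t -> `|t - r| < d ->
    `|z - x| < d -> `|u t z - u r x| <= eta.
Proof.
move=> e0 r0 mu_ L1 T0 mono cx eta eta0.
have eta2 : 0 < eta / 2 by rewrite divr_gt0.
move: cx => /cvgrPdist_le/(_ _ eta2) /nbhs_ballP[d1 /= d10 Hd1].
pose h := Num.min (e / 3) (d1 / 3).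
have h0 : 0 < h by rewrite lt_min !divr_gt0.
have he : h <= e / 3 by rewrite ge_min lexx.
have hd : h <= d1 / 3 by rewrite ge_min lexx orbT.
clearbody h.
have near z : x - 2 * h <= z <= x + 2 * h -> `|u r x - u r z| <= eta / 2.
  move=> /andP[h1 h2]; apply: Hd1; rewrite /ball /= ltr_norml.
  by move: h1 h2 hd d10; clear => *; apply/andP; split; lra.
(* By monotonicity, a deviation of more than [eta] at one point near [x] persists at level [eta / 2]
   on a whole interval of length [h], on the right if the value is too small and on the left if it
   is too large; this costs at least [eta / 2 * h] in L^1. *)
have het : 0 < eta / 2 * h by rewrite mulr_gt0.
have := L1 (x - 2 * h) (x + 2 * h).
move=> /fine_cvgP[fin].
move=> /cvgrPdist_lt/(_ _ het) cv.
have {cv}fin : \forall s \near within `[0, +oo[ (nbhs r),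
   (\int[mu]_(z in `[(x - 2 * h)%R, (x + 2 * h)%R]) `|u s z - u r z|%:E < (eta / 2 * h)%:E)%E.
  near=> s.
  have fs : (\int[mu]_(z in `[(x - 2 * h)%R, (x + 2 * h)%R]) `|u s z - u r z|%:E)%E \is a fin_num.
    by near: s.
  rewrite -[X in (X < _)%E]fineK// lte_fin.
  apply: le_lt_trans (ler_norm _) _; rewrite -normrN -sub0r.
  by near: s; exact: cv.
move: fin => /nbhs_ballP[d2 /= d20 Hd2].
exists (Num.min h d2); first by rewrite lt_min h0.
move=> t z Tt; rewrite !lt_min => /andP[_ td2] /andP[zh _].
have t0 : 0 <= t by exact: T0.
have small := Hd2 t; rewrite /ball/= distrC in_itv/= andbT in small.
have {}small := small td2 t0.
have mut : measurable_fun setT (fun z => u t z - u r z).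
  by apply: measurable_funB; exact: mu_.
move: zh; rewrite ltr_norml => /andP[z1 z2].
rewrite ler_norml; apply/andP; split; rewrite leNgt; apply/negP => big.
- have := @integral_abs_ge _ (x + h) (x + 2 * h) (x - 2 * h) (x + 2 * h) (eta / 2) mut.
  have -> : x + 2 * h - (x + h) = h by ring.
  move=> /(_ _ _ _ (ltW eta2)) H; have := le_lt_trans (H _ _ _ _) small.
  rewrite ltxx => HH; have // : false.
  apply: HH; rewrite ?lexx//.
  + by move: h0; clear; lra.
  + by move: h0; clear; lra.
  + move=> q /andP[q1 q2].
    have m1 : u t q <= u t z.
      apply: mono => //; first by move: z1 h0 he; clear; lra.
        by move: q1 z2; clear; lra.
      by move: q2 he e0; clear; lra.
    have m2 : `|u r x - u r q| <= eta / 2.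
      by apply: near; move: q1 q2 h0; clear => *; apply/andP; split; lra.
    move: m2; rewrite ler_norml => /andP[m2 m3].
    apply: (@le_trans _ _ (- (u t q - u r q))); last by rewrite -normrN ler_norm.
    by move: m1 m2 m3 big; clear; lra.
- have := @integral_abs_ge _ (x - 2 * h) (x - h) (x - 2 * h) (x + 2 * h) (eta / 2) mut.
  have -> : x - h - (x - 2 * h) = h by ring.
  move=> /(_ _ _ _ (ltW eta2)) H; have := le_lt_trans (H _ _ _ _) small.
  rewrite ltxx => HH; have // : false.
  apply: HH; rewrite ?lexx//.
  + by move: h0; clear; lra.
  + by move: h0; clear; lra.
  + move=> q /andP[q1 q2].
    have m1 : u t z <= u t q.
      apply: mono => //; first by move: q1 he e0; clear; lra.
        by move: q2 z1; clear; lra.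
      by move: z2 he h0; clear; lra.
    have m2 : `|u r x - u r q| <= eta / 2.
      by apply: near; move: q1 q2 h0; clear => *; apply/andP; split; lra.
    move: m2; rewrite ler_norml => /andP[m2 m3].
    apply: (@le_trans _ _ (u t q - u r q)); last by rewrite ler_norm.
    by move: m1 m2 m3 big; clear; lra.
Unshelve. all: by end_near. Qed.

End joint_continuity.

(** * The two phases of a solution *)

Lemma half_lt (R : realFieldType) (e : R) : 0 < e -> e / 2 < e.
Proof. by move=> e0; lra. Qed.

Lemma ball_itv_sub (R : realFieldType) (x0 x e : R) : `|x - x0| < e / 2 ->
  x0 - e <= x - e / 2 /\ x + e / 2 <= x0 + e.
Proof. by rewrite ltr_norml => /andP[h1 h2]; split; lra. Qed.

Section solution.
Context (R : realType) (alpha beta betas delta L u0 : R) (f g : R -> R)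
  (u : R -> R -> R).
Context (delta_gt0 : 0 < delta)
  (A1 : assumption_A1 alpha beta betas f g)
  (weak : weak_solution delta L f g (cst u0) u)
  (adm : forall s, 0 <= s -> admissible_profile alpha delta L u0 (u s))
  (neg : (@lebesgue_measure R \x @lebesgue_measure R)%E.-negligible
        [set p | [/\ 0 < p.1, derivable (u p.1) p.2 1
                   & dx u p.1 p.2 = - delta]]).
Notation mu := (@lebesgue_measure R).

Definition f_phase (s x : R) : Prop := - delta < derive1 (u s) x.

Lemma sol_range s x : 0 <= s -> 0 < u s x < alpha.
Proof.
move=> s0; have [_ _ [_ lb ub inf0 supa] _] := adm s0.
apply/andP; split.
  by apply: lt_le_trans inf0 _; apply: ge_inf.
by apply: le_lt_trans supa; exact: ub_le_sup.
Qed.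

Lemma jump_freeS (w : R -> R) A B A' B' : A <= A' -> B' <= B ->
  jump_free w A B -> jump_free w A' B'.
Proof.
move=> AA BB jf; rewrite /jump_free -subset0 -jf => x [] /=.
rewrite !in_itv/= => /andP[h1 h2] h3; split => //=.
by rewrite ?in_itv/= (le_lt_trans AA h1) (lt_le_trans h2 BB).
Qed.

Lemma jump_free_derivable s A B x : 0 <= s -> jump_free (u s) A B ->
  A < x < B -> derivable (u s) x 1.
Proof. by move=> s0 jf; have [_ [_ /(_ A B jf)[d _ _]] _ _] := adm s0; exact: d. Qed.

Lemma jump_free_mono s A B x z : 0 <= s -> jump_free (u s) A B ->
  A < x -> x <= z -> z < B -> u s z <= u s x.
Proof. by move=> s0 jf; have [_ [_ /(_ A B jf)[_ _ m]] _ _] := adm s0; exact: m. Qed.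

Lemma jump_free_continuous s A B x : 0 <= s -> jump_free (u s) A B ->
  A < x < B -> {for x, continuous (u s)}.
Proof.
move=> s0 jf xAB; apply: differentiable_continuous.
apply/derivable1_diffP; exact: jump_free_derivable jf xAB.
Qed.

(** By [profile_P3], a slope at most [- delta] somewhere is the slope of the whole interval; the
    phase is thus a property of the interval and not of the point. *)
Lemma jump_free_phase s A B x z : 0 <= s -> jump_free (u s) A B ->
  A < x < B -> A < z < B -> f_phase s x -> f_phase s z.
Proof.
move=> s0 jf xAB zAB fx; rewrite /f_phase ltNge; apply/negP => dz.
have [_ _ _ p3] := adm s0.
have := p3 A B z x jf zAB xAB dz => E.
by move: fx; rewrite /f_phase E ltNge dz.
Qed.

Lemma f_phase_slope s A B x z : 0 <= s -> jump_free (u s) A B ->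
  A < x -> x < z -> z < B -> f_phase s x -> u s x - u s z < delta * (z - x).
Proof.
move=> s0 jf Ax xz zB fx.
have [|w /andP[w1 w2] E] := @MVT_open _ (u s) x z xz.
  move=> w /andP[w1 w2]; apply: jump_free_derivable s0 jf _.
  by rewrite (lt_le_trans Ax w1) (le_lt_trans w2 zB).
have fw : f_phase s w.
  apply: jump_free_phase s0 jf _ _ fx; first by rewrite Ax (lt_trans xz zB).
  by rewrite (lt_trans Ax w1) (lt_trans w2 zB).
rewrite -opprB E -mulNr ltr_pM2r ?subr_gt0//.
by move: fw; rewrite /f_phase ltrNl.
Qed.

Lemma g_phase_slope s A B x z : 0 <= s -> jump_free (u s) A B ->
  A < x < B -> A < z < B -> ~ f_phase s x ->
  u s x - u s z = - derive1 (u s) x * (z - x).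
Proof.
move=> s0 jf xAB zAB nfx.
have dx : derive1 (u s) x <= - delta by rewrite leNgt; apply/negP.
have [_ _ _ p3] := adm s0.
have E w : A < w < B -> derive1 (u s) w = derive1 (u s) x.
  by move=> wAB; exact: p3 jf xAB wAB dx.
have d w : A < w < B -> derivable (u s) w 1 by exact: jump_free_derivable.
case/andP: xAB => Ax xB; case/andP: zAB => Az zB.
have [xz|zx|->] := ltgtP x z.
- have [|w /andP[w1 w2] E'] := @MVT_open _ (u s) x z xz.
    by move=> w /andP[w1 w2]; apply: d; rewrite (lt_le_trans Ax w1) (le_lt_trans w2 zB).
  rewrite -opprB E' E; first by rewrite mulNr.
  by rewrite (lt_trans Ax w1) (lt_trans w2 zB).
- have [|w /andP[w1 w2] ->] := @MVT_open _ (u s) z x zx.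
    by move=> w /andP[w1 w2]; apply: d; rewrite (lt_le_trans Az w1) (le_lt_trans w2 xB).
  rewrite E; first by ring.
  by rewrite (lt_trans Az w1) (lt_trans w2 xB).
- by rewrite !subrr mulr0.
Qed.

Lemma sol_measurable s : 0 <= s -> measurable_fun setT (u s).
Proof.
by move=> s0; have [[_ _ h] _ _ _] := weak; have [] := h s s0.
Qed.

(** The set [T] of times at which a fixed neighbourhood of [x] is free of jumps is arbitrary, so
    that limits from one side, in particular at the beginning of a time interval, are covered. *)
Lemma sol_continuous (T : set R) (r x e : R) : 0 < e -> T `<=` [set t | 0 <= t] ->
  T r -> (forall t, T t -> jump_free (u t) (x - e) (x + e)) ->
  forall eta, 0 < eta -> exists2 d, 0 < d & forall t z, T t -> `|t - r| < d ->
    `|z - x| < d -> `|u t z - u r x| <= eta.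
Proof.
move=> e0 T0 Tr jf.
have r0 : 0 <= r by exact: T0.
apply: (@monotone_joint_continuity R u T r x e) => //.
- by move=> t; exact: sol_measurable.
- by move=> A B; have [_ h _ _] := weak; exact: h.
- move=> t Tt z z' h1 h2 h3; exact: jump_free_mono (T0 _ Tt) (jf _ Tt) h1 h2 h3.
- apply: jump_free_continuous (jf _ Tr) _ => //.
  by rewrite gtrBl ltrDl e0.
Qed.

(** Facts common to the two fluxes, so that they can be treated alike. The gap of the speeds holds
    up to the ends of [[0, alpha]] because the mean value theorem evaluates the second derivative at
    interior points. *)
Lemma A1_facts : [/\ 0 < alpha, 0 < beta, 0 < betas,
  (forall h, h = f \/ h = g -> [/\ (forall v, derivable h v 1),
     (forall v, derivable (derive1 h) v 1) & continuous (derive1n 2 h)]) &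
  (forall h, h = f \/ h = g -> forall v w, 0 <= v -> v <= w -> w <= alpha ->
     betas * (w - v) <= derive1 h v - derive1 h w)].
Proof.
have [[a0 b0 bs0] gE [df ddf cf _] _ conc] := A1.
have dg (v : R) : is_derive v 1 g (beta / 2 * alpha - beta * v).
  have -> : g = (fun v => beta / 2 * v * (alpha - v)) by apply/funext.
  apply: is_derive_eq.
  by rewrite /GRing.scale/=; field.
have d1g : derive1 g = fun v => beta / 2 * alpha - beta * v.
  by apply/funext => v; rewrite derive1E; have [_ ->] := dg v.
have ddg (v : R) : is_derive v 1 (derive1 g) (- beta).
  rewrite d1g; apply: is_derive_eq.
  rewrite /GRing.scale/=; ring.
have d2g : derive1n 2 g = cst (- beta).
  by apply/funext => v; rewrite /= derive1E; have [_ ->] := ddg v.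
have reg h : h = f \/ h = g -> [/\ (forall v, derivable h v 1),
     (forall v, derivable (derive1 h) v 1) & continuous (derive1n 2 h)].
  case=> ->; first by split; [exact: df|exact: ddf|exact: cf].
  split.
  - by move=> v; have [] := dg v.
  - by move=> v; have [] := ddg v.
  - by rewrite d2g => v; exact: cvg_cst.
split; [exact: a0|exact: b0|exact: bs0|exact: reg|].
move=> h hfg v w v0 vw wa.
have [_ dh _] := reg h hfg.
move: vw; rewrite le_eqVlt => /predU1P[->|vw]; first by rewrite !subrr mulr0.
have [z /andP[z1 z2] E] := @MVT_open _ (derive1 h) v w vw (fun z _ => dh z).
have z0a : 0 < z < alpha by rewrite (le_lt_trans v0 z1) (lt_le_trans z2 wa).
have [_ c1 c2] := conc z z0a.
have c : derive1 (derive1 h) z <= - betas.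
  by case: hfg => hE; rewrite hE; [exact: c1|exact: c2].
rewrite -[leRHS]opprB E -mulNr ler_wpM2r ?subr_ge0 ?(ltW vw)//.
by rewrite lerNr.
Qed.

Lemma sol_line (h : R -> R) (r0 x0 e : R) : 0 < e -> 0 < r0 - e ->
  (forall t, r0 - e < t <= r0 -> jump_free (u t) (x0 - e) (x0 + e)) ->
  (h = f /\ forall t, r0 - e < t < r0 -> f_phase t x0) \/
  (h = g /\ forall t, r0 - e < t < r0 -> ~ f_phase t x0) ->
  exists2 e', 0 < e' & forall t, r0 - e' < t <= r0 ->
    u t (x0 + derive1 h (u r0 x0) * (t - r0)) = u r0 x0.
Proof.
move=> e0 r00 jf phase.
have [a0 b0 bs0 reg _] := A1_facts.
have hfg : h = f \/ h = g by case: phase => -[-> _]; [left|right].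
have [dh ddh cddh] := reg h hfg.
have cont k : k = f \/ k = g -> continuous k.
  move=> /reg[dk _ _] x; apply: differentiable_continuous.
  by apply/derivable1_diffP; exact: dk.
have cf := cont f (or_introl erefl); have cg := cont g (or_intror erefl).
have [Cf Cf0 HCf] := continuous_bounded_segment 0 alpha cf.
have [Cg Cg0 HCg] := continuous_bounded_segment 0 alpha cg.
pose M := alpha + Cf + Cg.
have M0 : 0 <= M by rewrite !addr_ge0// ltW.
have aM : alpha <= M by rewrite /M -addrA lerDl addr_ge0.
have [K K0 [_ HK]] := C2_line_bound M dh ddh cddh.
have [[_ mu_u _] _ _ [Th [mTh Th01 Thf Thg wk]]] := weak.
pose B t x := Th (t, x) * f (u t x) + (1 - Th (t, x)) * g (u t x).
have e20 : 0 < e / 2 by rewrite divr_gt0.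
have e2e : e / 2 < e by exact: half_lt.
have re2 : r0 - e < r0 - e / 2 by rewrite ltrD2l ltrN2.
have pos t : r0 - e < t -> 0 <= t by move=> h1; apply: ltW; exact: lt_trans r00 h1.
have muu : measurable_fun [set p : R * R | 0 < p.1] (fun p => u p.1 p.2).
  apply: measurable_funS mu_u; last by move=> p /= /ltW.
  have -> : [set p : R * R | 0 <= p.1] = setT `&` (fst @^-1` `[0, +oo[).
    by apply/seteqP; split => p /=; rewrite in_itv/= andbT//; move=> [].
  exact: (measurable_fst measurableT).
have mB : measurable_fun [set p : R * R | 0 < p.1] (fun p => B p.1 p.2).
  have mTh' : measurable_fun [set p : R * R | 0 < p.1] (fun p => Th (p.1, p.2)).
    rewrite (_ : (fun p : R * R => _) = Th); last by apply/funext => -[].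
    exact: measurable_funTS.
  apply: measurable_funD; apply: measurable_funM => //.
  - by apply: (@measurableT_comp _ _ _ _ _ _ f) => //; exact: continuous_measurable_fun.
  - exact: measurable_funB.
  - by apply: (@measurableT_comp _ _ _ _ _ _ g) => //; exact: continuous_measurable_fun.
have phase' t x : r0 - e < t < r0 -> `|x - x0| < e ->
    (h = f /\ f_phase t x) \/ (h = g /\ ~ f_phase t x).
  move=> /andP[t1 t2]; rewrite ltr_distl => xi.
  have jft : jump_free (u t) (x0 - e) (x0 + e) by apply: jf; rewrite t1 ltW.
  have x0i : x0 - e < x0 < x0 + e by rewrite gtrBl ltrDl e0.
  case: phase => -[-> ph]; [left|right]; split => //.
    by apply: jump_free_phase (pos _ t1) jft x0i xi _; apply: ph; rewrite t1.
  move=> fx; apply: (ph t); first by rewrite t1.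
  exact: jump_free_phase (pos _ t1) jft xi x0i fx.
(* A Lipschitz constant uniform in time: slopes are above [- delta] in phase [f], while in phase [g]
   the slope is constant on an interval of length [2 * e] and the values lie between [0] and
   [alpha]. *)
pose D := delta + alpha / e.
have D0 : 0 <= D by rewrite addr_ge0// ?divr_ge0// ltW.
have rng t x : r0 - e < t -> 0 <= u t x <= alpha.
  by move=> /pos/(sol_range x)/andP[h1 h2]; rewrite !ltW.
have r0t : 0 <= r0 by rewrite ltW// -(subrK e r0) addr_gt0.
apply: (@local_line R u B h [set p | [/\ 0 < p.1, derivable (u p.1) p.2 1
                   & dx u p.1 p.2 = - delta]] r0 x0 (derive1 h (u r0 x0))
   (e / 2) D K M (u r0 x0)) => //.
- exact: lt_trans r00 re2.
- move=> phi tp; rewrite -[RHS](wk phi tp).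
  by apply: eq_Rintegral => -[t x] _.
- by case: phase => -[-> _]; [exact: cf|exact: cg].
- move=> t x /andP[t1 _] _; have /andP[-> h2] := @rng t x (lt_trans re2 t1).
  exact: le_trans h2 aM.
- move=> t x /andP[t1 t2] xx0; have t1' := lt_trans re2 t1.
  have ux := rng t x t1'; have t0 : 0 < t by exact: lt_trans r00 t1'.
  have /andP[Th0 Th1] := Th01 (t, x); split.
    rewrite /B (le_trans (ler_normD _ _))// !normrM (ger0_norm Th0).
    rewrite (ger0_norm (_ : 0 <= 1 - Th (t, x))) ?subr_ge0//.
    apply: (@le_trans _ _ (Cf + Cg)); last by rewrite /M -addrA lerDr ltW.
    have Th1' : 1 - Th (t, x) <= 1 by rewrite gerBl.
    by apply: lerD; rewrite -[leRHS]mul1r ler_pM// ?subr_ge0// ?HCf ?HCg.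
  (* Outside the null set the slope differs from [- delta], so that [Th] is determined by the
     phase. *)
  move=> nN; have itx : r0 - e < t < r0 by rewrite t1' t2.
  have dut : derivable (u t) x 1.
    apply: (jump_free_derivable (A := x0 - e) (B := x0 + e)) => //; first exact: ltW.
      by apply: jf; rewrite t1' ltW.
    by rewrite -ltr_distl (lt_trans xx0 e2e).
  case: (phase' t x itx (lt_trans xx0 e2e)) => -[-> ph]; rewrite /B.
    by rewrite Thf// mul1r subrr mul0r addr0.
  rewrite Thg ?mul0r ?subr0 ?mul1r ?add0r//.
  have [//|dd|dd] := ltgtP (dx u t x) (- delta); first by case: (ph dd).
  by case: nN.
- move=> t x x' /andP[t1 t2] h1 h2; have t1' := lt_trans re2 t1.
  have itx : r0 - e < t < r0 by rewrite t1' t2.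
  have t0 := pos _ t1'.
  have jft : jump_free (u t) (x0 - e) (x0 + e) by apply: jf; rewrite t1' ltW.
  have xi : x0 - e < x < x0 + e by rewrite -ltr_distl (lt_trans h1 e2e).
  have xi' : x0 - e < x' < x0 + e by rewrite -ltr_distl (lt_trans h2 e2e).
  case: (phase' t x itx (lt_trans h1 e2e)) => -[_ ph]; last first.
    have E z : x0 - e < z < x0 + e -> u t x - u t z = - derive1 (u t) x * (z - x).
      by move=> zi; exact: g_phase_slope t0 jft xi zi ph.
    have dle : 0 <= - derive1 (u t) x.
      move: ph; rewrite /f_phase => /negP; rewrite -leNgt => hd.
      by rewrite oppr_ge0 (le_trans hd)// oppr_le0 ltW.
    rewrite E// normrM (ger0_norm dle) [X in _ * X]distrC ler_wpM2r//.
    apply: (@le_trans _ _ (alpha / e)); last by rewrite /D lerDr ltW.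
    have i1 : x0 - e < x0 - e / 2 < x0 + e.
      by rewrite ltrD2l ltrN2 e2e/= ltrD2l (lt_trans _ e0)// oppr_lt0.
    have i2 : x0 - e < x0 + e / 2 < x0 + e.
      by rewrite [X in _ && X]ltrD2l e2e andbT ltrD2l (lt_trans _ e20)// oppr_lt0.
    rewrite ler_pdivlMr//.
    have -> : - derive1 (u t) x * e = u t (x0 - e / 2) - u t (x0 + e / 2).
      have -> : u t (x0 - e / 2) - u t (x0 + e / 2) =
        (u t x - u t (x0 + e / 2)) - (u t x - u t (x0 - e / 2)) by ring.
      by rewrite !E//; field.
    have /andP[_ ha] := rng t (x0 - e / 2) t1'.
    have /andP[hb _] := rng t (x0 + e / 2) t1'.
    by apply: le_trans ha; rewrite gerBl.
  have wl z z' : x0 - e < z -> z' < x0 + e -> z < z' -> f_phase t z ->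
      `|u t z - u t z'| <= D * `|z - z'|.
    move=> za zb zz fz; have := f_phase_slope t0 jft za zz zb fz => /ltW sl.
    have mo := jump_free_mono t0 jft za (ltW zz) zb.
    rewrite ger0_norm ?subr_ge0// [X in _ * X]distrC gtr0_norm ?subr_gt0//.
    apply: le_trans sl _; rewrite ler_wpM2r ?subr_ge0 ?(ltW zz)//.
    by rewrite /D lerDl divr_ge0// ltW.
  case/andP: (xi) => xa xb; case/andP: (xi') => xa' xb'.
  have [xx|xx|->] := ltgtP x x'; last by rewrite !subrr normr0 mulr0.
    exact: wl.
  rewrite distrC [X in _ * X]distrC; apply: wl => //.
  exact: jump_free_phase t0 jft xi xi' ph.
- move=> t x /andP[t1 t2] xx0 eta eta0.
  have tT : [set t | r0 - e / 2 < t <= r0] t by rewrite /= t1.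
  have [|t' /andP[h1 h2]|d d0 Hd] := sol_continuous e20 _ tT _ eta0 (x := x).
  + by move=> t' /= /andP[h1 _]; apply: pos; exact: lt_trans re2 h1.
  + have [k1 k2] := ball_itv_sub xx0.
    apply: jump_freeS k1 k2 _; apply: jf; rewrite h2 andbT.
    exact: lt_trans re2 h1.
  + by exists d => // t' x' h1 _ h2 h3; apply: Hd.
- move=> v v' h1 h2; apply: HK => //.
  have /andP[k1 k2] := sol_range x0 r0t.
  by rewrite (ltW k1) (le_trans (ltW k2) aM).
Qed.

End solution.

(** * Speed of the jumps *)

Lemma derive1_shift (R : realType) (w : R -> R) (c x : R) :
  derive1 (fun z => w (z + c)) x = derive1 w (x + c).
Proof.
have E : (fun h : R => h^-1 *: (w (h + x + c) - w (x + c))) =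
    (fun h => h^-1 *: (w (h + (x + c)) - w (x + c))).
  by apply/funext => h; rewrite addrA.
by rewrite /derive1 -E.
Qed.

Lemma periodic_int (R : realType) (L : R) (w : R -> R) (m : int) x :
  periodic_with L w -> w (x + m%:~R * L) = w x.
Proof.
move=> per; have pos k z : w (z + k%:R * L) = w z.
  elim: k z => [|k IH] z; first by rewrite mul0r addr0.
  by rewrite -addn1 natrD mulrDl mul1r addrA per.
case: (intP m) => [|k|k]; first by rewrite mul0r addr0.
  exact: pos.
rewrite mulrNz mulNr.
by rewrite -[in RHS](subrK (k.+1%:R * L) x) pos.
Qed.

Section rankine_hugoniot_speed.
Context (R : realType) (alpha beta betas delta L u0 : R) (f g : R -> R)
  (u : R -> R -> R).
Context (A1 : assumption_A1 alpha beta betas f g)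
  (adm : forall s, 0 <= s -> admissible_profile alpha delta L u0 (u s)).

Lemma f_phase_periodic s x (m : int) : 0 <= s ->
  f_phase delta u s (x + m%:~R * L) <-> f_phase delta u s x.
Proof.
move=> s0; have [per _ _ _] := adm s0.
rewrite /f_phase -(derive1_shift (u s) (m%:~R * L)).
have -> : (fun z => u s (z + m%:~R * L)) = u s.
  by apply/funext => z; exact: periodic_int.
by [].
Qed.

Lemma g_le_f v : 0 <= v <= alpha -> g v <= f v.
Proof.
have [_ _ _ [f0 g0 fa ga _] conc] := A1.
move=> /andP[]; rewrite le_eqVlt => /predU1P[<-|v0]; first by rewrite f0 g0.
rewrite le_eqVlt => /predU1P[->|va]; first by rewrite fa ga.
by have [/ltW] := conc v (introT andP (conj v0 va)).
Qed.

Lemma sol_range_le s x : 0 <= s -> 0 <= u s x <= alpha.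
Proof. by move=> /(sol_range adm x)/andP[h1 h2]; rewrite !ltW. Qed.

Lemma local_flux_le_f s x : 0 <= s -> local_flux delta f g (u s) x <= f (u s x).
Proof.
by move=> s0; rewrite /local_flux; case: ifP => // _; exact/g_le_f/sol_range_le.
Qed.

Lemma local_flux_f s x : f_phase delta u s x ->
  local_flux delta f g (u s) x = f (u s x).
Proof. by rewrite /local_flux /f_phase => ->. Qed.

(** Whatever the phases on the two sides, each flux is at most that of [f]; this is all that is
    known about the side of the jump opposite to the region under study. *)
Lemma rh_facts (y : R -> R) r : 0 <= r -> upward_jump (u r) (y r) ->
  rankine_hugoniot delta f g u y r -> derivable y r 1 /\
  exists ul ur Fl Fr,
    [/\ u r x @[x --> (y r)^'-] --> ul, u r x @[x --> (y r)^'+] --> ur,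
        0 <= ul < ur /\ ur <= alpha
      & [/\ local_flux delta f g (u r) x @[x --> (y r)^'-] --> Fl,
            local_flux delta f g (u r) x @[x --> (y r)^'+] --> Fr,
            derive1 y r * (ur - ul) = Fr - Fl, Fl <= f ul & Fr <= f ur]].
Proof.
move=> r0 [l [r' [cl cr lr _]]] [dy [ul [ur [Fl [Fr [cul cur cFl cFr E]]]]]].
split => //; exists ul, ur, Fl, Fr.
have ulE : ul = l by rewrite -(cvg_lim _ cul)// -(cvg_lim _ cl).
have urE : ur = r' by rewrite -(cvg_lim _ cur)// -(cvg_lim _ cr).
have [_ _ _ reg _] := A1_facts A1.
have cf : continuous f.
  move=> v; apply: differentiable_continuous; apply/derivable1_diffP.
  by have [df _ _] := reg f (or_introl erefl); exact: df.
have ul0 : 0 <= ul.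
  by apply: (cvgr_to_ge cul); near=> z; have /andP[] := sol_range_le z r0.
have ura : ur <= alpha.
  by apply: (cvgr_to_le cur); near=> z; have /andP[] := sol_range_le z r0.
split => //; first by split => //; rewrite ul0/= ulE urE.
split => //.
- apply: (ler_cvg_to cFl (cvg_comp _ _ cul (cf ul))).
  by near=> z; exact: local_flux_le_f.
- apply: (ler_cvg_to cFr (cvg_comp _ _ cur (cf ur))).
  by near=> z; exact: local_flux_le_f.
Unshelve. all: by end_near. Qed.

Context (K : R) (K0 : 0 <= K)
  (HK : forall v v', 0 <= v <= alpha -> 0 <= v' <= alpha ->
    `|derive1 f v - derive1 f v'| <= K * `|v - v'|).

Lemma f_chord ul ur : 0 <= ul -> ul < ur -> ur <= alpha ->
  derive1 f ur * (ur - ul) <= f ur - f ul <= derive1 f ul * (ur - ul).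
Proof.
move=> ul0 lr ura; have [_ _ bs0 reg conc] := A1_facts A1.
have [df _ _] := reg f (or_introl erefl).
have [w /andP[w1 w2] ->] := @MVT_open _ f _ _ lr (fun w _ => df w).
have d0 : 0 < ur - ul by rewrite subr_gt0.
have fd := conc f (or_introl erefl).
rewrite !ler_pM2r//; apply/andP; split; rewrite -subr_ge0.
  apply: le_trans (fd w ur (le_trans ul0 (ltW w1)) (ltW w2) ura).
  by rewrite mulr_ge0 ?subr_ge0 ?(ltW bs0) ?(ltW w2).
apply: le_trans (fd ul w ul0 (ltW w1) (le_trans (ltW w2) ura)).
by rewrite mulr_ge0 ?subr_ge0 ?(ltW bs0) ?(ltW w1).
Qed.

(** The flux is [f ur] on the right and at most [f ul] on the left, an inequality that can only make
    the jump faster. Its speed is at least the slope of the chord of [f], hence at least [f'(ur)] by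
    concavity. *)
Lemma rh_speed_ge (y : R -> R) r e c eta : 0 <= r -> upward_jump (u r) (y r) ->
  rankine_hugoniot delta f g u y r -> 0 < e -> 0 <= c <= alpha ->
  (forall z, y r < z < y r + e ->
    f_phase delta u r z /\ c <= u r z <= c + eta) ->
  derive1 f c - K * eta <= derive1 y r.
Proof.
move=> r0 uj rh e0 ca near_r.
have [_ [ul [ur [Fl [Fr [cul cur [/andP[ul0 lr] ura] [cFl cFr E Flf _]]]]]]] :=
  rh_facts r0 uj rh.
have cur1 : c <= ur.
  apply: (cvgr_to_ge cur); near=> z; have [|_ /andP[]//] := near_r z.
  by apply/andP; split; near: z; [exact: nbhs_right_gt|apply: nbhs_right_lt; rewrite ltrDl].
have cur2 : ur <= c + eta.
  apply: (cvgr_to_le cur); near=> z; have [|_ /andP[]//] := near_r z.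
  by apply/andP; split; near: z; [exact: nbhs_right_gt|apply: nbhs_right_lt; rewrite ltrDl].
have [_ _ _ reg _] := A1_facts A1.
have cf : continuous f.
  move=> v; apply: differentiable_continuous; apply/derivable1_diffP.
  by have [df _ _] := reg f (or_introl erefl); exact: df.
have FrE : f ur <= Fr.
  apply: (ler_cvg_to (cvg_comp _ _ cur (cf ur)) cFr); near=> z.
  rewrite /= local_flux_f//; have [|//] := near_r z.
  by apply/andP; split; near: z; [exact: nbhs_right_gt|apply: nbhs_right_lt; rewrite ltrDl].
have d0 : 0 < ur - ul by rewrite subr_gt0.
have /andP[ch _] := f_chord ul0 lr ura.
have sp : derive1 f ur <= derive1 y r.
  rewrite -(ler_pM2r d0) E; apply: le_trans ch _.
  by rewrite lerB.
apply: le_trans sp; rewrite lerBlDl -lerBlDr.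
apply: le_trans (ler_norm _) _.
have ur0 : 0 <= ur <= alpha by rewrite ura (le_trans ul0 (ltW lr)).
apply: le_trans (HK ca ur0) _; rewrite ler_wpM2l//.
by rewrite distrC ger0_norm ?subr_ge0// lerBlDl.
Unshelve. all: by end_near. Qed.

(** The mirror case: the flux is [f ul] on the left, and the unknown flux on the right can only slow
    the jump down. *)
Lemma rh_speed_le (y : R -> R) r e c eta : 0 <= r -> upward_jump (u r) (y r) ->
  rankine_hugoniot delta f g u y r -> 0 < e -> 0 <= c <= alpha ->
  (forall z, y r - e < z < y r ->
    f_phase delta u r z /\ c - eta <= u r z <= c) ->
  derive1 y r <= derive1 f c + K * eta.
Proof.
move=> r0 uj rh e0 ca near_r.
have [_ [ul [ur [Fl [Fr [cul cur [/andP[ul0 lr] ura] [cFl cFr E _ Frf]]]]]]] :=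
  rh_facts r0 uj rh.
have cul1 : c - eta <= ul.
  apply: (cvgr_to_ge cul); near=> z; have [|_ /andP[]//] := near_r z.
  by apply/andP; split; near: z; [apply: nbhs_left_gt; rewrite gtrBl|exact: nbhs_left_lt].
have cul2 : ul <= c.
  apply: (cvgr_to_le cul); near=> z; have [|_ /andP[]//] := near_r z.
  by apply/andP; split; near: z; [apply: nbhs_left_gt; rewrite gtrBl|exact: nbhs_left_lt].
have [_ _ _ reg _] := A1_facts A1.
have cf : continuous f.
  move=> v; apply: differentiable_continuous; apply/derivable1_diffP.
  by have [df _ _] := reg f (or_introl erefl); exact: df.
have FlE : f ul <= Fl.
  apply: (ler_cvg_to (cvg_comp _ _ cul (cf ul)) cFl); near=> z.
  rewrite /= local_flux_f//; have [|//] := near_r z.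
  by apply/andP; split; near: z; [apply: nbhs_left_gt; rewrite gtrBl|exact: nbhs_left_lt].
have d0 : 0 < ur - ul by rewrite subr_gt0.
have /andP[_ ch] := f_chord ul0 lr ura.
have sp : derive1 y r <= derive1 f ul.
  rewrite -(ler_pM2r d0) E; apply: le_trans ch.
  by rewrite lerB.
apply: le_trans sp _; rewrite -lerBlDl.
apply: le_trans (ler_norm _) _.
have ula : 0 <= ul <= alpha by rewrite ul0 (le_trans (ltW lr) ura).
apply: le_trans (HK ula ca) _; rewrite ler_wpM2l//.
by rewrite distrC ger0_norm ?subr_ge0// lerBlDl -lerBlDr.
Unshelve. all: by end_near. Qed.

End rankine_hugoniot_speed.

(** * Backward characteristics *)

Section region_solution.
Context (R : realType) (alpha beta betas delta L u0 : R) (f g : R -> R)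
  (u : R -> R -> R).
Context (delta_gt0 : 0 < delta) (L_gt0 : 0 < L)
  (A1 : assumption_A1 alpha beta betas f g)
  (weak : weak_solution delta L f g (cst u0) u)
  (adm : forall s, 0 <= s -> admissible_profile alpha delta L u0 (u s))
  (neg : (@lebesgue_measure R \x @lebesgue_measure R)%E.-negligible
        [set p | [/\ 0 < p.1, derivable (u p.1) p.2 1
                   & dx u p.1 p.2 = - delta]]).
Context (a b : R) (n : nat) (y : nat -> R -> R) (a_gt0 : 0 < a)
  (JC : jump_curves delta L f g u a b n y).

Local Notation reg := (region L n y).
Local Notation phase := (f_phase delta u).

Lemma time_ge0 r : a < r <= b -> 0 <= r.
Proof. by move=> /andP[ar _]; apply: ltW; exact: lt_trans a_gt0 ar. Qed.

Context (s x0 : R) (sab : a < s <= b) (nj : ~ jump_set (u s) x0).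

Lemma region_phase r x z : a < r <= b -> reg s x0 r x -> reg s x0 r z ->
  phase r x -> phase r z.
Proof.
move=> rab rx rz; have r0 := time_ge0 rab.
have [xz|zx] := leP x z.
  have [A [B [h1 h2 jf _]]] := region_jump_free L_gt0 JC sab rab nj rx rz xz.
  apply: (jump_free_phase adm r0 jf); first by rewrite h1 (le_lt_trans xz h2).
  by rewrite h2 (lt_le_trans h1 xz).
have [A [B [h1 h2 jf _]]] := region_jump_free L_gt0 JC sab rab nj rz rx (ltW zx).
apply: (jump_free_phase adm r0 jf); first by rewrite h2 (lt_trans h1 zx).
by rewrite h1 (lt_trans zx h2).
Qed.

Lemma region_mono r x z : a < r <= b -> reg s x0 r x -> reg s x0 r z ->
  x <= z -> u r z <= u r x.
Proof.
move=> rab rx rz xz; have r0 := time_ge0 rab.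
have [A [B [h1 h2 jf _]]] := region_jump_free L_gt0 JC sab rab nj rx rz xz.
exact: (jump_free_mono adm r0 jf h1 xz h2).
Qed.

Lemma region_f_slope_lt r x z : a < r <= b -> reg s x0 r x -> reg s x0 r z ->
  x < z -> phase r x -> u r x - u r z < delta * (z - x).
Proof.
move=> rab rx rz xz fx; have r0 := time_ge0 rab.
have [A [B [h1 h2 jf _]]] := region_jump_free L_gt0 JC sab rab nj rx rz (ltW xz).
exact: (f_phase_slope adm r0 jf h1 xz h2 fx).
Qed.

Lemma region_f_slope r x z : a < r <= b -> reg s x0 r x -> reg s x0 r z ->
  x <= z -> phase r x -> u r x - u r z <= delta * (z - x).
Proof.
move=> rab rx rz; rewrite le_eqVlt => /predU1P[->|xz fx].
  by rewrite !subrr mulr0.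
exact/ltW/region_f_slope_lt.
Qed.

Lemma region_g_slope r x z : a < r <= b -> reg s x0 r x -> reg s x0 r z ->
  ~ phase r x -> u r x - u r z = - derive1 (u r) x * (z - x).
Proof.
move=> rab rx rz; have r0 := time_ge0 rab.
have [xz|zx] := leP x z.
  have [A [B [h1 h2 jf _]]] := region_jump_free L_gt0 JC sab rab nj rx rz xz.
  apply: (g_phase_slope adm r0 jf); first by rewrite h1 (le_lt_trans xz h2).
  by rewrite h2 (lt_le_trans h1 xz).
have [A [B [h1 h2 jf _]]] := region_jump_free L_gt0 JC sab rab nj rz rx (ltW zx).
apply: (g_phase_slope adm r0 jf); first by rewrite h2 (lt_trans h1 zx).
by rewrite h1 (lt_trans zx h2).
Qed.

Lemma region_ball r x : a < r <= b -> reg s x0 r x -> exists2 e, 0 < e &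
  forall t, a < t <= b -> `|t - r| < e ->
    jump_free (u t) (x - e) (x + e) /\
    (forall z, `|z - x| < e -> reg s x0 t z).
Proof.
move=> rab rx; have [e e0 He] := region_open L_gt0 JC sab rab nj rx.
exists e => // t tab tr.
have tab' : a <= t <= b by case/andP: tab => /ltW ->.
have inr z : `|z - x| < e -> reg s x0 t z by exact: He.
split => //; rewrite /jump_free -subset0 => z [/=]; rewrite in_itv/= => zi.
apply: (region_nojump JC sab tab nj); apply: inr.
by rewrite ltr_distl.
Qed.

Lemma region_continuous r x : a < r <= b -> reg s x0 r x ->
  forall eta, 0 < eta -> exists2 d, 0 < d & forall t z, a < t <= b ->
    `|t - r| < d -> `|z - x| < d -> `|u t z - u r x| <= eta.
Proof.
move=> rab rx eta eta0; have [e e0 He] := region_ball rab rx.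
pose T := [set t | a < t <= b /\ `|t - r| < e].
have Tr : T r by split => //; rewrite subrr normr0.
have [|t [tab tr]|d d0 Hd] := sol_continuous weak adm e0 _ Tr _ eta0 (x := x).
- by move=> t [tab _]; exact: time_ge0.
- by have [] := He t tab tr.
exists (Num.min d e); first by rewrite lt_min d0.
move=> t z tab; rewrite !lt_min => /andP[h1 h2] /andP[h3 _].
exact: Hd.
Qed.

Lemma region_line h r x r1 : a < r <= b -> reg s x0 r x -> a <= r1 -> r1 < r ->
  (h = f /\ forall t, r1 < t < r -> forall z, reg s x0 t z -> phase t z) \/
  (h = g /\ forall t, r1 < t < r -> forall z, reg s x0 t z -> ~ phase t z) ->
  exists2 e, 0 < e & forall t, r - e < t <= r ->
    u t (x + derive1 h (u r x) * (t - r)) = u r x.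
Proof.
move=> rab rx ar1 r1r ph; have [e e0 He] := region_ball rab rx.
pose e' := Num.min e ((r - r1) / 2).
have e'0 : 0 < e' by rewrite lt_min e0 divr_gt0// subr_gt0.
have e'e : e' <= e by rewrite ge_min lexx.
have e'r : r1 < r - e'.
  rewrite ltrBrDl -ltrBrDr; apply: (@le_lt_trans _ _ ((r - r1) / 2)).
    by rewrite ge_min lexx orbT.
  by rewrite half_lt// subr_gt0.
have are : a < r - e' by exact: le_lt_trans ar1 e'r.
have near_t t : r - e' < t <= r -> a < t <= b /\ `|t - r| < e.
  move=> /andP[t1 t2]; case/andP: rab => ar rb; split.
    by rewrite (lt_trans are t1) (le_trans t2 rb).
  rewrite ler0_norm ?subr_le0// opprB ltrBlDr -ltrBlDl.
  by apply: le_lt_trans t1; rewrite lerD2l lerN2.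
have rt t : r - e' < t <= r -> reg s x0 t x.
  move=> ht; have [tab tr] := near_t t ht.
  by have [_] := He t tab tr; apply; rewrite subrr normr0.
apply: (sol_line (R := R) delta_gt0 A1 weak adm neg e'0) => //.
- exact: lt_trans a_gt0 are.
- move=> t ht; have [tab tr] := near_t t ht.
  have [jf _] := He t tab tr.
  by apply: jump_freeS jf; rewrite ?lerD2l ?lerN2.
- case: ph => -[hE ph]; [left|right]; split => // t /andP[t1 t2];
    apply: ph => //; rewrite ?t2 ?(lt_trans e'r t1)//;
    by apply: rt; rewrite t1 ltW.
Qed.

Lemma is_derive_line (ell : R -> R) (c r : R) : (forall r, ell r = ell s + c * (r - s)) ->
  is_derive r 1 ell c.
Proof.
move=> ellE; rewrite (_ : ell = fun z => c * z + (ell s - c * s)); last first.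
  by apply/funext => z; rewrite ellE; ring.
have := is_derive_id (c * r + (ell s - c * s)) (1 : R).
by move=> /is_derive_affine; rewrite mulr1.
Qed.

Lemma is_derive_lift p (r : R) : derivable (y p.1) r 1 ->
  is_derive r 1 (lift_curve L y p) (derive1 (y p.1) r).
Proof.
move=> dy; have h1 : is_derive r 1 (y p.1) (derive1 (y p.1) r).
  by apply: DeriveDef => //; rewrite derive1E.
have h2 : is_derive r 1 (cst (p.2%:~R * L) : R -> R) 0 by exact: is_derive_cst.
by have := is_deriveD h1 h2; rewrite addr0.
Qed.

Lemma jump_curve_upward i r : a < r <= b -> (i < n)%N -> upward_jump (u r) (y i r).
Proof.
move=> rab ilt; have : jump_set (u r) (y i r); last by [].
apply/(jump_setE JC _ rab); exists (i, 0) => //.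
by rewrite /lift_curve /= mul0r addr0.
Qed.

Lemma limit_right (d : R -> R) K t : t < s -> 0 <= K ->
  (forall r, t < r <= s -> `|d t - d r| <= K * (r - t)) ->
  (forall r, t < r <= s -> 0 <= d r) -> 0 <= d t.
Proof.
move=> ts K0 lip dpos; rewrite leNgt; apply/negP => dt.
pose C := K + 1; have C0 : 0 < C by rewrite ltr_wpDl.
pose r := Num.min s (t - d t / C / 2).
have gC0 : 0 < - d t / C / 2 by rewrite !divr_gt0// oppr_gt0.
have r1 : t < r by rewrite lt_min ts ltrDl -!mulNr.
have r2 : r <= s by rewrite ge_min lexx.
have rt : t < r <= s by rewrite r1.
have r3 : r - t < - d t / C.
  apply: (@le_lt_trans _ _ (- d t / C / 2)); last by rewrite half_lt// divr_gt0// oppr_gt0.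
  by rewrite lerBlDl ge_min -!mulNr lexx orbT.
have h4 : C * (r - t) < - d t by rewrite mulrC -ltr_pdivlMr.
have h5 : K * (r - t) <= C * (r - t).
  by rewrite ler_wpM2r ?subr_ge0 ?(ltW r1)// lerDl.
have h6 : d r - d t <= K * (r - t).
  by apply: le_trans (lip _ rt); rewrite distrC ler_norm.
have h7 := lt_le_trans (le_lt_trans (le_trans h6 h5) h4) (lexx _).
by have := dpos r rt; rewrite leNgt; move: h7; rewrite -ltrBrDr opprK addNr => ->.
Qed.

Lemma line_lift_lipschitz (ell : R -> R) (c : R) q t : (q.1 < n)%N -> a < t -> t < s ->
  (forall r, ell r = ell s + c * (r - s)) ->
  exists2 K, 0 <= K & forall r, t < r <= s ->
    `|(ell t - lift_curve L y q t) - (ell r - lift_curve L y q r)| <= K * (r - t).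
Proof.
move=> qlt at_ ts ellE; have [_ sb] := andP sab.
have [K1 K10 lip] := lift_lipschitz JC.
exists (`|c| + K1); first by rewrite addr_ge0.
move=> r /andP[tr rs].
have -> : ell t - lift_curve L y q t - (ell r - lift_curve L y q r) =
   (ell t - ell r) - (lift_curve L y q t - lift_curve L y q r) by ring.
apply: le_trans (ler_normB _ _) _.
have rt : r - t = `|t - r| by rewrite distrC gtr0_norm// subr_gt0.
rewrite rt mulrDl; apply: lerD.
  rewrite (ellE r) (ellE t) -normrM; have -> : ell s + c * (t - s) -
    (ell s + c * (r - s)) = c * (t - r) by ring.
  by [].
apply: lip => //; first by rewrite (ltW at_) (le_trans (ltW ts) sb).
by rewrite (le_trans (ltW at_) (ltW tr)) (le_trans rs sb).
Qed.

(* By Rankine-Hugoniot, [g <= f] and concavity, a jump curve on the left of a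
   characteristic moves at least as fast as it, up to an error proportional to
   their distance; by Gronwall's inequality this distance stays zero after a
   meeting. *)
Lemma f_curve_left (ell : R -> R) p t c : (p.1 < n)%N -> a < t -> t < s -> 0 <= c <= alpha ->
  (forall r, ell r = ell s + derive1 f c * (r - s)) ->
  (forall r, t < r <= s -> [/\ reg s x0 r (ell r), u r (ell r) = c &
    forall z, reg s x0 r z -> phase r z]) ->
  lift_curve L y p s < x0 -> lift_curve L y p t = ell t -> False.
Proof.
move=> plt at_ ts ca ellE H ps pt.
have [_ sb] := andP sab.
have [_ _ _ reg_ _] := A1_facts A1.
have [df ddf cddf] := reg_ f (or_introl erefl).
have [K K0 [HK _]] := C2_line_bound alpha df ddf cddf.
have [K1 K10 lip] := lift_lipschitz JC.
have tb r : t <= r <= s -> a <= r <= b.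
  by move=> /andP[h1 h2]; rewrite (le_trans (ltW at_) h1) (le_trans h2 sb).
have lift_le q : (q.1 < n)%N -> lift_curve L y q s < x0 ->
    lift_curve L y q t <= ell t.
  move=> qlt qs; have [K2 K20 lip2] := line_lift_lipschitz qlt at_ ts ellE.
  rewrite -subr_ge0; apply: (limit_right ts K20 lip2) => r tr.
  have [rr _ _] := H r tr; have [h _] := rr q qlt.
  by rewrite subr_ge0 ltW// h.
pose d r := ell r - lift_curve L y p r.
have dpos r : t < r <= s -> 0 < d r.
  by move=> /H[rr _ _]; rewrite subr_gt0; have [h _] := rr p plt; exact: h.
apply: (@lipschitz_ae_gronwall R d t s (`|derive1 f c| + K1) (K * delta)) => //.
- by rewrite addr_ge0.
- by rewrite mulr_ge0// ltW.
- move=> r r' hr hr'; rewrite /d.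
  have -> : ell r - lift_curve L y p r - (ell r' - lift_curve L y p r') =
     (ell r - ell r') - (lift_curve L y p r - lift_curve L y p r') by ring.
  apply: le_trans (ler_normB _ _) _; rewrite mulrDl; apply: lerD; last first.
    exact: (lip _ _ _ plt (tb _ hr) (tb _ hr')).
  by rewrite (ellE r) (ellE r') -normrM; have -> : ell s + derive1 f c * (r - s) -
    (ell s + derive1 f c * (r' - s)) = derive1 f c * (r - r') by ring.
- by rewrite /d pt subrr.
- have [_ _ _ [E [mE muE HE]]] := JC.
  exists E; split => // r /= nr; apply: HE => /= HR; apply: nr => /andP[r1 r2].
  have rab : a < r < b by rewrite (lt_trans at_ r1) (lt_le_trans r2 sb).
  have rab' : a < r <= b by case/andP: rab => -> /ltW ->.
  have r0 := time_ge0 rab'.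
  have rh := HR rab p.1 plt.
  have r12 : t < r <= s by rewrite r1 ltW.
  have [rl ul ph] := H r r12.
  (* No other curve separates the curve [p] from the line: by [lift_no_cross] it would already be
     strictly to the right of the meeting point at time [t], against [lift_le]. *)
  have inreg z : lift_curve L y p r < z <= ell r -> reg s x0 r z.
    move=> /andP[z1 z2] q qlt; split => qs; last first.
      by have [_ /(_ qs) h] := rl q qlt; exact: le_lt_trans z2 h.
    apply: le_lt_trans z1; rewrite leNgt; apply/negP => pq.
    have := lift_no_cross JC plt qlt at_ (ltW r1) (le_trans (ltW r2) sb) pq.
    by rewrite pt ltNge lift_le.
  have uj := jump_curve_upward rab' plt.
  have [per _ _ _] := adm r0.
  (* The Rankine-Hugoniot condition concerns the base curve, so the situation is translated by the
     period of the lift. *)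
  have near_r z : y p.1 r < z < y p.1 r + d r ->
      phase r z /\ c <= u r z <= c + delta * d r.
    move=> /andP[z1 z2].
    have zr : reg s x0 r (z + p.2%:~R * L).
      apply: inreg; rewrite /lift_curve ltrD2r z1/=.
      move: z2; rewrite /d /lift_curve => z2.
      by rewrite -lerBrDr; apply: ltW; apply: lt_le_trans z2 _; rewrite le_eqVlt; apply/orP; left; apply/eqP; ring.
    have zl : z + p.2%:~R * L <= ell r.
      move: z2; rewrite /d /lift_curve => z2.
      by rewrite -lerBrDr; apply: ltW; apply: lt_le_trans z2 _; rewrite le_eqVlt; apply/orP; left; apply/eqP; ring.
    have phz := ph _ zr.
    split; first by apply/(f_phase_periodic adm z p.2 r0).
    rewrite -(periodic_int p.2 z per) -ul.
    rewrite region_mono//=.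
    have := region_f_slope rab' zr rl zl phz.
    rewrite lerBlDl => /le_trans; apply; rewrite lerD2l ler_wpM2l ?(ltW delta_gt0)//.
    by rewrite /d /lift_curve lerD2l lerN2 lerD2r ltW.
  have sp := rh_speed_ge A1 adm K0 HK r0 uj rh (dpos _ r12) ca near_r.
  have [dy _] := rh.
  have dd : is_derive r 1 d (derive1 f c - derive1 (y p.1) r).
    have de : is_derive r 1 ell (derive1 f c) by exact: is_derive_line.
    have dl := is_derive_lift dy.
    exact: (is_deriveB de dl).
  split; first by case: dd.
  rewrite (is_derive_derive1 dd) lerBlDl -lerBlDr.
  by rewrite -mulrA.
Qed.

(** The mirror image of [f_curve_left]: by [rh_speed_le], a jump on the right moves at most as fast
    as the characteristic, up to an error proportional to the distance. *)
Lemma f_curve_right (ell : R -> R) p t c : (p.1 < n)%N -> a < t -> t < s -> 0 <= c <= alpha ->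
  (forall r, ell r = ell s + derive1 f c * (r - s)) ->
  (forall r, t < r <= s -> [/\ reg s x0 r (ell r), u r (ell r) = c &
    forall z, reg s x0 r z -> phase r z]) ->
  x0 < lift_curve L y p s -> lift_curve L y p t = ell t -> False.
Proof.
move=> plt at_ ts ca ellE H ps pt.
have [_ sb] := andP sab.
have [_ _ _ reg_ _] := A1_facts A1.
have [df ddf cddf] := reg_ f (or_introl erefl).
have [K K0 [HK _]] := C2_line_bound alpha df ddf cddf.
have [K1 K10 lip] := lift_lipschitz JC.
have tb r : t <= r <= s -> a <= r <= b.
  by move=> /andP[h1 h2]; rewrite (le_trans (ltW at_) h1) (le_trans h2 sb).
have lift_ge q : (q.1 < n)%N -> x0 < lift_curve L y q s ->
    ell t <= lift_curve L y q t.
  move=> qlt qs; have [K2 K20 lip2] := line_lift_lipschitz qlt at_ ts ellE.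
  rewrite -subr_ge0.
  apply: (@limit_right (fun r => lift_curve L y q r - ell r) K2 t ts K20) => r tr.
    by have := lip2 r tr; rewrite -normrN; apply: le_trans; rewrite le_eqVlt; apply/orP; left; apply/eqP; congr Num.norm; ring.
  have [rr _ _] := H r tr; have [_ h] := rr q qlt.
  by rewrite subr_ge0 ltW// h.
pose d r := lift_curve L y p r - ell r.
have dpos r : t < r <= s -> 0 < d r.
  by move=> /H[rr _ _]; rewrite subr_gt0; have [_ h] := rr p plt; exact: h.
apply: (@lipschitz_ae_gronwall R d t s (K1 + `|derive1 f c|) (K * delta)) => //.
- by rewrite addr_ge0.
- by rewrite mulr_ge0// ltW.
- move=> r r' hr hr'; rewrite /d.
  have -> : lift_curve L y p r - ell r - (lift_curve L y p r' - ell r') =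
     (lift_curve L y p r - lift_curve L y p r') - (ell r - ell r') by ring.
  apply: le_trans (ler_normB _ _) _; rewrite mulrDl; apply: lerD.
    exact: (lip _ _ _ plt (tb _ hr) (tb _ hr')).
  by rewrite (ellE r) (ellE r') -normrM; have -> : ell s + derive1 f c * (r - s) -
    (ell s + derive1 f c * (r' - s)) = derive1 f c * (r - r') by ring.
- by rewrite /d pt subrr.
- have [_ _ _ [E [mE muE HE]]] := JC.
  exists E; split => // r /= nr; apply: HE => /= HR; apply: nr => /andP[r1 r2].
  have rab : a < r < b by rewrite (lt_trans at_ r1) (lt_le_trans r2 sb).
  have rab' : a < r <= b by case/andP: rab => -> /ltW ->.
  have r0 := time_ge0 rab'.
  have rh := HR rab p.1 plt.
  have r12 : t < r <= s by rewrite r1 ltW.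
  have [rl ul ph] := H r r12.
  have inreg z : ell r <= z < lift_curve L y p r -> reg s x0 r z.
    move=> /andP[z1 z2] q qlt; split => qs.
      by have [/(_ qs) h _] := rl q qlt; exact: lt_le_trans h z1.
    apply: lt_le_trans z2 _; rewrite leNgt; apply/negP => pq.
    have := lift_no_cross JC qlt plt at_ (ltW r1) (le_trans (ltW r2) sb) pq.
    by rewrite pt ltNge lift_ge.
  have uj := jump_curve_upward rab' plt.
  have [per _ _ _] := adm r0.
  have near_r z : y p.1 r - d r < z < y p.1 r ->
      phase r z /\ c - delta * d r <= u r z <= c.
    move=> /andP[z1 z2].
    have zl : ell r <= z + p.2%:~R * L.
      move: z1; rewrite /d /lift_curve => z1.
      by rewrite -lerBlDr; apply: ltW; apply: le_lt_trans z1; rewrite le_eqVlt; apply/orP; left; apply/eqP; ring.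
    have zr : reg s x0 r (z + p.2%:~R * L).
      by apply: inreg; rewrite zl /lift_curve ltrD2r z2.
    have phz := ph _ zr.
    split; first by apply/(f_phase_periodic adm z p.2 r0).
    rewrite -(periodic_int p.2 z per) -ul.
    rewrite region_mono// andbT.
    have := region_f_slope rab' rl zr zl (ph _ rl).
    rewrite lerBlDl -lerBlDr; apply: le_trans; rewrite lerD2l lerN2 ler_wpM2l ?(ltW delta_gt0)//.
    by rewrite /d /lift_curve lerD2r lerD2r ltW.
  have sp := rh_speed_le A1 adm K0 HK r0 uj rh (dpos _ r12) ca near_r.
  have [dy _] := rh.
  have dd : is_derive r 1 d (derive1 (y p.1) r - derive1 f c).
    have de : is_derive r 1 ell (derive1 f c) by exact: is_derive_line.
    have dl := is_derive_lift dy.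
    exact: (is_deriveB dl de).
  split; first by case: dd.
  by rewrite (is_derive_derive1 dd) lerBlDl -mulrA.
Qed.

(** Backward induction on time. Inside the region the line is extended by [region_line]; a limit
    point outside it would lie on a jump curve, which [f_curve_left] and [f_curve_right] exclude,
    and the value passes to the limit by continuity. *)
Lemma f_line r1 : a < r1 -> r1 <= s ->
  (forall r, r1 <= r <= s -> forall z, reg s x0 r z -> phase r z) ->
  forall r, r1 <= r <= s ->
    reg s x0 r (x0 + derive1 f (u s x0) * (r - s)) /\
    u r (x0 + derive1 f (u s x0) * (r - s)) = u s x0.
Proof.
move=> ar1 r1s ph; set c := u s x0.
pose ell r := x0 + derive1 f c * (r - s).
have ca : 0 <= c <= alpha by exact: (sol_range_le adm x0 (time_ge0 sab)).
have [_ sb] := andP sab.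
have ellE r : ell r = ell s + derive1 f c * (r - s) by rewrite /ell subrr mulr0 addr0.
have ell_lip t r : `|ell r - ell t| = `|derive1 f c| * `|r - t|.
  by rewrite -normrM; congr Num.norm; rewrite /ell; ring.
have tb t : r1 <= t <= s -> a < t <= b.
  by move=> /andP[h1 h2]; rewrite (lt_le_trans ar1 h1) (le_trans h2 sb).
apply: (@left_induction R r1 s (fun r => reg s x0 r (ell r) /\ u r (ell r) = c) r1s).
- by rewrite /ell subrr mulr0 addr0; split => //; exact: region_refl.
- move=> t /andP[t1 t2] Pt; have [rt ut] := Pt t (introT andP (conj (lexx t) t2)).
  have tr : r1 <= t <= s by rewrite (ltW t1).
  have tab := tb t tr.
  have [e1 e10 H1] := region_ball tab rt.
  have [|e2 e20 H2] := region_line (h := f) tab rt (ltW ar1) t1.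
    left; split => // q /andP[q1 q2] z; apply: ph.
    by rewrite (ltW q1) (le_trans (ltW q2) t2).
  pose e := Num.min e2 (e1 / (`|derive1 f c| + 1)).
  exists e; first by rewrite lt_min e20 divr_gt0.
  move=> q /andP[q1 q2] rq.
  have qab : a < q <= b by apply: tb; rewrite rq (le_trans (ltW q2) t2).
  have tq0 : 0 < t - q by rewrite subr_gt0.
  have tq : t - q < e by rewrite ltrBlDl -ltrBlDr.
  have tq1 : (`|derive1 f c| + 1) * (t - q) < e1.
    rewrite mulrC -ltr_pdivlMr//; apply: lt_le_trans tq _.
    by rewrite ge_min lexx orbT.
  have tqe1 : `|q - t| < e1.
    rewrite distrC (gtr0_norm tq0); apply: le_lt_trans tq1.
    by rewrite mulrDl mul1r lerDr mulr_ge0// ltW.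
  split.
    have [_] := H1 q qab tqe1; apply; rewrite ell_lip distrC (gtr0_norm tq0).
    by apply: le_lt_trans tq1; rewrite ler_wpM2r ?(ltW tq0)// lerDl.
  have := H2 q; rewrite ut => <-; last first.
    rewrite (ltW q2) andbT; apply: le_lt_trans q1; rewrite lerD2l lerN2.
    by rewrite ge_min lexx.
  by congr (u q _); rewrite /ell; ring.
- move=> t /andP[t1 t2] Pt.
  have at_ : a < t by exact: lt_le_trans ar1 t1.
  have H r : t < r <= s -> [/\ reg s x0 r (ell r), u r (ell r) = c &
      forall z, reg s x0 r z -> phase r z].
    move=> tr; have [h1 h2] := Pt r tr; split => // z; apply: ph.
    by case/andP: tr => h3 ->; rewrite (le_trans t1 (ltW h3)).
  have rt : reg s x0 t (ell t).
    move=> p plt; have [K2 K20 lip2] := line_lift_lipschitz plt at_ t2 ellE.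
    split=> ps.
      have h : 0 <= ell t - lift_curve L y p t.
        apply: (limit_right t2 K20 lip2) => r tr.
        by have [rr _ _] := H r tr; have [h _] := rr p plt; rewrite subr_ge0 ltW// h.
      move: h; rewrite subr_ge0 le_eqVlt => /predU1P[E|//].
      by case: (f_curve_left plt at_ t2 ca ellE H ps E).
    have h : 0 <= lift_curve L y p t - ell t.
      apply: (@limit_right (fun r => lift_curve L y p r - ell r) K2 t t2 K20) => r tr.
        have := lip2 r tr; rewrite -normrN; apply: le_trans; rewrite le_eqVlt.
        by apply/orP; left; apply/eqP; congr Num.norm; ring.
      by have [rr _ _] := H r tr; have [_ h] := rr p plt; rewrite subr_ge0 ltW// h.
    move: h; rewrite subr_ge0 le_eqVlt => /predU1P[E|//].
    by case: (f_curve_right plt at_ t2 ca ellE H ps (esym E)).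
  split => //.
  have tab : a < t <= b by apply: tb; rewrite t1 ltW.
  apply/eqP; rewrite -subr_eq0 -normr_le0; apply/ler_addgt0Pr => eta eta0.
  rewrite add0r.
  have [d d0 Hd] := region_continuous tab rt eta0.
  pose e := d / (`|derive1 f c| + 1).
  have e0 : 0 < e by rewrite divr_gt0.
  pose r := Num.min s (t + e / 2).
  have r1' : t < r by rewrite lt_min t2 ltrDl divr_gt0.
  have r2' : r <= s by rewrite ge_min lexx.
  have rt0 : 0 < r - t by rewrite subr_gt0.
  have r3' : (`|derive1 f c| + 1) * (r - t) < d.
    rewrite mulrC -ltr_pdivlMr//; apply: (@le_lt_trans _ _ (e / 2)); last exact: half_lt.
    by rewrite lerBlDl ge_min lexx orbT.
  have trs : t < r <= s by rewrite r1'.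
  have [_ ur _] := H r trs.
  rewrite -ur distrC; apply: Hd.
  + by apply: tb; rewrite r2' andbT (le_trans t1 (ltW r1')).
  + rewrite (gtr0_norm rt0); apply: le_lt_trans r3'.
    by rewrite mulrDl mul1r lerDr mulr_ge0// ltW.
  + rewrite ell_lip (gtr0_norm rt0); apply: le_lt_trans r3'.
    by rewrite ler_wpM2r ?(ltW rt0)// lerDl.
Qed.

End region_solution.

(** * Evolution of the phases *)

Lemma finite_argmax (R : realType) (n : nat) (F : nat -> R) : (0 < n)%N ->
  exists2 i, (i < n)%N & forall j, (j < n)%N -> F j <= F i.
Proof.
elim: n => // n IH _; case: n IH => [_|n /(_ isT)[i ilt Hi]].
  by exists 0%N => // -[|].
have [h|h] := leP (F n.+1) (F i).
  exists i; first exact: leqW.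
  by move=> j; rewrite ltnS leq_eqVlt => /predU1P[->//|]; exact: Hi.
exists n.+1 => // j; rewrite ltnS leq_eqVlt => /predU1P[->//|jlt].
exact: le_trans (Hi _ jlt) (ltW h).
Qed.

Lemma slope_gap_false (R : realFieldType) (eta dw p p' q q' : R) : 0 < eta ->
  dw - (p - p') = 4 * eta -> q - p <= eta -> - eta <= q' - p' -> dw <= q - q' ->
  False.
Proof. by move=> *; lra. Qed.

Lemma drop_pos (R : realFieldType) (w eta p p' q q' : R) : w <= p - p' ->
  - eta <= q - p -> q' - p' <= eta -> 2 * eta < w -> q' < q.
Proof. by move=> *; lra. Qed.

Lemma once_f_arith (R : realFieldType) (delta betas k w eta x x' r1 r t p p' q q' : R) :
  0 < delta -> 0 < betas -> 0 < k -> 0 < w -> q' < q ->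
  k = delta * betas * (t - r1) / 2 -> w = delta * (x' - x) ->
  eta = w * k / (4 * (1 + k)) -> (r1 + t) / 2 <= r -> w <= p - p' ->
  - eta <= q - p -> q' - p' <= eta ->
  q - q' <= delta * (x' - x - betas * (q - q') * (r - r1)) -> False.
Proof.
move=> d0 b0 k0 w0 qq kE wE etaE rr wp h1 h2 h3.
have D0 : 0 < q - q' by rewrite subr_gt0.
have k1 : 0 < 1 + k by rewrite addr_gt0.
have h4 : (q - q') * (1 + k) <= w.
  have : k <= delta * betas * (r - r1).
    rewrite kE -mulrA ler_wpM2l ?mulr_ge0 ?(ltW d0) ?(ltW b0)//; lra.
  move=> /(ler_wpM2l (ltW D0)) h5.
  have h6 : q - q' <= delta * (x' - x) - (q - q') * (delta * betas * (r - r1)).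
    by apply: le_trans h3 _; rewrite le_eqVlt; apply/orP; left; apply/eqP; ring.
  rewrite wE mulrDr mulr1.
  by move: h5 h6; clear; lra.
have h5 : (w - 2 * eta) * (1 + k) <= w.
  by apply: le_trans h4; rewrite ler_wpM2r ?(ltW k1)//; lra.
have E : 2 * eta * (1 + k) = w * k / 2 by rewrite etaE; field; rewrite gt_eqF.
have wk : 0 < w * k by rewrite mulr_gt0.
by move: h5; rewrite mulrBl E mulrDr mulr1; lra.
Qed.

Section phases.
Context (R : realType) (alpha beta betas delta L u0 : R) (f g : R -> R)
  (u : R -> R -> R).
Context (delta_gt0 : 0 < delta) (L_gt0 : 0 < L)
  (A1 : assumption_A1 alpha beta betas f g)
  (weak : weak_solution delta L f g (cst u0) u)
  (adm : forall s, 0 <= s -> admissible_profile alpha delta L u0 (u s))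
  (neg : (@lebesgue_measure R \x @lebesgue_measure R)%E.-negligible
        [set p | [/\ 0 < p.1, derivable (u p.1) p.2 1
                   & dx u p.1 p.2 = - delta]]).
Context (a b : R) (n : nat) (y : nat -> R -> R) (a_gt0 : 0 < a)
  (JC : jump_curves delta L f g u a b n y).

Local Notation reg := (region L n y).
Local Notation phase := (f_phase delta u).
Local Notation lift := (lift_curve L y).

Context (s x0 : R) (sab : a < s <= b) (nj : ~ jump_set (u s) x0).

Let s_le_b : s <= b. Proof. by case/andP: sab. Qed.
Let sub_time r : a < r -> r <= s -> a < r <= b.
Proof. by move=> -> h; exact: le_trans h s_le_b. Qed.

(** For each curve, only the last translate before [x0] and the first one after it can be extremal,
    so the choice is between finitely many candidates. The sides are taken at [s] but the ranking is
    made at [r], because curves that are distinct at [r] may have merged at [s]. *)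
Lemma extremal_lifts r : (0 < n)%N -> exists p q,
  [/\ (p.1 < n)%N /\ lift p s < x0, (q.1 < n)%N /\ x0 < lift q s
    & forall p', (p'.1 < n)%N -> (lift p' s < x0 -> lift p' r <= lift p r) /\
        (x0 < lift p' s -> lift q r <= lift p' r)].
Proof.
move=> n0.
pose m i : int := Num.floor ((x0 - y i s) / L).
have mP i : (m i)%:~R * L <= x0 - y i s < (m i + 1)%:~R * L.
  by rewrite -ler_pdivlMr// -ltr_pdivrMr//; exact: floor_itv.
have le_m p : (p.1 < n)%N -> lift p s < x0 -> p.2 <= m p.1.
  move=> plt; rewrite /lift_curve -ltrBrDl => h.
  have /andP[_ h2] := mP p.1.
  have := lt_trans h (lt_le_trans h2 (lexx _)).
  rewrite ltNge => h3; rewrite leNgt; apply/negP => h4; move: h; apply/negP.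
  rewrite -leNgt; apply: le_trans (ltW h2) _.
  by rewrite ler_wpM2r ?(ltW L_gt0)// ler_int lezD1.
have ge_m p : (p.1 < n)%N -> x0 < lift p s -> m p.1 + 1 <= p.2.
  move=> plt; rewrite /lift_curve -ltrBlDl => h; rewrite lezD1.
  have /andP[h2 _] := mP p.1.
  have h3 := le_lt_trans h2 h.
  by rewrite ltr_pM2r// ltr_int in h3.
have side1 i : (i < n)%N -> lift (i, m i) s < x0.
  move=> ilt; have /andP[h _] := mP i.
  case: (region_side JC sab nj (p := (i, m i)) ilt) => // h'.
  by move: h'; rewrite /lift_curve /= -ltrBlDl ltNge h.
have side2 i : (i < n)%N -> x0 < lift (i, m i + 1) s.
  by move=> ilt; have /andP[_ h] := mP i; rewrite /lift_curve /= -ltrBlDl.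
have [i ilt Hi] := finite_argmax (fun i => lift (i, m i) r) n0.
have [j jlt Hj] := finite_argmax (fun i => - lift (i, m i + 1) r) n0.
exists (i, m i), (j, m j + 1); split.
- by split => //; exact: side1.
- by split => //; exact: side2.
- move=> p plt; split=> hp.
    apply: le_trans (Hi _ plt); rewrite /lift_curve /= lerD2l ler_wpM2r ?(ltW L_gt0)//.
    by rewrite ler_int; exact: le_m.
  have := Hj _ plt; rewrite lerN2 => /le_trans; apply.
  rewrite /lift_curve /= lerD2l ler_wpM2r ?(ltW L_gt0)//.
  by rewrite ler_int; exact: ge_m.
Qed.

Lemma region_nonempty r : a < r -> r <= s -> exists x, reg s x0 r x.
Proof.
move=> ar rs; have [n0|n0] := posnP n.
  by exists 0 => p; rewrite n0.
have [p [q [[plt ps] [qlt qs] H]]] := extremal_lifts r n0.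
have pq := lift_no_cross JC plt qlt ar rs s_le_b (lt_trans ps qs).
exists ((lift p r + lift q r) / 2) => p' p'lt; have [h1 h2] := H p' p'lt.
split=> [/h1|/h2] h.
  by apply: le_lt_trans h _; exact: (midf_lt pq).1.
by apply: lt_le_trans h; exact: (midf_lt pq).2.
Qed.

Let rphase := region_phase L_gt0 adm a_gt0 JC sab nj.
Let rmono := region_mono L_gt0 adm a_gt0 JC sab nj.
Let rcont := region_continuous L_gt0 weak adm a_gt0 JC sab nj.
Let rball := region_ball L_gt0 JC sab nj.
Let rfslope := region_f_slope L_gt0 adm a_gt0 JC sab nj.
Let rfslope_lt := region_f_slope_lt L_gt0 adm a_gt0 JC sab nj.
Let rgslope := region_g_slope L_gt0 adm a_gt0 JC sab nj.

Definition f_time r := forall z, reg s x0 r z -> phase r z.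

Lemma not_f_time r z : a < r -> r <= s -> ~ f_time r -> reg s x0 r z -> ~ phase r z.
Proof.
move=> ar rs nf rz fz; apply: nf => w rw.
exact: (rphase (sub_time ar rs) rz rw fz).
Qed.

Lemma g_slope_ge r z : ~ phase r z -> delta <= - derive1 (u r) z.
Proof. by rewrite /f_phase => /negP; rewrite -leNgt lerNr. Qed.

(** In phase [f] the drop between two points [x < x'] is strictly less than [delta * (x' - x)], in
    phase [g] it is at least that, and the drop is continuous in time. *)
Lemma f_time_open t : a < t -> t <= s -> f_time t -> exists2 e, 0 < e &
  forall r, a < r -> r <= s -> `|r - t| < e -> f_time r.
Proof.
move=> at_ ts ft; have tab := sub_time at_ ts.
have [x rx] := region_nonempty at_ ts.
have [e e0 He] := rball tab rx.
pose x' := x + e / 2.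
have e2 : 0 < e / 2 by rewrite divr_gt0.
have xx' : x < x' by rewrite ltrDl.
have dxx' : `|x' - x| < e by rewrite /x' addrAC subrr add0r gtr0_norm// half_lt.
have rx' : reg s x0 t x'.
  have tt : `|t - t| < e by rewrite subrr normr0.
  by have [_ Ht] := He t tab tt; exact: Ht.
have gap := rfslope_lt tab rx rx' xx' (ft _ rx).
pose eta := (delta * (x' - x) - (u t x - u t x')) / 4.
have eta0 : 0 < eta by rewrite divr_gt0// subr_gt0.
have [d1 d10 H1] := rcont tab rx eta0.
have [d2 d20 H2] := rcont tab rx' eta0.
exists (Num.min e (Num.min d1 d2)); first by rewrite !lt_min e0 d10.
move=> r ar rs; rewrite !lt_min => /and3P[re rd1 rd2].
have rab := sub_time ar rs.
have [_ Hr] := He r rab re.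
have rrx : reg s x0 r x by apply: Hr; rewrite subrr normr0.
have rrx' : reg s x0 r x' by exact: Hr.
apply: contrapT => nf; have nph := not_f_time ar rs nf rrx.
have E := rgslope rab rrx rrx' nph.
have h1 := H1 r x rab rd1 (_ : `|x - x| < d1).
have h2 := H2 r x' rab rd2 (_ : `|x' - x'| < d2).
rewrite subrr normr0 in h1; rewrite subrr normr0 in h2.
have {}h1 := h1 d10; have {}h2 := h2 d20.
have ge := g_slope_ge nph.
have : delta * (x' - x) <= u r x - u r x'.
  by rewrite E ler_wpM2r ?subr_ge0 ?(ltW xx').
have E4 : delta * (x' - x) - (u t x - u t x') = 4 * eta by rewrite /eta; field.
move: h1 h2; rewrite !ler_norml => /andP[_ h1] /andP[h2 _] h3.
exact: (slope_gap_false eta0 E4 h1 h2 h3).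
Qed.

Lemma f_line_from r1 r x : a < r1 -> r1 <= r -> r <= s -> reg s x0 r x ->
  (forall q, r1 <= q <= r -> f_time q) ->
  reg s x0 r1 (x + derive1 f (u r x) * (r1 - r)) /\
  u r1 (x + derive1 f (u r x) * (r1 - r)) = u r x.
Proof.
move=> ar1 r1r rs rx ft.
have rab : a < r <= b by apply: sub_time => //; exact: lt_le_trans ar1 r1r.
have njx := region_nojump JC sab rab nj rx.
have [||h1 h2] := f_line delta_gt0 L_gt0 A1 weak adm neg a_gt0 JC rab njx ar1 r1r _ (r := r1).
- move=> q qr z rz; apply: (ft q qr).
  by apply/(region_rebase JC _ _ sab rab nj rx).
- by rewrite lexx.
- split => //; by apply/(region_rebase JC _ _ sab rab nj rx).
Qed.

(** The smaller value, on the right, travels faster, so backward in time the distance shrinks at a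
    rate of at least [betas] times the difference of the values. The feet stay ordered because the
    profile at [r1] is non-increasing on the region. *)
Lemma f_pair r1 r x x' : a < r1 -> r1 <= r -> r <= s ->
  reg s x0 r x -> reg s x0 r x' -> u r x' < u r x ->
  (forall q, r1 <= q <= r -> f_time q) ->
  let X := x + derive1 f (u r x) * (r1 - r) in
  let X' := x' + derive1 f (u r x') * (r1 - r) in
  [/\ reg s x0 r1 X, reg s x0 r1 X', u r1 X = u r x /\ u r1 X' = u r x', X < X'
    & X' - X <= x' - x - betas * (u r x - u r x') * (r - r1)].
Proof.
move=> ar1 r1r rs rx rx' cc ft X X'.
have [h1 h2] := f_line_from ar1 r1r rs rx ft.
have [h3 h4] := f_line_from ar1 r1r rs rx' ft.
have r1ab : a < r1 <= b by apply: sub_time => //; exact: le_trans r1r rs.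
have r0 : 0 <= r by apply: ltW; exact: lt_trans a_gt0 (lt_le_trans ar1 r1r).
split => //.
  rewrite ltNge; apply/negP => XX; have := rmono r1ab h3 h1 XX.
  by rewrite h2 h4 leNgt cc.
have [_ _ _ _ conc] := A1_facts A1.
have /andP[c0 _] := sol_range_le adm x' r0.
have /andP[_ ca] := sol_range_le adm x r0.
have := conc f (or_introl erefl) _ _ c0 (ltW cc) ca.
move=> /(ler_wpM2r (_ : 0 <= r - r1)); rewrite subr_ge0 => /(_ r1r) h.
rewrite /X /X'.
have -> : x' + derive1 f (u r x') * (r1 - r) - (x + derive1 f (u r x) * (r1 - r)) =
  x' - x - (derive1 f (u r x') - derive1 f (u r x)) * (r - r1) by ring.
by rewrite lerD2l lerN2.
Qed.

(* The slopes in a region following the flux [f] are bounded away from [-delta],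
   because the decrease bound improves with time; hence the region cannot reach
   the slope [-delta] again. *)
Lemma once_f r1 : a < r1 -> r1 <= s -> f_time r1 ->
  forall r, r1 <= r <= s -> f_time r.
Proof.
move=> ar1 r1s f1; apply: (@right_induction R r1 s f_time r1s f1).
  move=> t /andP[t1 ts] ft.
  have [|e e0 He] := f_time_open (lt_le_trans ar1 t1) (ltW ts).
    by apply: ft; rewrite t1 lexx.
  exists e => // r /andP[tr re] rs; apply: He => //.
    exact: lt_trans (lt_le_trans ar1 t1) tr.
  by rewrite gtr0_norm ?subr_gt0// ltrBlDl.
move=> t /andP[t1 ts] ft; apply: contrapT => nf.
have at_ := lt_trans ar1 t1; have tab := sub_time at_ ts.
have [x rx] := region_nonempty at_ ts.
have [e e0 He] := rball tab rx.
pose x' := x + e / 2.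
have e2 : 0 < e / 2 by rewrite divr_gt0.
have xx' : x < x' by rewrite ltrDl.
have dxx' : `|x' - x| < e by rewrite /x' addrAC subrr add0r gtr0_norm// half_lt.
have rx' : reg s x0 t x'.
  have tt : `|t - t| < e by rewrite subrr normr0.
  by have [_ Ht] := He t tab tt; exact: Ht.
have nph := not_f_time at_ ts nf rx.
have ge : delta * (x' - x) <= u t x - u t x'.
  rewrite (rgslope tab rx rx' nph) ler_wpM2r ?subr_ge0 ?(ltW xx')//.
  exact: g_slope_ge.
have [_ _ bs0 _ _] := A1_facts A1.
(* In phase [g] at [t] the drop from [x] to [x'] is at least [w], hence at least [w - 2 * eta] at a
   slightly earlier time [r]. The characteristics coming from [r1] bound it by [w / (1 + k)], since
   [r - r1 >= (t - r1) / 2]. The choice of [eta] makes the two incompatible. *)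
pose k := delta * betas * (t - r1) / 2.
have k0 : 0 < k by rewrite divr_gt0// !mulr_gt0// subr_gt0.
pose w := delta * (x' - x).
have w0 : 0 < w by rewrite mulr_gt0// subr_gt0.
pose eta := w * k / (4 * (1 + k)).
have k10 : 0 < 4 * (1 + k) by rewrite mulr_gt0// addr_gt0.
have eta0 : 0 < eta by rewrite divr_gt0// mulr_gt0.
have [d1 d10 H1] := rcont tab rx eta0.
have [d2 d20 H2] := rcont tab rx' eta0.
pose d := Num.min e (Num.min d1 d2).
have d0 : 0 < d by rewrite !lt_min e0 d10.
pose r := Num.max ((r1 + t) / 2) (t - d / 2).
have rt : r < t.
  by rewrite gt_max (midf_lt t1).2 gtrBl divr_gt0.
have r1r : (r1 + t) / 2 <= r by rewrite le_max lexx.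
have r1r' : r1 < r by exact: lt_le_trans (midf_lt t1).1 r1r.
have rd : `|r - t| < d.
  rewrite ltr0_norm ?subr_lt0// opprB; apply: le_lt_trans (half_lt d0).
  by rewrite lerBlDl -lerBlDr le_max lexx orbT.
move: rd; rewrite !lt_min => /and3P[re rd1 rd2].
have ar := lt_trans ar1 r1r'; have rs := ltW (lt_le_trans rt ts).
have rab := sub_time ar rs.
have [_ Hr] := He r rab re.
have rrx : reg s x0 r x by apply: Hr; rewrite subrr normr0.
have rrx' : reg s x0 r x' by exact: Hr.
have h1 := H1 r x rab rd1 (_ : `|x - x| < d1).
have h2 := H2 r x' rab rd2 (_ : `|x' - x'| < d2).
rewrite subrr normr0 in h1; rewrite subrr normr0 in h2.
have {}h1 := h1 d10; have {}h2 := h2 d20.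
move: h1 h2; rewrite !ler_norml => /andP[h1 _] /andP[_ h2].
have cc : u r x' < u r x.
  have e3 : 2 * eta < w.
    rewrite /eta; have -> : 2 * (w * k / (4 * (1 + k))) = w * (k / (1 + k) / 2).
      by field; rewrite gt_eqF// addr_gt0.
    rewrite gtr_pMr// ltr_pdivrMr// mul1r; apply: (@lt_trans _ _ 1); last by rewrite ltr1n.
    by rewrite ltr_pdivrMr ?addr_gt0// mul1r ltrDr.
  exact: (drop_pos ge h1 h2 e3).
have ftr q : r1 <= q <= r -> f_time q.
  by move=> /andP[q1 q2]; apply: ft; rewrite q1 (le_lt_trans q2).
have [R1 R2 [E1 E2] XX lenX] := f_pair ar1 (ltW r1r') rs rrx rrx' cc ftr.
have r1ab : a < r1 <= b by apply: sub_time.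
have sl := rfslope r1ab R1 R2 (ltW XX) (f1 _ R1).
rewrite E1 E2 in sl.
have sl2 := le_trans sl (ler_wpM2l (ltW delta_gt0) lenX).
exact: (once_f_arith delta_gt0 bs0 k0 w0 cc (erefl _) (erefl _) (erefl _) r1r ge h1 h2 sl2).
Qed.

End phases.

(** * Spreading of the values inside a region *)

(** Cleared of denominators, this says that [1/ka + bs * (t - q) <= T] and
    [1/kb + bs * (q - q') <= 1/ka] give [1/kb + bs * (t - q') <= T]. *)
Lemma g_step_arith (R : realFieldType) (ka kb T bs t q q' : R) : 0 < ka -> 0 < kb ->
  1 + bs * (t - q) * ka <= ka * T -> ka + bs * ka * kb * (q - q') <= kb ->
  1 + bs * (t - q') * kb <= kb * T.
Proof.
move=> a0 b0 h1 h2.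
rewrite -(ler_pM2l a0).
have h3 := ler_wpM2l (ltW b0) h1.
have -> : ka * (kb * T) = kb * (ka * T) by ring.
apply: le_trans h3.
have -> : kb * (1 + bs * (t - q) * ka) = kb + ka * kb * (bs * (t - q)) by ring.
have -> : ka * (1 + bs * (t - q') * kb) =
  ka + bs * ka * kb * (q - q') + ka * kb * (bs * (t - q)) by ring.
by rewrite lerD2r.
Qed.

Lemma g_limit_arith (R : realFieldType) (ka kb bs T t q p eta : R) :
  0 <= bs -> 0 < ka -> 0 <= T -> 0 < eta -> eta < 1 -> q < p -> p - q <= eta -> q < t ->
  `|kb - ka| <= eta -> 1 + bs * (t - p) * kb <= kb * T ->
  1 + bs * (t - q) * ka - ka * T <= (bs * (t - q) + T + bs * (ka + 1)) * eta.
Proof.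
move=> bs0 ka0 T0 eta0 eta1 qp pq qt; rewrite ler_norml => /andP[k1 k2] P.
have h1 : bs * (t - q) * (ka - kb) <= bs * (t - q) * eta.
  by rewrite ler_wpM2l ?mulr_ge0 ?subr_ge0 ?(ltW qt)//; lra.
have h2 : T * (kb - ka) <= T * eta by rewrite ler_wpM2l.
have h3 : bs * ((p - q) * kb) <= bs * (eta * (ka + 1)).
  rewrite ler_wpM2l//; have [kb0|kb0] := leP 0 kb.
    by apply: ler_pM => //; lra.
  apply: (@le_trans _ _ 0); first by rewrite nmulr_lle0 ?subr_ge0 ?(ltW qp).
  by rewrite mulr_ge0 ?addr_ge0 ?(ltW eta0) ?(ltW ka0).
have -> : 1 + bs * (t - q) * ka - ka * T =
  (1 + bs * (t - p) * kb - kb * T) + bs * (t - q) * (ka - kb) + T * (kb - ka) + bs * ((p - q) * kb).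
  by ring.
have -> : (bs * (t - q) + T + bs * (ka + 1)) * eta =
  bs * (t - q) * eta + T * eta + bs * (eta * (ka + 1)) by ring.
have P' : 1 + bs * (t - p) * kb - kb * T <= 0 by rewrite subr_le0.
by rewrite !lerD// (le_trans _ h1)// gerDr.
Qed.

Lemma g_before_f_arith (R : realFieldType) (delta bs D w s q T e : R) :
  delta * bs * D * (q - T) <= e -> D <= delta * (w - bs * D * (s - q)) ->
  D * (1 + delta * bs * (s - T)) <= delta * w + e.
Proof.
move=> h1 h2.
have -> : D * (1 + delta * bs * (s - T)) = D + delta * (bs * D * (s - q)) + delta * bs * D * (q - T).
  by ring.
by apply: lerD h1; rewrite -lerBrDr -mulrBr.
Qed.

Lemma slope_cancel (R : realFieldType) (k w k' : R) : 0 < k ->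
  k * w * (k' / k) = k' * w.
Proof. by move=> k0; field; rewrite gt_eqF. Qed.

Section decay.
Context (R : realType) (alpha beta betas delta L u0 : R) (f g : R -> R)
  (u : R -> R -> R).
Context (delta_gt0 : 0 < delta) (L_gt0 : 0 < L)
  (A1 : assumption_A1 alpha beta betas f g)
  (weak : weak_solution delta L f g (cst u0) u)
  (adm : forall s, 0 <= s -> admissible_profile alpha delta L u0 (u s))
  (neg : (@lebesgue_measure R \x @lebesgue_measure R)%E.-negligible
        [set p | [/\ 0 < p.1, derivable (u p.1) p.2 1
                   & dx u p.1 p.2 = - delta]]).
Context (a b : R) (n : nat) (y : nat -> R -> R) (a_gt0 : 0 < a)
  (JC : jump_curves delta L f g u a b n y).

Local Notation reg := (region L n y).
Local Notation phase := (f_phase delta u).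

Context (s x0 : R) (sab : a < s <= b) (nj : ~ jump_set (u s) x0).

Let s_gt_a : a < s. Proof. by case/andP: sab. Qed.
Let s_le_b : s <= b. Proof. by case/andP: sab. Qed.
Let sub_time r : a < r -> r <= s -> a < r <= b.
Proof. by move=> -> h; exact: le_trans h s_le_b. Qed.

Let rphase := region_phase L_gt0 adm a_gt0 JC sab nj.
Let rmono := region_mono L_gt0 adm a_gt0 JC sab nj.
Let rcont := region_continuous L_gt0 weak adm a_gt0 JC sab nj.
Let rball := region_ball L_gt0 JC sab nj.
Let rfslope := region_f_slope L_gt0 adm a_gt0 JC sab nj.
Let rgslope := region_g_slope L_gt0 adm a_gt0 JC sab nj.

Local Notation f_time := (f_time delta L u n y s x0).
Let not_f := not_f_time L_gt0 adm a_gt0 JC sab nj.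
Let nonempty := region_nonempty L_gt0 JC sab nj.
Let once := once_f delta_gt0 L_gt0 A1 weak adm neg a_gt0 JC sab nj.
Let fpair := f_pair delta_gt0 L_gt0 A1 weak adm neg a_gt0 JC sab nj.

Lemma g_slope_cst r z z' : a < r -> r <= s -> ~ phase r z -> reg s x0 r z ->
  reg s x0 r z' -> derive1 (u r) z' = derive1 (u r) z.
Proof.
move=> ar rs nz rz rz'; have rab := sub_time ar rs.
have nz' : ~ phase r z' by move=> h; exact: nz (rphase rab rz' rz h).
have [->//|zz] := eqVneq z' z.
have E1 := rgslope rab rz rz' nz; have E2 := rgslope rab rz' rz nz'.
have h : z' - z != 0 by rewrite subr_eq0.
apply: (mulIf h).
have E3 : u r z - u r z' = - (derive1 (u r) z' * (z' - z)).
  by rewrite -opprB E2; congr (- _); ring.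
by move: E3; rewrite E1 mulNr => /oppr_inj.
Qed.

(* The slope [- k] of a region following the flux [g] satisfies
   [d(1/k)/dt >= betas]. *)
Lemma g_decay r t zr zt : a < r -> r <= t -> t <= s ->
  (forall q, r <= q <= t -> ~ f_time q) -> reg s x0 r zr -> reg s x0 t zt ->
  1 + betas * (t - r) * - derive1 (u r) zr <=
    - derive1 (u r) zr * (- derive1 (u t) zt)^-1.
Proof.
move=> ar rt ts ng rzr rzt.
have [_ _ bs0 _ conc] := A1_facts A1.
have at_ := lt_le_trans ar rt.
have ntt : ~ phase t zt.
  by apply: not_f rzt => //; apply: ng; rewrite rt lexx.
set T := (- derive1 (u t) zt)^-1.
have kt0 : 0 < - derive1 (u t) zt by exact: lt_le_trans delta_gt0 (g_slope_ge ntt).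
have T0 : 0 < T by rewrite invr_gt0.
have qs q : r <= q <= t -> [/\ a < q, q <= s, a < q <= b & ~ f_time q].
  move=> h; have /andP[h1 h2] := h; have aq := lt_le_trans ar h1.
  have h3 := le_trans h2 ts.
  by split => //; [exact: sub_time|exact: ng].
(* This is [1/k + betas * (t - q) <= T] multiplied by [k]. It is stated for all points of the
   region, since no single point need belong to it at all times. *)
suff H : forall q, r <= q <= t -> forall z, reg s x0 q z ->
    1 + betas * (t - q) * - derive1 (u q) z <= - derive1 (u q) z * T.
  by apply: H rzr; rewrite lexx.
apply: left_induction => //.
- move=> z rz; rewrite subrr mulr0 mul0r addr0.
  by rewrite (g_slope_cst at_ ts ntt rzt rz) /T mulfV// gt_eqF.
- move=> q /andP[q1 q2] Pq.
  have qrt : r <= q <= t by rewrite (ltW q1).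
  have [aq qs_ qab nfq] := qs q qrt.
  have [z1 rz1] := nonempty aq qs_.
  have [e e0 He] := rball qab rz1.
  have qq : `|q - q| < e by rewrite subrr normr0.
  have [_ Hq] := He q qab qq.
  pose z2 := z1 + e / 2.
  have e20 : 0 < e / 2 by rewrite divr_gt0.
  have rz2 : reg s x0 q z2.
    by apply: Hq; rewrite /z2 addrAC subrr add0r gtr0_norm// half_lt.
  have nz1 : ~ phase q z1 by exact: not_f rz1.
  have ph : (g = f /\ forall t, r < t < q -> forall z, reg s x0 t z -> phase t z) \/
      (g = g /\ forall t, r < t < q -> forall z, reg s x0 t z -> ~ phase t z).
    right; split => // p /andP[p1 p2] z rz.
    have prt : r <= p <= t by rewrite (ltW p1) (le_trans (ltW p2) q2).
    have [h1 h2 _ h3] := qs p prt.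
    exact: (not_f h1 h2 h3 rz).
  (* Two characteristics of [g] followed backward for a short time: their values do not change, so
     the change of their distance is a change of the slope. *)
  have [e1 e10 H1] := region_line delta_gt0 L_gt0 A1 weak adm neg a_gt0 JC sab nj
    qab rz1 (ltW ar) q1 ph.
  have [e2 e2' H2] := region_line delta_gt0 L_gt0 A1 weak adm neg a_gt0 JC sab nj
    qab rz2 (ltW ar) q1 ph.
  set c1 := u q z1 in H1; set c2 := u q z2 in H2.
  pose ka := - derive1 (u q) z1.
  have ka0 : 0 < ka by exact: lt_le_trans delta_gt0 (g_slope_ge nz1).
  have cE : c1 - c2 = ka * (z2 - z1) by exact: (rgslope qab rz1 rz2 nz1).
  have zz0 : 0 < z2 - z1 by rewrite /z2 addrAC subrr add0r.
  have cc : c2 < c1 by rewrite -subr_gt0 cE mulr_gt0.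
  pose C := `|derive1 g c1| + `|derive1 g c2| + 1.
  have C0 : 0 < C by rewrite ltr_wpDl// addr_ge0.
  pose e' := Num.min (Num.min e1 e2) (Num.min e (e / 2 / C)).
  exists e'; first by rewrite !lt_min e10 e2' e0 divr_gt0.
  move=> q' /andP[q'1 q'2] rq' z rz.
  have q'0 : 0 < q - q' by rewrite subr_gt0.
  have q'e : q - q' < e' by rewrite ltrBlDl -ltrBlDr.
  have := q'e; rewrite !lt_min => /andP[/andP[qe1 qe2] /andP[qe3 qe4]].
  have qrt' : r <= q' <= t by rewrite rq' (le_trans (ltW q'2)).
  have [aq' q's q'ab nfq'] := qs q' qrt'.
  have [_ Hq'] : jump_free (u q') (z1 - e) (z1 + e) /\
      (forall w, `|w - z1| < e -> reg s x0 q' w).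
    by apply: He => //; rewrite distrC gtr0_norm.
  have CC : C * (q - q') < e / 2 by rewrite mulrC -ltr_pdivlMr.
  have small c : `|derive1 g c| <= C -> `|derive1 g c * (q' - q)| < e / 2.
    move=> h; rewrite normrM distrC (gtr0_norm q'0); apply: le_lt_trans CC.
    by rewrite ler_wpM2r// ltW.
  have C1 : `|derive1 g c1| <= C by rewrite /C -addrA lerDl addr_ge0.
  have C2 : `|derive1 g c2| <= C by rewrite /C addrAC lerDr addr_ge0.
  pose Z1 := z1 + derive1 g c1 * (q' - q).
  pose Z2 := z2 + derive1 g c2 * (q' - q).
  have rZ1 : reg s x0 q' Z1.
    apply: Hq'; rewrite /Z1 addrAC subrr add0r; apply: lt_trans (small _ C1) _.
    exact: half_lt.
  have rZ2 : reg s x0 q' Z2.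
    apply: Hq'; rewrite /Z2 addrAC; apply: le_lt_trans (ler_normD _ _) _.
    have zzE : z2 - z1 = e / 2 by rewrite /z2 addrAC subrr add0r.
    rewrite (gtr0_norm zz0) zzE.
    by have := small _ C2 => h; rewrite [ltRHS](splitr e) ltrD2l.
  have u1 : u q' Z1 = c1 by apply: H1; rewrite (ltW q'2) andbT ltrBlDr -ltrBlDl.
  have u2 : u q' Z2 = c2 by apply: H2; rewrite (ltW q'2) andbT ltrBlDr -ltrBlDl.
  have nz : ~ phase q' z by exact: not_f rz.
  have nZ1 : ~ phase q' Z1 by exact: not_f rZ1.
  pose kb := - derive1 (u q') z.
  have kb0 : 0 < kb by exact: lt_le_trans delta_gt0 (g_slope_ge nz).
  have cE' : c1 - c2 = kb * (Z2 - Z1).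
    rewrite -u1 -u2 (rgslope q'ab rZ1 rZ2 nZ1) /kb.
    by rewrite (g_slope_cst aq' q's nz rz rZ1).
  have q0 := time_ge0 a_gt0 qab.
  have /andP[c20 _] := sol_range_le adm z2 q0.
  have /andP[_ c1a] := sol_range_le adm z1 q0.
  have cv := conc g (or_intror erefl) _ _ c20 (ltW cc) c1a.
  have ZZ : Z2 - Z1 <= (z2 - z1) - betas * (c1 - c2) * (q - q').
    have -> : Z2 - Z1 = z2 - z1 - (derive1 g c2 - derive1 g c1) * (q - q').
      by rewrite /Z1 /Z2; ring.
    by rewrite lerD2l lerN2 ler_wpM2r// ltW.
  have qqt : q <= q <= t by rewrite lexx q2.
  apply: (g_step_arith ka0 kb0 (q := q)); first exact: (Pq q qqt z1 rz1).
  rewrite -(ler_pM2r zz0).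
  have h5 : ka * (z2 - z1) <= kb * ((z2 - z1) - betas * (c1 - c2) * (q - q')).
    by rewrite -cE {1}cE'; exact: (ler_wpM2l (ltW kb0) ZZ).
  rewrite mulrDl -lerBrDr; apply: le_trans h5 _.
  by rewrite cE le_eqVlt; apply/orP; left; apply/eqP; ring.
- move=> q /andP[q1 q2] Pq z rz.
  have qrt : r <= q <= t by rewrite q1 ltW.
  have [aq qs_ qab nfq] := qs q qrt.
  have [e e0 He] := rball qab rz.
  have qq : `|q - q| < e by rewrite subrr normr0.
  have [_ Hq] := He q qab qq.
  pose z2 := z + e / 2.
  have e20 : 0 < e / 2 by rewrite divr_gt0.
  have w0 : 0 < z2 - z by rewrite /z2 addrAC subrr add0r.
  have dz2 : `|z2 - z| < e by rewrite (gtr0_norm w0) /z2 addrAC subrr add0r half_lt.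
  have rz2 : reg s x0 q z2 by exact: Hq.
  have nz : ~ phase q z by exact: not_f rz.
  pose ka := - derive1 (u q) z.
  have kaE := rgslope qab rz rz2 nz.
  rewrite -subr_le0.
  apply: (@mulr_arch_le0 _ _ (betas * (t - q) + T + betas * (ka + 1)) 1) => // eta eta0 eta1.
  pose h := eta * (z2 - z) / 2.
  have h0 : 0 < h by rewrite divr_gt0// mulr_gt0.
  have [d1 d10 H1] := rcont qab rz h0.
  have [d2 d20 H2] := rcont qab rz2 h0.
  pose d := Num.min (Num.min e eta) (Num.min d1 d2).
  have d0 : 0 < d by rewrite !lt_min e0 eta0 d10.
  pose p := Num.min t (q + d / 2).
  have qp : q < p by rewrite lt_min q2 ltrDl divr_gt0.
  have pt : p <= t by rewrite ge_min lexx.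
  have pd : `|p - q| < d.
    rewrite gtr0_norm ?subr_gt0//; apply: le_lt_trans (half_lt d0).
    by rewrite lerBlDl ge_min lexx orbT.
  move: pd; rewrite !lt_min => /andP[/andP[pe peta] /andP[pd1 pd2]].
  have prt : r <= p <= t by rewrite (le_trans q1 (ltW qp)).
  have [ap ps pab nfp] := qs p prt.
  have [_ Hp] := He p pab pe.
  have rpz : reg s x0 p z by apply: Hp; rewrite subrr normr0.
  have rpz2 : reg s x0 p z2 by exact: Hp.
  have npz : ~ phase p z by exact: not_f rpz.
  have zz : `|z - z| < d1 by rewrite subrr normr0.
  have zz2 : `|z2 - z2| < d2 by rewrite subrr normr0.
  have h1 := H1 p z pab pd1 zz; have h2 := H2 p z2 pab pd2 zz2.
  have kbE := rgslope pab rpz rpz2 npz.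
  pose kb := - derive1 (u p) z.
  have Pp : 1 + betas * (t - p) * kb <= kb * T.
    by apply: (Pq p) => //; rewrite qp.
  have kab : `|kb - ka| <= eta.
    have -> : kb - ka = ((u p z - u q z) - (u p z2 - u q z2)) / (z2 - z).
      have -> : u p z - u q z - (u p z2 - u q z2) = (u p z - u p z2) - (u q z - u q z2).
        by ring.
      by rewrite kbE kaE -mulrBl mulfK// gt_eqF.
    rewrite normrM normfV (gtr0_norm w0) ler_pdivrMr//.
    apply: le_trans (ler_normB _ _) _; apply: le_trans (lerD h1 h2) _.
    by rewrite /h le_eqVlt; apply/orP; left; apply/eqP; field.
  rewrite (gtr0_norm (_ : 0 < p - q)) ?subr_gt0// in peta.
  apply: (@g_limit_arith _ ka kb betas T t q p eta) => //.
  - exact: ltW.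
  - exact: lt_le_trans delta_gt0 (g_slope_ge nz).
  - exact: ltW.
  - exact: ltW.
Qed.

(** With [D] the drop from [x1] to [x2] and [k] the opposite of the slope at [r], this is
    [D * (1/k + betas * (s - r)) <= x2 - x1]. If phase [g] lasts until [s], it is [g_decay].
    Otherwise, for the switching time [T], [g_decay] gives [1/k + betas * (T - r) <= 1/delta],
    because slopes are at most [- delta] at [T], and the lines of [f] give [D * (1/delta + betas *
    (s - T)) <= x2 - x1], because slopes are above [- delta] just after [T]. *)
Lemma g_pair_bound r x1 x2 z : a < r -> r <= s -> ~ f_time r ->
  reg s x0 s x1 -> reg s x0 s x2 -> x1 < x2 -> u s x2 < u s x1 -> reg s x0 r z ->
  (u s x1 - u s x2) * (1 + betas * (s - r) * - derive1 (u r) z) <=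
    - derive1 (u r) z * (x2 - x1).
Proof.
move=> ar rs nfr rx1 rx2 x12 c12 rz.
have [_ _ bs0 _ _] := A1_facts A1.
have nfz : ~ phase r z by exact: not_f rz.
set ka := - derive1 (u r) z.
have ka0 : 0 < ka by exact: lt_le_trans delta_gt0 (g_slope_ge nfz).
have D0 : 0 < u s x1 - u s x2 by rewrite subr_gt0.
have [fs|nfs] := pselect (f_time s); last first.
  have ng q : r <= q <= s -> ~ f_time q.
    move=> /andP[q1 q2] fq; apply: nfs.
    by apply: (once (lt_le_trans ar q1) q2 fq); rewrite q2 lexx.
  have h := g_decay ar rs (lexx s) ng rz rx1.
  have nsx : ~ phase s x1 by apply: not_f rx1.
  have ks0 : 0 < - derive1 (u s) x1 by exact: lt_le_trans delta_gt0 (g_slope_ge nsx).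
  have := ler_wpM2l (ltW D0) h => /le_trans; apply.
  rewrite (rgslope sab rx1 rx2 nsx) -/ka le_eqVlt; apply/orP; left; apply/eqP.
  exact: slope_cancel.
(* The last time in phase [g]. If there were none, phase [f] would propagate backward from [s] to
   [r], as it is an open condition in time. *)
have [T [/andP[rT Ts] nfT fT]] : exists T, [/\ r <= T < s, ~ f_time T &
    forall q, T < q <= s -> f_time q].
  apply: contrapT => nT; apply: nfr.
  apply: (@left_induction R r s f_time rs fs); last by rewrite lexx.
    move=> t /andP[t1 t2] ft.
    have [|e e0 He] := f_time_open L_gt0 weak adm a_gt0 JC sab nj (lt_trans ar t1) t2.
      by apply: ft; rewrite lexx.
    exists e => // q /andP[q1 q2] rq; apply: He.
    - exact: lt_le_trans ar rq.
    - exact: le_trans (ltW q2) t2.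
    - by rewrite ltr0_norm ?subr_lt0// opprB ltrBlDl -ltrBlDr.
  move=> t trs ft; apply: contrapT => nft; apply: nT; exists t; split => //.
have aT := lt_le_trans ar rT.
have ng q : r <= q <= T -> ~ f_time q.
  move=> /andP[q1 q2] fq; apply: nfT.
  apply: (once (lt_le_trans ar q1) (le_trans q2 (ltW Ts)) fq).
  by rewrite q2 ltW.
have [zT rzT] := nonempty aT (ltW Ts).
have h1 := g_decay ar rT (ltW Ts) ng rz rzT.
have nzT : ~ phase T zT by exact: not_f (ltW Ts) nfT rzT.
have kT := g_slope_ge nzT.
have h2 : (u s x1 - u s x2) * (1 + delta * betas * (s - T)) <= delta * (x2 - x1).
  apply/ler_addgt0Pr => e e0.
  pose C := delta * betas * (u s x1 - u s x2) + 1.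
  have C1 : 0 <= delta * betas * (u s x1 - u s x2) by rewrite !mulr_ge0 ?(ltW delta_gt0) ?(ltW bs0) ?(ltW D0).
  have C0 : 0 < C by rewrite ltr_wpDl.
  (* The lines of [f] are available after [T] only; the estimate is made at a slightly later time
     [q], at the price of the error [e]. *)
  pose q := Num.min s (T + e / C).
  have Tq : T < q by rewrite lt_min Ts ltrDl divr_gt0.
  have qs_ : q <= s by rewrite ge_min lexx.
  have qC : C * (q - T) <= e.
    by rewrite mulrC -ler_pdivlMr// lerBlDl ge_min lexx orbT.
  have ftq p : q <= p <= s -> f_time p.
    by move=> /andP[p1 p2]; apply: fT; rewrite p2 (lt_le_trans Tq p1).
  have aq := lt_trans aT Tq.
  have [R1 R2 [E1 E2] XX lenX] := fpair aq qs_ (lexx s) rx1 rx2 c12 ftq.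
  have fq : phase q (x1 + derive1 f (u s x1) * (q - s)).
    by apply: (ftq q) => //; rewrite lexx.
  have sl := rfslope (sub_time aq qs_) R1 R2 (ltW XX) fq.
  rewrite E1 E2 in sl.
  have sl2 := le_trans sl (ler_wpM2l (ltW delta_gt0) lenX).
  have qT0 : 0 <= q - T by rewrite subr_ge0 ltW.
  have h3 : (C - 1) * (q - T) <= e.
    by apply: le_trans qC; rewrite ler_wpM2r// gerBl.
  by rewrite /C addrK in h3; exact: g_before_f_arith h3 sl2.
have h3 : 1 + betas * (T - r) * ka <= ka / delta.
  apply: le_trans h1 _; rewrite -/ka ler_wpM2l ?(ltW ka0)//.
  by rewrite lef_pV2 ?posrE// (lt_le_trans delta_gt0 kT).
have -> : 1 + betas * (s - r) * ka = (1 + betas * (T - r) * ka) + betas * (s - T) * ka.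
  by ring.
apply: (@le_trans _ _ ((u s x1 - u s x2) * (ka / delta + betas * (s - T) * ka))).
  by rewrite ler_wpM2l ?(ltW D0)// lerD2r.
have -> : (u s x1 - u s x2) * (ka / delta + betas * (s - T) * ka) =
  ka / delta * ((u s x1 - u s x2) * (1 + delta * betas * (s - T))).
  by field; rewrite gt_eqF.
have -> : ka * (x2 - x1) = ka / delta * (delta * (x2 - x1)).
  by field; rewrite gt_eqF.
by rewrite ler_wpM2l// divr_ge0// ltW.
Qed.

(** Nothing is known of the profile at [r]: in phase [f] it is enough that the feet of the two lines
    are ordered, and in phase [g] the contribution of [1/k] in [g_pair_bound] is dropped. *)
Lemma decay_mid r x1 x2 : a < r -> r <= s -> reg s x0 s x1 -> reg s x0 s x2 ->
  x1 <= x2 -> betas * (s - r) * (u s x1 - u s x2) <= x2 - x1.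
Proof.
move=> ar rs rx1 rx2 x12.
have [_ _ bs0 _ _] := A1_facts A1.
have mono := rmono sab rx1 rx2 x12.
move: mono; rewrite le_eqVlt => /predU1P[->|c12]; first by rewrite subrr mulr0 subr_ge0.
have {}x12 : x1 < x2.
  by rewrite lt_neqAle x12 andbT; apply/eqP => E; rewrite E ltxx in c12.
have [fr|nfr] := pselect (f_time r).
  have [_ _ _ XX lenX] := fpair ar rs (lexx s) rx1 rx2 c12 (once ar rs fr).
  have := le_trans (ltW (_ : 0 < _)) lenX; rewrite subr_gt0 => /(_ XX).
  by rewrite subr_ge0 mulrAC.
have [z rz] := nonempty ar rs.
have h := g_pair_bound ar rs nfr rx1 rx2 x12 c12 rz.
have nfz : ~ phase r z by exact: not_f rz.
have ka0 : 0 < - derive1 (u r) z by exact: lt_le_trans delta_gt0 (g_slope_ge nfz).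
rewrite -(ler_pM2l ka0); apply: le_trans h.
have -> : (u s x1 - u s x2) * (1 + betas * (s - r) * - derive1 (u r) z) =
  (u s x1 - u s x2) + - derive1 (u r) z * (betas * (s - r) * (u s x1 - u s x2)) by ring.
by rewrite lerDr subr_ge0 ltW.
Qed.

End decay.

(** * Spreading from the beginning of a time interval *)

Lemma f_start_arith (R : realFieldType) (th delta D v1 v2 w1 w2 z1 z2 l1 l2 eta c1 c2 : R) :
  0 <= th -> 0 < delta -> D = c1 - c2 ->
  `|l1 - z1| <= eta -> `|l2 - z2| <= eta ->
  `|v1 - w1| <= eta -> `|v2 - w2| <= eta ->
  c1 - v1 <= delta * (z1 + 2 * eta - l1) -> v2 - c2 <= delta * (l2 - (z2 - 2 * eta)) ->
  th * (w1 - w2) <= z2 - 2 * eta - (z1 + 2 * eta) -> 0 < eta ->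
  th * D - (z2 - z1) <= th * (2 + 6 * delta) * eta.
Proof.
move=> th0 d0 ->; rewrite !ler_norml => /andP[a1 a2] /andP[b1 b2] /andP[e1 e2] /andP[f1 f2].
move=> h1 h2 h3 eta0.
have k1 : c1 - v1 <= delta * (3 * eta).
  by apply: le_trans h1 _; rewrite ler_wpM2l ?(ltW d0)//; lra.
have k2 : v2 - c2 <= delta * (3 * eta).
  by apply: le_trans h2 _; rewrite ler_wpM2l ?(ltW d0)//; lra.
have k3 : c1 - c2 <= (w1 - w2) + (2 + 6 * delta) * eta by lra.
have k4 := ler_wpM2l th0 k3.
have E : th * (w1 - w2 + (2 + 6 * delta) * eta) =
  th * (w1 - w2) + th * (2 + 6 * delta) * eta by ring.
rewrite {}E in k4.
rewrite lerBlDr; apply: le_trans k4 _; rewrite addrC lerD2l.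
by apply: le_trans h3 _; lra.
Qed.

Lemma g_start_arith (R : realFieldType) (th delta betas D k eta sr sa w : R) :
  0 < delta -> 0 < betas -> 0 < D -> 0 < eta -> delta <= k ->
  th * k <= 1 + eta -> sa <= sr + eta ->
  D * (1 + betas * sr * k) <= k * w ->
  (th + betas * sa) * D - w <= D * (delta^-1 + betas) * eta.
Proof.
move=> d0 b0 D0 eta0 dk h1 h2 h3.
have k0 : 0 < k by exact: lt_le_trans dk.
have h4 : D * (th * k - eta + betas * sr * k) <= k * w.
  by apply: le_trans h3; rewrite ler_wpM2l ?(ltW D0)// lerD2r lerBlDr.
have h5 : (th + betas * sr) * D <= w + D * eta / k.
  rewrite -(ler_pM2l k0).
  have -> : k * (w + D * eta / k) = k * w + D * eta by field; rewrite gt_eqF.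
  rewrite -lerBlDr; apply: le_trans h4.
  by rewrite le_eqVlt; apply/orP; left; apply/eqP; ring.
have h6 : D * eta / k <= D * eta / delta.
  by rewrite ler_wpM2l ?mulr_ge0 ?(ltW D0) ?(ltW eta0)// lef_pV2 ?posrE.
have h7 : betas * sa * D <= betas * (sr + eta) * D.
  by rewrite ler_wpM2r ?(ltW D0)// ler_wpM2l ?(ltW b0).
have -> : D * (delta^-1 + betas) * eta = D * eta / delta + betas * eta * D by ring.
have -> : (th + betas * sa) * D = th * D + betas * sa * D by ring.
have h8 : th * D + betas * (sr + eta) * D = (th + betas * sr) * D + betas * eta * D by ring.
rewrite lerBlDr; apply: (le_trans (lerD (lexx _) h7)); rewrite h8.
apply: le_trans (lerD (le_trans h5 (lerD (lexx w) h6)) (lexx _)) _.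
by rewrite -addrA addrC.
Qed.

Lemma start_slope_arith (R : realFieldType) (th eta v1 v2 w1 w2 w : R) :
  0 <= th -> 0 < eta -> 0 < w ->
  `|v1 - w1| <= eta * w / (2 * (th + 1)) -> `|v2 - w2| <= eta * w / (2 * (th + 1)) ->
  th * (w1 - w2) <= w -> th * (v1 - v2) <= (1 + eta) * w.
Proof.
move=> th0 eta0 w0; set h := _ / _; rewrite !ler_norml => /andP[_ a1] /andP[b1 _] k.
have h0 : 0 <= h by rewrite divr_ge0 ?mulr_ge0 ?addr_ge0 ?(ltW eta0) ?(ltW w0).
have hE : 2 * (th + 1) * h = eta * w by rewrite /h; field; rewrite gt_eqF// ltr_wpDl.
have k1 : v1 - v2 <= (w1 - w2) + 2 * h by move: a1 b1; clear; lra.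
have k2 := ler_wpM2l th0 k1.
apply: le_trans k2 _.
have -> : (1 + eta) * w = w + 2 * (th + 1) * h by rewrite hE; ring.
have -> : th * (w1 - w2 + 2 * h) = th * (w1 - w2) + th * 2 * h by ring.
by rewrite lerD// ler_wpM2r// mulrC ler_wpM2l// lerDl.
Qed.

Lemma two_points (R : realFieldType) (P Q : R) : P < Q ->
  exists z z', [/\ P < z, z < z' & z' < Q].
Proof.
by move=> PQ; exists ((2 * P + Q) / 3), ((P + 2 * Q) / 3); split; lra.
Qed.

Lemma shrink_arith (R : realFieldType) (P Q z1 z2 eta : R) : 0 < eta ->
  4 * eta < z2 - z1 -> P <= z1 -> z2 <= Q ->
  [/\ P + eta < z1 + 2 * eta, z1 + 2 * eta < z2 - 2 * eta & z2 - 2 * eta < Q - eta].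
Proof. by move=> *; split; lra. Qed.

Lemma sub_start_arith (R : realFieldType) (a r s eta : R) : r - a < eta ->
  s - a <= s - r + eta.
Proof. by move=> *; lra. Qed.

Section start.
Context (R : realType) (alpha beta betas delta L u0 : R) (f g : R -> R)
  (u : R -> R -> R).
Context (delta_gt0 : 0 < delta) (L_gt0 : 0 < L)
  (A1 : assumption_A1 alpha beta betas f g)
  (weak : weak_solution delta L f g (cst u0) u)
  (adm : forall s, 0 <= s -> admissible_profile alpha delta L u0 (u s))
  (neg : (@lebesgue_measure R \x @lebesgue_measure R)%E.-negligible
        [set p | [/\ 0 < p.1, derivable (u p.1) p.2 1
                   & dx u p.1 p.2 = - delta]]).
Context (a b : R) (n : nat) (y : nat -> R -> R) (a_gt0 : 0 < a)
  (JC : jump_curves delta L f g u a b n y).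

Local Notation reg := (region L n y).
Local Notation phase := (f_phase delta u).
Local Notation lift := (lift_curve L y).

Context (s x0 : R) (sab : a < s <= b) (nj : ~ jump_set (u s) x0).
Context (P Q th : R) (jfa : jump_free (u a) P Q) (th_ge0 : 0 <= th)
  (PQ : P < Q)
  (ua_good : forall z z', P < z -> z < z' -> z' < Q -> th * (u a z - u a z') <= z' - z)
  (side : forall p, (p.1 < n)%N ->
    (lift p s < x0 -> lift p a <= P) /\ (x0 < lift p s -> Q <= lift p a))
  (P_lift : exists p, [/\ (p.1 < n)%N, lift p s < x0 & lift p a = P])
  (Q_lift : exists p, [/\ (p.1 < n)%N, x0 < lift p s & lift p a = Q]).

Let s_gt_a : a < s. Proof. by case/andP: sab. Qed.
Let s_le_b : s <= b. Proof. by case/andP: sab. Qed.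
Let sub_time r : a < r -> r <= s -> a < r <= b.
Proof. by move=> -> h; exact: le_trans h s_le_b. Qed.

Let rmono := region_mono L_gt0 adm a_gt0 JC sab nj.
Let rfslope := region_f_slope L_gt0 adm a_gt0 JC sab nj.
Let rgslope := region_g_slope L_gt0 adm a_gt0 JC sab nj.
Local Notation f_time := (f_time delta L u n y s x0).
Let not_f := not_f_time L_gt0 adm a_gt0 JC sab nj.
Let once := once_f delta_gt0 L_gt0 A1 weak adm neg a_gt0 JC sab nj.
Let fpair := f_pair delta_gt0 L_gt0 A1 weak adm neg a_gt0 JC sab nj.

(** The curves describe the jumps only after time [a], so the profile at [a] is reached as a limit
    from the right; Lipschitz continuity keeps the curves close to their starting points
    meanwhile. *)
Lemma region_start eta : 0 < eta -> exists2 d, 0 < d & forall r z,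
  a < r -> r <= s -> r - a < d -> P + eta < z < Q - eta -> reg s x0 r z.
Proof.
move=> eta0; have [K K0 lip] := lift_lipschitz JC.
have K1 : 0 < K + 1 by rewrite ltr_wpDl.
exists (eta / (K + 1)); first exact: divr_gt0.
move=> r z ar rs rd /andP[z1 z2] p plt.
have ab : a <= b by exact: ltW (lt_le_trans s_gt_a s_le_b).
have near : `|lift p r - lift p a| < eta.
  apply: (@le_lt_trans _ _ (K * `|r - a|)).
    by apply: lip; rewrite ?lexx ?(ltW ar) ?(le_trans rs s_le_b).
  rewrite gtr0_norm ?subr_gt0//; apply: (@le_lt_trans _ _ ((K + 1) * (r - a))).
    by rewrite ler_wpM2r ?subr_ge0 ?(ltW ar)// lerDl.
  by rewrite mulrC -ltr_pdivlMr.
move: near; rewrite ltr_norml => /andP[n1 n2].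
have [h1 h2] := side plt; split.
  move=> /h1 h; apply: lt_trans z1; rewrite -ltrBlDl.
  by apply: le_lt_trans n2; rewrite lerD2l lerN2.
move=> /h2 h; apply: lt_trans z2 _; rewrite ltrBlDr -ltrBlDl.
by rewrite -ltrN2 opprB; apply: lt_le_trans n1 _; rewrite lerD2l lerN2.
Qed.

Lemma start_continuous z eta : P < z < Q -> 0 < eta -> exists2 d, 0 < d &
  forall r, a < r -> r <= s -> r - a < d -> `|u r z - u a z| <= eta.
Proof.
move=> /andP[Pz zQ] eta0.
pose e := Num.min (z - P) (Q - z) / 2.
have e0 : 0 < e by rewrite divr_gt0// lt_min !subr_gt0 Pz.
have e2 : e + e = Num.min (z - P) (Q - z) by rewrite -splitr.
have eP : P + e <= z - e.
  by rewrite lerBrDr -addrA e2 -lerBrDl ge_min lexx.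
have eQ : z + e <= Q - e.
  by rewrite lerBrDr -addrA e2 -lerBrDl ge_min lexx orbT.
have [d d0 Hd] := region_start e0.
pose T := [set r | a <= r <= s /\ r - a < d].
have Ta : T a by split; rewrite ?lexx ?(ltW s_gt_a)// subrr.
have [|r [/andP[ar rs] rd]|d' d'0 Hd'] := sol_continuous weak adm e0 _ Ta _ eta0 (x := z).
- by move=> r [/andP[ar _] _]; exact: le_trans (ltW a_gt0) ar.
- move: ar; rewrite le_eqVlt => /predU1P[<-|ar].
    by apply: jump_freeS jfa; [apply: le_trans eP|apply: le_trans eQ _];
      rewrite ?lerDl ?gerBl ltW.
  rewrite /jump_free -subset0 => w [/=]; rewrite in_itv/= => /andP[w1 w2].
  apply: (region_nojump JC sab (sub_time ar rs) nj); apply: Hd => //.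
  by rewrite (le_lt_trans eP w1) (lt_le_trans w2 eQ).
exists (Num.min d d'); first by rewrite lt_min d0.
move=> r ar rs; rewrite lt_min => /andP[rd rd'].
apply: Hd'; last by rewrite subrr normr0.
  by split => //; rewrite (ltW ar).
by rewrite gtr0_norm ?subr_gt0.
Qed.

(** If phase [g] occurs at some time, [once] gives it at all earlier times; the bound on [u a] then
    yields [th * k <= 1 + eta] for the slope [- k] shortly after [a], and [g_pair_bound] concludes.
    Otherwise the two lines of [f] are followed down to time [a], where the bound on [u a] is
    applied near their feet. *)
Lemma start_decay x1 x2 : reg s x0 s x1 -> reg s x0 s x2 -> x1 <= x2 ->
  (th + betas * (s - a)) * (u s x1 - u s x2) <= x2 - x1.
Proof.
move=> rx1 rx2 x12.
have [_ _ bs0 _ _] := A1_facts A1.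
have mono := rmono sab rx1 rx2 x12.
have sa0 : 0 < s - a by rewrite subr_gt0.
move: mono; rewrite le_eqVlt => /predU1P[->|c12]; first by rewrite subrr mulr0 subr_ge0.
have {}x12 : x1 < x2.
  by rewrite lt_neqAle x12 andbT; apply/eqP => E; rewrite E ltxx in c12.
have D0 : 0 < u s x1 - u s x2 by rewrite subr_gt0.
set D := u s x1 - u s x2 in D0 *.
have [fall|] := pselect (forall r, a < r -> r <= s -> f_time r); last first.
  move=> /existsNP [t /not_implyP[at_ /not_implyP[ts nft]]].
  have ng r : a < r -> r <= t -> ~ f_time r.
    move=> ar rt fr; apply: nft; apply: (once ar (le_trans rt ts) fr).
    by rewrite rt.
  have [z [z' [Pz zz z'Q]]] := two_points PQ.
  have w0 : 0 < z' - z by rewrite subr_gt0.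
  rewrite -subr_le0.
  apply: (@mulr_arch_le0 _ _ (D * (delta^-1 + betas)) 1) => // eta eta0 eta1.
  pose h := eta * (z' - z) / (2 * (th + 1)).
  have th1 : 0 < th + 1 by rewrite ltr_wpDl.
  have h0 : 0 < h by rewrite divr_gt0 ?mulr_gt0.
  have zPQ : P < z < Q by rewrite Pz (lt_trans zz z'Q).
  have z'PQ : P < z' < Q by rewrite z'Q (lt_trans Pz zz).
  have [d1 d10 H1] := start_continuous zPQ h0.
  have [d2 d20 H2] := start_continuous z'PQ h0.
  pose e := Num.min (z - P) (Q - z') / 2.
  have e0 : 0 < e by rewrite divr_gt0// lt_min !subr_gt0 Pz.
  have [d3 d30 H3] := region_start e0.
  pose d := Num.min (Num.min d1 d2) (Num.min d3 eta).
  have d0 : 0 < d by rewrite !lt_min d10 d20 d30.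
  pose r := Num.min t (a + d / 2).
  have ar : a < r by rewrite lt_min at_ ltrDl divr_gt0.
  have rt : r <= t by rewrite ge_min lexx.
  have rs := le_trans rt ts.
  have rd : r - a < d.
    apply: le_lt_trans (half_lt d0).
    by rewrite lerBlDl ge_min lexx orbT.
  move: rd; rewrite !lt_min => /andP[/andP[rd1 rd2] /andP[rd3 rd4]].
  have e2 : e < Num.min (z - P) (Q - z').
    by apply: half_lt; rewrite lt_min !subr_gt0 Pz.
  move: e2; rewrite lt_min => /andP[eP eQ].
  have zr : reg s x0 r z.
    apply: H3 => //; rewrite -ltrBrDl eP /=.
    by apply: lt_trans zz _; rewrite ltrBrDr -ltrBrDl.
  have z'r : reg s x0 r z'.
    apply: H3 => //; rewrite ltrBrDr -ltrBrDl eQ andbT.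
    by apply: lt_trans zz; rewrite -ltrBrDl.
  have nr := ng r ar rt.
  have nz : ~ phase r z by exact: not_f nr zr.
  have kE := rgslope (sub_time ar rs) zr z'r nz.
  have h1 := H1 r ar rs rd1; have h2 := H2 r ar rs rd2.
  apply: (@g_start_arith _ th delta betas D (- derive1 (u r) z) eta (s - r)) => //.
  - exact: g_slope_ge.
  - rewrite -(ler_pM2r w0) -mulrA -kE.
    have := ua_good Pz zz z'Q.
    exact: start_slope_arith.
  - exact: sub_start_arith.
  - exact: (g_pair_bound delta_gt0 L_gt0 A1 weak adm neg a_gt0 JC sab nj).
pose ell (x r : R) := x + derive1 f (u s x) * (r - s).
pose C := `|derive1 f (u s x1)| + `|derive1 f (u s x2)| + 1.
have C0 : 0 < C by rewrite ltr_wpDl// addr_ge0.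
have ellP x r : `|derive1 f (u s x)| <= C -> a < r -> `|ell x a - ell x r| <= C * (r - a).
  move=> h ar; have -> : ell x a - ell x r = derive1 f (u s x) * (a - r).
    by rewrite /ell; ring.
  have ar0 : 0 < r - a by rewrite subr_gt0.
  by rewrite normrM (distrC a) (gtr0_norm ar0) ler_wpM2r// ltW.
have C1 : `|derive1 f (u s x1)| <= C by rewrite /C -addrA lerDl addr_ge0.
have C2 : `|derive1 f (u s x2)| <= C by rewrite /C addrAC lerDr addr_ge0.
have pairs r : a < r -> r <= s -> [/\ reg s x0 r (ell x1 r), reg s x0 r (ell x2 r),
    u r (ell x1 r) = u s x1, u r (ell x2 r) = u s x2 & D <= delta * (ell x2 r - ell x1 r)].
  move=> ar rs; have ft q : r <= q <= s -> f_time q.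
    by move=> /andP[q1 q2]; apply: fall => //; exact: lt_le_trans q1.
  have [R1 R2 [E1 E2] XX _] := fpair ar rs (lexx s) rx1 rx2 c12 ft.
  have fr : phase r (ell x1 r) by apply: (fall r ar rs).
  split => //; rewrite /D -{1}E1 -{1}E2.
  exact: (rfslope (sub_time ar rs) R1 R2 (ltW XX) fr).
have [K K0 lip] := lift_lipschitz JC.
have ab : a <= b by exact: ltW (lt_le_trans s_gt_a s_le_b).
have CK0 : 0 <= C + K by rewrite addr_ge0// ltW.
have lipd x p r : `|derive1 f (u s x)| <= C -> (p.1 < n)%N -> a < r <= s ->
    `|(ell x a - lift p a) - (ell x r - lift p r)| <= (C + K) * (r - a).
  move=> Cx plt /andP[ar rs].
  have -> : ell x a - lift p a - (ell x r - lift p r) =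
    (ell x a - ell x r) - (lift p a - lift p r) by ring.
  apply: le_trans (ler_normB _ _) _; rewrite mulrDl; apply: lerD; first exact: ellP.
  have ar0 : 0 < r - a by rewrite subr_gt0.
  rewrite -(gtr0_norm ar0) (distrC r).
  by apply: lip; rewrite ?lexx ?(ltW ar) ?(le_trans rs s_le_b).
set z1 := ell x1 a; set z2 := ell x2 a.
have Pz1 : P <= z1.
  have [p [plt ps <-]] := P_lift; rewrite -subr_ge0.
  apply: (limit_right s_gt_a CK0 (d := fun r => ell x1 r - lift p r)).
    by move=> r; exact: lipd.
  move=> r /andP[ar rs]; have [R1 _ _ _ _] := pairs r ar rs.
  by rewrite subr_ge0; apply: ltW; exact: (R1 p plt).1.
have z2Q : z2 <= Q.
  have [p [plt ps <-]] := Q_lift; rewrite -subr_ge0.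
  apply: (limit_right s_gt_a CK0 (d := fun r => lift p r - ell x2 r)).
    move=> r ar; have -> : lift p a - ell x2 a - (lift p r - ell x2 r) =
      - ((ell x2 a - lift p a) - (ell x2 r - lift p r)) by ring.
    by rewrite normrN; exact: lipd.
  move=> r /andP[ar rs]; have [_ R2 _ _ _] := pairs r ar rs.
  by rewrite subr_ge0; apply: ltW; exact: (R2 p plt).2.
(* The slope bound of phase [f] passes to the limit, so that the two feet are still distinct. *)
have Dz : D / delta <= z2 - z1.
  rewrite -subr_ge0.
  have CC0 : 0 <= C + C by rewrite addr_ge0 ?(ltW C0).
  apply: (limit_right s_gt_a CC0 (d := fun r => ell x2 r - ell x1 r - D / delta)).
    move=> r /andP[ar rs].
    have -> : ell x2 a - ell x1 a - D / delta - (ell x2 r - ell x1 r - D / delta) =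
      (ell x2 a - ell x2 r) - (ell x1 a - ell x1 r) by ring.
    by apply: le_trans (ler_normB _ _) _; rewrite mulrDl; apply: lerD; exact: ellP.
  move=> r /andP[ar rs]; have [_ _ _ _ h] := pairs r ar rs.
  by rewrite subr_ge0 ler_pdivrMr// mulrC.
have zz0 : 0 < z2 - z1 by apply: lt_le_trans Dz; rewrite divr_gt0.
have zw : z2 - z1 <= x2 - x1 - betas * D * (s - a).
  have [_ _ _ _ conc] := A1_facts A1.
  have s0 := time_ge0 a_gt0 sab.
  have /andP[c20 _] := sol_range_le adm x2 s0.
  have /andP[_ c1a] := sol_range_le adm x1 s0.
  have cv := conc f (or_introl erefl) _ _ c20 (ltW c12) c1a.
  have -> : z2 - z1 = x2 - x1 - (derive1 f (u s x2) - derive1 f (u s x1)) * (s - a).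
    by rewrite /z1 /z2 /ell; ring.
  by rewrite lerD2l lerN2 ler_wpM2r// ltW.
suff thD : th * D <= z2 - z1.
  have := le_trans thD zw; rewrite lerBrDr; apply: le_trans.
  by rewrite le_eqVlt; apply/orP; left; apply/eqP; ring.
rewrite -subr_le0.
apply: (@mulr_arch_le0 _ _ (th * (2 + 6 * delta)) ((z2 - z1) / 4)); first by rewrite divr_gt0.
move=> eta eta0; rewrite ltr_pdivlMr// mulrC => eta4.
have [Pa ab' bQ] := shrink_arith eta0 eta4 Pz1 z2Q.
(* The feet may be [P] or [Q] themselves, where [u a] is not controlled. Moving inwards changes each
   value by at most [3 * delta * eta], because slopes are above [- delta]. *)
pose z1' := z1 + 2 * eta; pose z2' := z2 - 2 * eta.
have P1 : P < z1' < Q.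
  by rewrite (lt_trans _ Pa) ?ltrDl//= (lt_trans ab')// (lt_trans bQ)// gtrBl.
have P2 : P < z2' < Q.
  by rewrite (lt_trans _ ab') ?(lt_trans _ Pa) ?ltrDl//= (lt_trans bQ)// gtrBl.
have [d1 d10 H1] := start_continuous P1 eta0.
have [d2 d20 H2] := start_continuous P2 eta0.
have [d3 d30 H3] := region_start eta0.
pose d := Num.min (Num.min d1 d2) (Num.min d3 (eta / C)).
have d0 : 0 < d by rewrite !lt_min d10 d20 d30 divr_gt0.
pose r := Num.min s (a + d / 2).
have ar : a < r by rewrite lt_min s_gt_a ltrDl divr_gt0.
have rs : r <= s by rewrite ge_min lexx.
have rd : r - a < d.
  apply: le_lt_trans (half_lt d0).
  by rewrite lerBlDl ge_min lexx orbT.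
move: rd; rewrite !lt_min => /andP[/andP[rd1 rd2] /andP[rd3 rd4]].
have rC : C * (r - a) <= eta by rewrite mulrC -ler_pdivlMr// ltW.
have [R1 R2 E1 E2 _] := pairs r ar rs.
have ft : phase r (ell x1 r) by exact: (fall r ar rs).
have rz1 : reg s x0 r z1' by apply: H3 => //; rewrite Pa (lt_trans ab').
have rz2 : reg s x0 r z2' by apply: H3 => //; rewrite bQ andbT (lt_trans Pa).
have n1 : `|ell x1 r - z1| <= eta by rewrite distrC; apply: le_trans rC; exact: ellP.
have n2 : `|ell x2 r - z2| <= eta by rewrite distrC; apply: le_trans rC; exact: ellP.
have rab := sub_time ar rs.
have l1 : ell x1 r <= z1'.
  rewrite -lerBlDl; apply: le_trans (le_trans (ler_norm _) n1) _.
  by rewrite mulr2n mulrDl mul1r lerDl ltW.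
have l2 : z2' <= ell x2 r.
  rewrite lerBlDl -lerBlDr; apply: le_trans (ler_norm _) _; rewrite distrC.
  by apply: le_trans n2 _; rewrite mulr2n mulrDl mul1r lerDl ltW.
have s1 := rfslope rab R1 rz1 l1 ft.
have s2 := rfslope rab rz2 R2 l2 (fall r ar rs _ rz2).
rewrite E1 in s1; rewrite E2 in s2.
have h1 := H1 r ar rs rd1; have h2 := H2 r ar rs rd2.
apply: (f_start_arith th_ge0 delta_gt0 (erefl D) n1 n2 h1 h2 s1 s2 _ eta0).
by move: P1 P2 => /andP[p1 _] /andP[_ p2]; exact: ua_good.
Qed.

End start.

(** * Marked jumps *)

Lemma at_left_shift (R : realType) (w : R -> R) (y c l : R) :
  w z @[z --> y^'-] --> l -> w (z - c) @[z --> (y + c)^'-] --> l.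
Proof.
move=> h; apply/cvgrPdist_lt => e e0.
have /cvgrPdist_lt /(_ e e0) := h.
rewrite /at_left; move=> /nbhs_ballP[d d0 Hd].
apply/nbhs_ballP; exists d => // z /= zd zy; apply: Hd; last by rewrite /= ltrBlDr.
by move: zd; rewrite /ball/= opprB addrA.
Qed.

Lemma at_right_shift (R : realType) (w : R -> R) (y c l : R) :
  w z @[z --> y^'+] --> l -> w (z - c) @[z --> (y + c)^'+] --> l.
Proof.
move=> h; apply/cvgrPdist_lt => e e0.
have /cvgrPdist_lt /(_ e e0) := h.
rewrite /at_right; move=> /nbhs_ballP[d d0 Hd].
apply/nbhs_ballP; exists d => // z /= zd zy; apply: Hd; last by rewrite /= ltrBrDr.
by move: zd; rewrite /ball/= opprB addrA.
Qed.

Lemma jump_set_periodic (R : realType) (L : R) (w : R -> R) (x : R) (m : int) :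
  periodic_with L w -> jump_set w x -> jump_set w (x + m%:~R * L).
Proof.
move=> per [l [r [hl hr lr wx]]].
have wE c : w (c - m%:~R * L) = w c.
  have -> : c - m%:~R * L = c + (- m)%:~R * L by rewrite mulrNz mulNr.
  exact: periodic_int.
exists l, r; split => //.
- under eq_cvg do rewrite -wE; exact: at_left_shift.
- under eq_cvg do rewrite -wE; exact: at_right_shift.
- by rewrite periodic_int.
Qed.

(* [M] lists, modulo [L], the jumps to the right of which nothing is required. *)
Definition decay_off (R : realType) (L th : R) (M : seq R) (w : R -> R) : Prop :=
  forall A B, jump_set w A -> (forall z (m : int), z \in M -> A <> z + m%:~R * L) ->
    jump_free w A B -> forall x x', A < x -> x < x' -> x' < B ->
    th * (w x - w x') <= x' - x.

Lemma lattice_period_eq (R : realFieldType) (L x z : R) (m : int) : 0 < L ->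
  0 <= x < L -> 0 <= z < L -> x = z + m%:~R * L -> x = z.
Proof.
move=> L0 /andP[x1 x2] /andP[z1 z2] E.
have h1 : m%:~R * L < 1%:~R * L by rewrite mul1r; lra.
have h2 : (- 1)%:~R * L < m%:~R * L by rewrite mulrNz mulN1r; lra.
have m0 : m = 0 by move: h1 h2; rewrite !ltr_pM2r// !ltr_int; lia.
by rewrite E m0 mul0r addr0.
Qed.

Section evolution.
Context (R : realType) (alpha beta betas delta L u0 : R) (f g : R -> R)
  (u : R -> R -> R).
Context (delta_gt0 : 0 < delta) (L_gt0 : 0 < L)
  (A1 : assumption_A1 alpha beta betas f g)
  (weak : weak_solution delta L f g (cst u0) u)
  (adm : forall s, 0 <= s -> admissible_profile alpha delta L u0 (u s))
  (neg : (@lebesgue_measure R \x @lebesgue_measure R)%E.-negligible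
        [set p | [/\ 0 < p.1, derivable (u p.1) p.2 1
                   & dx u p.1 p.2 = - delta]]).
Context (a b : R) (n N : nat) (y : nat -> R -> R) (a_gt0 : 0 < a)
  (nN : (n <= N)%N) (JC : jump_curves delta L f g u a b N y)
  (old : old_curves L u a n y)
  (fresh : forall i, (n <= i < N)%N -> ~ jump_set (u a) (y i a)).
Context (s : R) (sab : a < s <= b).

Local Notation lift := (lift_curve L y).

Let s_gt_a : a < s. Proof. by case/andP: sab. Qed.
Let s_le_b : s <= b. Proof. by case/andP: sab. Qed.

Lemma decay_mid_off r : a < r -> r <= s -> decay_off L (betas * (s - r)) [::] (u s).
Proof.
move=> ar rs A B _ _ jf x x' Ax xx' x'B.
have xAB : A < x < B by rewrite Ax (lt_trans xx').
have x'AB : A < x' < B by rewrite x'B (lt_trans Ax).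
have nj : ~ jump_set (u s) x.
  by move=> h; have : (`]A, B[ `&` jump_set (u s)) x by []; rewrite jf.
apply: (decay_mid delta_gt0 L_gt0 A1 weak adm neg a_gt0 JC sab nj ar rs) => //.
  exact: (jump_free_region JC sab jf xAB x'AB).
exact: ltW.
Qed.

(** The order is only weak at time [a], where the two curves of a spike start from the same
    point. *)
Lemma lift_le_start p q : (p.1 < N)%N -> (q.1 < N)%N -> lift p s < lift q s ->
  lift p a <= lift q a.
Proof.
move=> plt qlt pq; have [K K0 lip] := lift_lipschitz JC.
have ab : a <= b by exact: ltW (lt_le_trans s_gt_a s_le_b).
have K2 : 0 <= K + K by rewrite addr_ge0.
rewrite -subr_ge0.
apply: (limit_right s_gt_a K2 (d := fun r => lift q r - lift p r)).
  move=> r /andP[ar rs].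
  have -> : lift q a - lift p a - (lift q r - lift p r) =
    (lift q a - lift q r) - (lift p a - lift p r) by ring.
  apply: le_trans (ler_normB _ _) _; rewrite mulrDl.
  have rE : `|a - r| = r - a by rewrite distrC gtr0_norm// subr_gt0.
  have rab : a <= r <= b by rewrite (ltW ar) (le_trans rs).
  by apply: lerD; rewrite -rE; apply: lip; rewrite ?lexx.
move=> r /andP[ar rs]; rewrite subr_ge0 ltW//.
exact: (lift_no_cross JC plt qlt ar rs s_le_b pq).
Qed.

Lemma old_lift_jump p : (p.1 < n)%N -> jump_set (u a) (lift p a).
Proof.
move=> plt; have [fun_ _ _] := old.
have [per _ _ _] := adm (ltW a_gt0).
apply: jump_set_periodic => //.
by have [] := fun_ p.1 plt.
Qed.

Lemma jump_old_lift z : jump_set (u a) z -> exists2 p, (p.1 < n)%N & lift p a = z.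
Proof.
move=> jz; have [_ _ surj] := old.
have [per _ _ _] := adm (ltW a_gt0).
pose m : int := Num.floor (z / L).
have /andP[m1 m2] : m%:~R <= z / L < (m + 1)%:~R by exact: floor_itv.
have j' := jump_set_periodic (- m) per jz.
have [|i /= ilt iE] := surj (z + (- m)%:~R * L).
  split => //=; rewrite in_itv/= mulrNz mulNr subr_ge0 ltrBlDr.
  rewrite -ler_pdivlMr// m1 /=; rewrite -[X in X + _]mul1r -mulrDl -ltr_pdivrMr//.
  by rewrite addrC -[1]/(1%:~R) -intrD.
exists (i, m) => //; rewrite /lift_curve /= iE mulrNz mulNr.
by rewrite subrK.
Qed.

Lemma old_lift_inj p q : (p.1 < n)%N -> (q.1 < n)%N -> lift p a = lift q a -> p = q.
Proof.
case: p q => [i m] [k l] /= ilt klt; rewrite /lift_curve /= => E.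
have [fun_ inj _] := old.
have [_ /=] := fun_ i ilt; rewrite in_itv/= => /andP[i1 i2].
have [_ /=] := fun_ k klt; rewrite in_itv/= => /andP[k1 k2].
have yE : y i a = y k a.
  apply: (lattice_period_eq (m := l - m) L_gt0); rewrite ?i1 ?k1//.
  by rewrite intrB mulrBl; move: E; lra.
have ik : i = k by apply: inj; rewrite ?inE.
congr (_, _) => //; move: E; rewrite yE => /addrI /(mulIf (lt0r_neq0 L_gt0)).
exact: intr_inj.
Qed.

(** Marks follow the jumps: those of [u a] are transported along their curves, and each fresh curve
    adds one. A region to the right of an unmarked jump then starts, at time [a], right after an
    unmarked jump, and [start_decay] applies. *)
Lemma decay_off_evolve th M : 0 <= th -> decay_off L th M (u a) ->
  exists2 M', size M' = (size M + (N - n))%N &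
    decay_off L (th + betas * (s - a)) M' (u s).
Proof.
move=> th0 good.
(* The position at [s] of the lift born at the jump [z]; the default pair concerns only marks which
   are not jumps of [u a]. *)
pose F z := lift (xget (0%N, 0) [set p | (p.1 < n)%N /\ lift p a = z]) s.
exists ([seq F z | z <- M] ++ [seq y i s | i <- iota n (N - n)]).
  by rewrite size_cat !size_map size_iota.
move=> A B jA nM jf x x' Ax xx' x'B.
have xAB : A < x < B by rewrite Ax (lt_trans xx').
have x'AB : A < x' < B by rewrite x'B (lt_trans Ax).
have njAB z : A < z < B -> ~ jump_set (u s) z.
  by move=> zAB h; have : (`]A, B[ `&` jump_set (u s)) z by []; rewrite jf.
have nj := njAB x xAB.
have [pA pAlt AE] := (jump_setE JC A sab).1 jA.
have N0 : (0 < N)%N by exact: leq_ltn_trans pAlt.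
have [p [q [[plt ps] [qlt qs] ext]]] := extremal_lifts L_gt0 JC sab nj a N0.
(* The curve [p] that is rightmost at time [a] may end strictly before [A]. Then a curve ending at
   [A] starts no earlier on the line, and by extremality no later, so it has the same starting
   point. *)
have [p' [p'lt p's p'a]] : exists p', [/\ (p'.1 < N)%N, lift p' s = A & lift p' a = lift p a].
  have := ltgtP (lift p s) A => -[h|h|h]; last by exists p.
    exists pA; split => //; apply/eqP; rewrite eq_le (ext pA pAlt).1 -?AE//=.
    by apply: lift_le_start; rewrite -?AE.
  exfalso; apply: (njAB (lift p s)); last by apply/(jump_setE JC _ sab); exists p.
  by rewrite h (lt_trans ps) // (lt_trans xx').
have p'n : (p'.1 < n)%N.
  rewrite ltnNge; apply/negP => np'; apply: (nM (y p'.1 s) p'.2); last by rewrite -p's.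
  rewrite mem_cat; apply/orP; right; apply: map_f.
  by rewrite mem_iota np' subnKC.
(* Equality is impossible: two old lifts with the same start are equal, and a fresh curve does not
   start at a jump. *)
have PQ : lift p a < lift q a.
  have p'q : lift p' s < lift q s by rewrite p's (lt_trans Ax).
  rewrite -p'a lt_neqAle (lift_le_start p'lt qlt p'q) andbT; apply/eqP => E.
  have [qn|qn] := ltnP q.1 n.
    by have h := old_lift_inj p'n qn E; rewrite h ltxx in p'q.
  apply: (@fresh q.1); first by rewrite qn.
  have [per _ _ _] := adm (ltW a_gt0).
  have := jump_set_periodic (- q.2) per (old_lift_jump p'n).
  by rewrite E /lift_curve mulrNz mulNr addrK.
have side r : (r.1 < N)%N -> (lift r s < x -> lift r a <= lift p a) /\
    (x < lift r s -> lift q a <= lift r a) by exact: ext.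
have jfa : jump_free (u a) (lift p a) (lift q a).
  rewrite /jump_free -subset0 => z [/=]; rewrite in_itv/= => /andP[z1 z2] jz.
  have [r rn rE] := jump_old_lift jz.
  have rN : (r.1 < N)%N by exact: leq_trans nN.
  have [h1 h2] := side r rN.
  case: (region_side JC sab nj rN) => [/h1|/h2]; rewrite rE.
    by rewrite leNgt z1.
  by rewrite leNgt z2.
have jP : jump_set (u a) (lift p a) by rewrite -p'a; exact: old_lift_jump.
have unmarked z (m : int) : z \in M -> lift p a <> z + m%:~R * L.
  move=> zM E; apply: (nM (F z) m).
    by rewrite mem_cat; apply/orP; left; exact: map_f.
  pose p2 := (p'.1, p'.2 - m).
  have p2a : lift p2 a = z.
    apply: (addIr (m%:~R * L)); rewrite -E -p'a /p2 /lift_curve /= intrB; ring.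
  have ex : exists r, [set r | (r.1 < n)%N /\ lift r a = z] r by exists p2.
  have [rn ra] := xgetPex (0%N, 0) ex.
  rewrite /F; set r := xget _ _ in rn ra *.
  have -> : r = p2 by apply: old_lift_inj; rewrite ?ra.
  by rewrite -p's /p2 /lift_curve /= intrB; ring.
have ua_good z z' : lift p a < z -> z < z' -> z' < lift q a ->
    th * (u a z - u a z') <= z' - z.
  exact: (good _ _ jP unmarked jfa).
apply: (start_decay delta_gt0 L_gt0 A1 weak adm neg a_gt0 JC sab nj jfa th0 PQ
  ua_good side) => //.
- by exists p.
- by exists q.
- exact: (jump_free_region JC sab jf xAB x'AB).
- exact: ltW.
Qed.

End evolution.

(** * Total variation of a profile *)

(* A function [Phi] dominating the decreases of [w] turns the variation of [w]
   into a telescoping sum. *)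
Definition drop_le (R : realType) (w Phi : R -> R) (a b : R) : Prop :=
  forall x x', a <= x -> x <= x' -> x' <= b ->
    w x - w x' <= Phi x' - Phi x /\ Phi x <= Phi x'.

Lemma drop_arith (R : realFieldType) (p q x y : R) : p - q <= y - x -> x <= y ->
  `|q - p| <= (q + 2 * y) - (p + 2 * x).
Proof. by move=> *; rewrite ler_norml; apply/andP; split; lra. Qed.

(** The absolute value of an increment of [w] is the increment plus twice the decrease. Increments
    telescope, and decreases are dominated by the telescoping increments of [Phi]. *)
Lemma drop_le_variation (R : realType) (w Phi : R -> R) (a b : R) :
  drop_le w Phi a b ->
  (total_variation a b w <= (w b - w a + 2 * (Phi b - Phi a))%:E)%E.
Proof.
move=> H; apply: ge_ereal_sup => _ [v [s sP <-] <-]; rewrite lee_fin /variation.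
pose G n := w (nth b (a :: s) n) + 2 * Phi (nth b (a :: s) n).
apply: (@le_trans _ _ (\sum_(0 <= n < size s) (G n.+1 - G n))).
  rewrite !big_mkord; apply: ler_sum => i _ /=.
  have ilt : (i < size s)%N by exact: ltn_ord.
  have h1 : a <= nth b (a :: s) i by apply: itv_partition_nth_ge sP; exact: ltnW.
  have h2 : nth b (a :: s) i.+1 <= b by apply: itv_partition_nth_le sP.
  have h3 : nth b (a :: s) i <= nth b (a :: s) i.+1.
    by have [/(pathP b)/(_ i ilt) /ltW] := sP.
  by have [k1 k2] := H _ _ h1 h3 h2; exact: drop_arith.
rewrite telescope_sumr// /G (itv_partition_nth_size _ sP) /=.
by rewrite le_eqVlt; apply/orP; left; apply/eqP; ring.
Qed.

Lemma drop_glue_arith (R : realFieldType) (p q r x y z t : R) :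
  p - q <= y - x -> x <= y -> q - r <= t - z -> z <= t ->
  p - r <= y + t - z - x /\ x <= y + t - z.
Proof. by move=> *; split; lra. Qed.

Lemma drop_le_glue (R : realType) (w Phi1 Phi2 : R -> R) (a b c : R) :
  a <= b -> b <= c -> drop_le w Phi1 a b -> drop_le w Phi2 b c ->
  exists2 Phi, drop_le w Phi a c &
    Phi c - Phi a = (Phi1 b - Phi1 a) + (Phi2 c - Phi2 b).
Proof.
move=> ab bc H1 H2.
exists (fun x => if x <= b then Phi1 x else Phi1 b + Phi2 x - Phi2 b); last first.
  rewrite ab; case: (leP c b) => cb; last by ring.
  have -> : c = b by apply/eqP; rewrite eq_le cb.
  by ring.
move=> x x' ax xx' x'c.
case: (leP x b) => xb; case: (leP x' b) => x'b.
- exact: H1.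
- have [k1 k2] := H1 _ _ ax xb (lexx b).
  have [k3 k4] := H2 _ _ (lexx b) (ltW x'b) x'c.
  exact: (drop_glue_arith k1 k2 k3 k4).
- by have := lt_le_trans xb (le_trans xx' x'b); rewrite ltxx.
- have [k3 k4] := H2 _ _ (ltW xb) xx' x'c.
  by split; [apply: le_trans k3 _|]; lra.
Qed.

Lemma drop_leS (R : realType) (w Phi : R -> R) (a b a' b' : R) :
  a <= a' -> b' <= b -> drop_le w Phi a b -> drop_le w Phi a' b'.
Proof.
by move=> aa bb H x x' ax xx' xb; apply: H => //; [exact: le_trans ax|exact: le_trans bb].
Qed.

Lemma drop_le_shift (R : realType) (w Phi : R -> R) (a b L : R) :
  periodic_with L w -> drop_le w Phi (a + L) (b + L) ->
  drop_le w (fun x => Phi (x + L)) a b.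
Proof.
by move=> per H x x' ax xx' xb; rewrite -(per x) -(per x'); apply: H; rewrite lerD2r.
Qed.

(** Here [Phi] is [- w] inside and the opposite of the inner one-sided limit at each end. Since the
    value at an upward jump lies between the two limits, passing from [A] into the arc, or from the
    arc to [B], adds no further decrease. *)
Lemma drop_le_arc (R : realType) (w : R -> R) (A B C : R) : A < B ->
  jump_set w A -> jump_set w B ->
  (forall x x', A < x -> x <= x' -> x' < B -> w x' <= w x /\ w x - w x' <= C) ->
  exists2 Phi, drop_le w Phi A B & Phi B - Phi A <= C.
Proof.
move=> AB [lA [rA [_ hA _ /andP[_ wA]]]] [lB [rB [hB _ _ /andP[wB _]]]] H.
have rA_ge x : A < x -> x < B -> w x <= rA.
  move=> Ax xB; apply: (cvgr_to_ge hA); near=> z.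
  have Az : A < z by near: z; exact: nbhs_right_gt.
  have zx : z < x by near: z; exact: nbhs_right_lt.
  by have [] := H z x Az (ltW zx) xB.
have lB_le x : A < x -> x < B -> lB <= w x.
  move=> Ax xB; apply: (cvgr_to_le hB); near=> z.
  have xz : x < z by near: z; exact: nbhs_left_gt.
  have zB : z < B by near: z; exact: nbhs_left_lt.
  by have [] := H x z Ax (ltW xz) zB.
have rC x : A < x -> x < B -> rA <= C + w x.
  move=> Ax xB; apply: (cvgr_to_le hA); near=> z.
  have Az : A < z by near: z; exact: nbhs_right_gt.
  have zx : z < x by near: z; exact: nbhs_right_lt.
  by have [_] := H z x Az (ltW zx) xB; rewrite lerBlDr.
have rlC : rA - C <= lB.
  apply: (cvgr_to_ge hB); near=> z.
  by rewrite lerBlDl; exact: rC.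
have lr : lB <= rA.
  have [Am mB] := midf_lt AB.
  exact: le_trans (lB_le _ Am mB) (rA_ge _ Am mB).
pose Phi x := if x <= A then - rA else if x < B then - w x else - lB.
have PA : Phi A = - rA by rewrite /Phi lexx.
have PB : Phi B = - lB by rewrite /Phi leNgt AB ltxx.
exists Phi; last by rewrite PA PB; move: rlC; lra.
move=> x x' Ax xx' x'B; rewrite /Phi.
have [xA|xA] := leP x A.
  have {}xA : x = A by apply/eqP; rewrite eq_le xA.
  subst x; have [x'A|x'A] := leP x' A.
    have -> : x' = A by apply/eqP; rewrite eq_le x'A.
    by rewrite !subrr; split.
  have [x'b|x'b] := ltP x' B.
    by have := rA_ge _ x'A x'b; split; lra.
  have -> : x' = B by apply/eqP; rewrite eq_le x'b x'B.
  by split; lra.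
have x'A : A < x' by exact: lt_le_trans xx'.
rewrite (leNgt x') x'A /=.
have [x'b|x'b] := ltP x' B.
  have xB : x < B by exact: le_lt_trans x'b.
  by rewrite xB; have [h _] := H x x' xA xx' x'b; split; lra.
have -> : x' = B by apply/eqP; rewrite eq_le x'b x'B.
have [xB|xB] := ltP x B.
  by have h := lB_le _ xA xB; split; lra.
have -> : x = B by apply/eqP; rewrite eq_le xB (le_trans xx' x'B).
by rewrite !subrr; split.
Unshelve. all: by end_near.
Qed.

Lemma range_gap (R : realFieldType) (alpha p q c : R) : 0 < p < alpha ->
  0 < q < alpha -> 0 <= c -> p - q <= c + alpha.
Proof. by move=> /andP[? ?] /andP[? ?] ?; lra. Qed.

Section total_variation_bound.
Context (R : realType) (alpha delta L u0 th : R) (M : seq R) (w : R -> R).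
Context (L_gt0 : 0 < L) (th_gt0 : 0 < th)
  (adm : admissible_profile alpha delta L u0 w) (alpha_gt0 : 0 < alpha)
  (good : decay_off L th M w).

Let per : periodic_with L w. Proof. by case: adm. Qed.

Definition marked (A : R) : bool :=
  `[< exists z (m : int), z \in M /\ A = z + m%:~R * L >].

Let w_range x : 0 < w x < alpha.
Proof.
have [_ _ [_ lb ub inf0 supa] _] := adm.
apply/andP; split.
  by apply: lt_le_trans inf0 _; apply: ge_inf.
by apply: le_lt_trans supa; exact: ub_le_sup.
Qed.

(** A marked arc may decrease by the whole range [alpha]. The term [(B - A) / th] is kept for it
    too, so that the lengths of the arcs add up to a period. *)
Let arc A B : A < B -> jump_set w A -> jump_set w B -> jump_free w A B ->
  exists2 Phi, drop_le w Phi A B &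
    Phi B - Phi A <= (B - A) / th + alpha * (marked A)%:R.
Proof.
move=> AB jA jB jf; have [_ [_ /(_ A B jf)[_ _ mono]] _ _] := adm.
apply: drop_le_arc => // x x' Ax xx' x'B.
split; first exact: mono.
have [mA|nmA] := boolP (marked A).
  rewrite mulr1.
  suff c0 : 0 <= (B - A) / th by exact: (range_gap (w_range x) (w_range x') c0).
  by apply: divr_ge0; rewrite ?subr_ge0 ltW.
rewrite mulr0 addr0 ler_pdivlMr// mulrC.
move: xx'; rewrite le_eqVlt => /predU1P[<-|xx'].
  by rewrite subrr mulr0 subr_ge0 ltW.
apply: (@le_trans _ _ (x' - x)).
  apply: (good jA _ jf) => // z m zM E; move/negP: nmA; apply.
  by apply/asboolP; exists z, m.
exact: lerB (ltW x'B) (ltW Ax).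
Qed.

Lemma drop_le_arcs p0 ps : path <%R p0 ps -> jump_set w p0 ->
  (forall z, z \in ps -> jump_set w z) ->
  (forall z, jump_set w z -> p0 < z < last p0 ps -> z \in ps) ->
  exists2 Phi, drop_le w Phi p0 (last p0 ps) &
    Phi (last p0 ps) - Phi p0 <=
      (last p0 ps - p0) / th + alpha * (count marked (belast p0 ps))%:R.
Proof.
elim: ps p0 => [|p1 ps IH] p0 /=.
  move=> _ _ _ _; exists (cst 0); last by rewrite !subrr mul0r mulr0 addr0.
  move=> x x' h1 h2 h3; rewrite !subrr; split => //.
  have -> : x' = x by apply/eqP; rewrite eq_le h2 (le_trans h3 h1).
  by rewrite subrr.
move=> /andP[p01 pth] j0 js all_.
have lep1 : p1 <= last p1 ps.
  have := mem_last p1 ps; rewrite inE => /predU1P[->//|h].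
  by have := lt_path_min pth => /allP /(_ _ h) /ltW.
have j1 : jump_set w p1 by apply: js; rewrite inE eqxx.
have jf : jump_free w p0 p1.
  rewrite /jump_free -subset0 => z [/=]; rewrite in_itv/= => /andP[z0 z1] jz.
  have := all_ z jz; rewrite z0 (lt_le_trans z1 lep1) => /(_ isT).
  rewrite inE => /predU1P[zE|h]; first by rewrite zE ltxx in z1.
  have := lt_path_min pth => /allP /(_ _ h) h'.
  by have := lt_trans z1 h'; rewrite ltxx.
have [Phi1 H1 b1] := arc p01 j0 j1 jf.
have [||Phi2 H2 b2] := IH p1 pth j1.
- by move=> z h; apply: js; rewrite inE h orbT.
- move=> z jz /andP[z1 z2].
  have := all_ z jz; rewrite z2 (lt_trans p01 z1) => /(_ isT).
  by rewrite inE => /predU1P[zE|//]; rewrite zE ltxx in z1.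
have [Phi H E] := drop_le_glue (ltW p01) lep1 H1 H2.
exists Phi => //; rewrite E; apply: le_trans (lerD b1 b2) _.
by rewrite natrD le_eqVlt; apply/orP; left; apply/eqP; ring.
Qed.

Let rho (z : R) : R := z - (Num.floor (z / L))%:~R * L.

Let rho_itv z : 0 <= rho z < L.
Proof.
have /andP[m1 m2] : (Num.floor (z / L))%:~R <= z / L < (Num.floor (z / L) + 1)%:~R.
  exact: floor_itv.
rewrite /rho subr_ge0 -ler_pdivlMr// m1 /=.
by rewrite ltrBlDr -[X in X + _]mul1r -mulrDl -ltr_pdivrMr// addrC -[1]/(1%:~R) -intrD.
Qed.

(** The arcs are taken in the period starting at the smallest jump [z0] of [[0, L[], and what lies
    beyond [L] is then moved back to [[0, z0]]. *)
Lemma drop_le_period :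
  exists2 Phi, drop_le w Phi 0 L & Phi L - Phi 0 <= L / th + alpha * (size M)%:R.
Proof.
have [_ [/finite_seqP[s sE] p1] _ _] := adm.
pose zs := sort <=%R (undup s).
have zsP z : (z \in zs) <-> jump_set w z /\ 0 <= z < L.
  rewrite /zs mem_sort mem_undup; split.
    by move=> h; have : [set` s] z by []; rewrite -sE => -[h1] /=; rewrite in_itv.
  move=> [h1 h2]; have : (jump_set w `&` `[0, L[) z by split; rewrite //= in_itv.
  by rewrite sE.
have szs : sorted <%R zs by rewrite sort_lt_sorted undup_uniq.
have uzs : uniq zs by rewrite sort_uniq undup_uniq.
have jrho z : jump_set w z -> rho z \in zs.
  move=> jz; apply/zsP; split; last exact: rho_itv.
  by rewrite /rho -mulNr -mulrNz; exact: jump_set_periodic.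
(* Distinct marked jumps of one period come from marks that are distinct modulo [L]. *)
have cnt : (count marked zs <= size M)%N.
  rewrite -size_filter -(size_map rho M); apply: uniq_leq_size.
    exact: filter_uniq.
  move=> A; rewrite mem_filter => /andP[/asboolP[z [m [zM AE]]] /zsP[_ A0]].
  apply/mapP; exists z => //.
  apply: (lattice_period_eq (m := m + Num.floor (z / L)) L_gt0 A0 (rho_itv z)).
  by rewrite AE /rho intrD; ring.
case E : zs => [|z0 zs'].
  (* Without jumps the profile is non-increasing on the whole line, and periodicity gives
     [w x = w (x + L) <= w x']. *)
  have jf A B : jump_free w A B.
    by rewrite /jump_free -subset0 => z [_ /jrho]; rewrite E.
  exists (cst 0); last first.
    by rewrite subrr addr_ge0 ?mulr_ge0 ?invr_ge0 ?(ltW L_gt0) ?(ltW th_gt0) ?(ltW alpha_gt0).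
  move=> x x' x0 xx' x'L; rewrite subrr; split => //; rewrite subr_le0 -(per x).
  have [_ _ mono] := p1 (x' - 1) (x + L + 1) (jf _ _).
  by apply: mono; rewrite ?ltrDl ?gtrBl// (le_trans x'L)// lerDr.
have [jz0 /andP[z00 z0L]] : jump_set w z0 /\ 0 <= z0 < L.
  by apply/zsP; rewrite E inE eqxx.
have pth : path <%R z0 zs' by move: szs; rewrite E.
have zmin z : z \in zs' -> z0 < z by move=> h; have /allP := lt_path_min pth; exact.
have [||||] := @drop_le_arcs z0 (rcons zs' (z0 + L)).
- rewrite rcons_path pth /=.
  have : last z0 zs' \in zs by rewrite E mem_last.
  by move=> /zsP[_ /andP[_ h]]; apply: lt_le_trans h _; rewrite lerDr.
- by [].
- move=> z; rewrite mem_rcons inE => /predU1P[->|h].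
    by have := jump_set_periodic 1 per jz0; rewrite mul1r.
  by have /zsP[] : z \in zs by rewrite E inE h orbT.
- move=> z jz; rewrite last_rcons => /andP[h1 h2].
  rewrite mem_rcons inE; apply/orP; right.
  have [zL|Lz] := ltP z L.
    have : z \in zs by apply/zsP; rewrite zL (le_trans z00 (ltW h1)).
    by rewrite E inE => /predU1P[zE|//]; rewrite zE ltxx in h1.
  have : z - L \in zs.
    apply/zsP; split.
      have := jump_set_periodic (- 1) per jz.
      by rewrite mulrNz mulN1r.
    rewrite subr_ge0 Lz ltrBlDr (lt_trans h2)// ltrD2r//.
  rewrite -ltrBlDr in h2.
  rewrite E inE => /predU1P[zE|/zmin h]; first by rewrite zE ltxx in h2.
  by have := lt_trans h h2; rewrite ltxx.
rewrite last_rcons belast_rcons => Phi H b.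
have H1 : drop_le w (fun x => Phi (x + L)) 0 z0.
  by apply: drop_le_shift => //; apply: drop_leS H; rewrite ?add0r ?(ltW z0L).
have H2 : drop_le w Phi z0 L by apply: drop_leS H; rewrite ?lexx// lerDr.
have [Phi' H' E'] := drop_le_glue z00 (ltW z0L) H1 H2.
exists Phi' => //; rewrite E' add0r.
have -> : Phi (z0 + L) - Phi L + (Phi L - Phi z0) = Phi (z0 + L) - Phi z0 by ring.
apply: le_trans b _; rewrite addrAC subrr add0r lerD2l ler_wpM2l ?(ltW alpha_gt0)//.
by rewrite ler_nat -E.
Qed.

Lemma decay_off_total_variation :
  (total_variation 0 L w <= (2 * (L / th + alpha * (size M)%:R))%:E)%E.
Proof.
have [Phi H b] := drop_le_period.
apply: le_trans (drop_le_variation H) _; rewrite lee_fin.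
have -> : w L = w 0 by rewrite -[in RHS]per add0r.
by rewrite subrr add0r ler_wpM2l.
Qed.

End total_variation_bound.

(** * Several arrivals *)

Lemma derivable_no_jump (R : realType) (w : R -> R) (x : R) :
  derivable w x 1 -> ~ jump_set w x.
Proof.
move=> dw [l [r [hl hr lr _]]].
have cw : {for x, continuous w} by exact/differentiable_continuous/derivable1_diffP.
have E1 : l = w x by apply: (cvg_unique (@norm_hausdorff R R^o) hl); exact: cvg_at_left_filter.
have E2 : r = w x by apply: (cvg_unique (@norm_hausdorff R R^o) hr); exact: cvg_at_right_filter.
by move: lr; rewrite E1 E2 ltxx.
Qed.

Lemma increasing_locate (R : realType) (t : nat -> R) (s : R) (K : nat) :
  t 0%N < s -> s <= t K -> exists2 j, (j < K)%N & t j < s <= t j.+1.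
Proof.
move=> t0 sK; elim: K sK => [|K IH] sK.
  by have := lt_le_trans t0 sK; rewrite ltxx.
have [h|h] := leP s (t K); last by exists K => //; rewrite h.
by have [j jK hj] := IH h; exists j => //; exact: leqW.
Qed.

Section chain.
Context (R : realType) (alpha beta betas delta L u0 : R) (f g : R -> R)
  (t X : nat -> R) (u : R -> R -> R).
Context (delta_gt0 : 0 < delta) (L_gt0 : 0 < L)
  (A1 : assumption_A1 alpha beta betas f g)
  (sol : spike_solution alpha beta delta L u0 f g t X u)
  (t0 : t 0%N = 0) (t_incr : forall j, t j < t j.+1).

Let weak : weak_solution delta L f g (cst u0) u. Proof. by case: sol. Qed.
Let adm s : 0 <= s -> admissible_profile alpha delta L u0 (u s).
Proof. by case: sol => _ h _ _ _; exact: h. Qed.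
Let neg : (@lebesgue_measure R \x @lebesgue_measure R)%E.-negligible
        [set p | [/\ 0 < p.1, derivable (u p.1) p.2 1
                   & dx u p.1 p.2 = - delta]].
Proof. by case: sol. Qed.

Let t_homo i j : (i <= j)%N -> t i <= t j.
Proof.
by apply: (@homo_leq _ t (fun x y => x <= y)) => [//|x y z|k]; [exact: le_trans|exact: ltW].
Qed.

Let t_gt0 j : 0 < t j.+1.
Proof. by rewrite -t0; apply: lt_le_trans (t_incr 0) _; exact: t_homo. Qed.

(** A common form for the two prolongations: the first [n] curves continue old jumps, and the
    others, if any, start at a point where the profile is differentiable and hence has no jump. *)
Lemma curves_step j : exists n N y, [/\ (n <= N <= n.+2)%N,
  jump_curves delta L f g u (t j.+1) (t j.+2) N y, old_curves L u (t j.+1) n y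
  & forall i, (n <= i < N)%N -> ~ jump_set (u (t j.+1)) (y i (t j.+1))].
Proof.
have [_ _ _ /(_ j.+1 isT) [h1 h2] _] := sol.
have [fr|nfr] := pselect (derivable (u (t j.+1)) (X j.+1) 1 /\
    - delta < dx u (t j.+1) (X j.+1)).
  have [n [y [old JC [y1 y2 _]]]] := h1 fr.
  exists n, n.+2, y; split => //; first by rewrite leqnn andbT (leq_trans (leqnSn _)).
  move=> i /andP[ni iN].
  have -> : y i (t j.+1) = X j.+1.
    move: iN; rewrite ltnS leq_eqVlt => /predU1P[->//|iN].
    by have -> : i = n by apply/eqP; rewrite eqn_leq ni -ltnS iN.
  by apply: derivable_no_jump; case: fr.
have [n [y [old JC]]] := h2 nfr.
exists n, n, y; split => //; first by rewrite leqnn /= (leq_trans (leqnSn _)).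
by move=> i /andP[h /(leq_ltn_trans h)]; rewrite ltnn.
Qed.

(** Induction over the arrivals after the beginning [a0] of the window. The interval containing [a0]
    starts without information, by [decay_mid_off]; every later one adds at most two marks. Before
    the first arrival the profile is constant and satisfies every bound. *)
Lemma decay_off_chain a0 j r : t j < r <= t j.+1 -> a0 <= r ->
  exists2 M, (size M <= 2 * \sum_(i < j) (a0 <= t i.+1)%R)%N &
    decay_off L (betas * (r - a0)) M (u r).
Proof.
elim: j r => [|j IH] r.
  rewrite t0 => /andP[r0 r1] a0r; exists [::]; first by rewrite big_ord0.
  have [_ _ cst_ _ _] := sol.
  move=> A B _ _ _ x x' _ xx' _; rewrite !cst_ ?(ltW r0)// subrr mulr0 subr_ge0.
  exact: ltW.
move=> /andP[r1 r2] a0r.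
have [n [N [y [/andP[nN Nn] JC old fresh]]]] := curves_step j.
have rab : t j.+1 < r <= t j.+2 by rewrite r1.
have [ta|at_] := ltP (t j.+1) a0.
  exists [::] => //.
  exact: (decay_mid_off delta_gt0 L_gt0 A1 weak adm neg (t_gt0 j) JC rab ta a0r).
have [|M Ms good] := IH (t j.+1) _ at_; first by rewrite t_incr lexx.
have [_ _ bs0 _ _] := A1_facts A1.
have th0 : 0 <= betas * (t j.+1 - a0) by rewrite mulr_ge0 ?(ltW bs0) ?subr_ge0.
have [M' M's good'] := decay_off_evolve delta_gt0 L_gt0 A1 weak adm neg (t_gt0 j)
  nN JC old fresh rab th0 good.
exists M'.
  rewrite M's big_ord_recr /= at_ mulnDr muln1 leq_add//.
  by rewrite leq_subLR addn2.
have -> : betas * (r - a0) = betas * (t j.+1 - a0) + betas * (r - t j.+1) by ring.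
exact: good'.
Qed.

Lemma spike_total_variation tau s K : 0 < tau -> 0 < s -> s <= t K ->
  (total_variation 0 L (u s) <= (2 * (L / (betas * tau) +
    alpha * (2 * \sum_(i < K) (s - tau <= t i.+1 < s)%R%:R)))%:E)%E.
Proof.
move=> tau0 s0 sK; have [alpha0 _ bs0 _ _] := A1_facts A1.
have [|j jK sj] := increasing_locate _ sK; first by rewrite t0.
have sts : s - tau <= s by rewrite gerBl ltW.
have [M Ms good] := decay_off_chain sj sts.
have th0 : 0 < betas * (s - (s - tau)) by rewrite subKr mulr_gt0.
apply: le_trans (decay_off_total_variation L_gt0 th0 (adm (ltW s0)) alpha0 good) _.
rewrite lee_fin subKr ler_wpM2l// lerD2l ler_wpM2l ?(ltW alpha0)//.
apply: (@le_trans _ _ (2 * \sum_(i < j) (s - tau <= t i.+1)%R)%N%:R).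
  by rewrite ler_nat.
rewrite natrM ler_wpM2l// natr_sum.
rewrite -(big_mkord xpredT (fun i => (s - tau <= t i.+1)%R%:R : R)).
rewrite -(big_mkord xpredT (fun i => (s - tau <= t i.+1 < s)%R%:R : R)).
apply: (@le_trans _ _ (\sum_(0 <= i < j) (s - tau <= t i.+1 < s)%R%:R)); last first.
  by rewrite [leRHS](big_cat_nat (n := j)) ?(ltnW jK)//= lerDl sumr_ge0.
rewrite big_nat_cond [leRHS]big_nat_cond; apply: ler_sum => i.
rewrite andbT => /andP[_ ij].
have -> : t i.+1 < s.
  by have /andP[h _] := sj; apply: le_lt_trans h; exact: t_homo.
by rewrite andbT.
Qed.

End chain.

(** * Arrivals of the Poisson process *)

(** From a point [x] below [a], the next arrival lands in [[a, b[] with probability [q] and beyond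
    with probability [r]; the tails give [r >= e * (q + r)] with [e] the exponential of
    [- lambda * (b - a)]. *)
Lemma memoryless_arith (R : realType) (lambda a b x q r : R) :
  expR (- (lambda * (b - x))) <= r -> q + r <= expR (- (lambda * (a - x))) ->
  q <= (1 - expR (- (lambda * (b - a)))) * (q + r).
Proof.
have -> : - (lambda * (b - x)) = - (lambda * (b - a)) + - (lambda * (a - x)) by ring.
rewrite expRD; set e := expR (- (lambda * (b - a))) => h1 h2.
have e0 : 0 <= e by exact: expR_ge0.
have := le_trans (ler_wpM2l e0 h2) h1; lra.
Qed.

(** For the arrival of index [j], [q j] is the probability of lying in [[a, b[], [l j] that of lying
    below [a], and [c j] that of lying below [a] while the next one does not. The sum of the [c j]
    telescopes to at most [l 0], so that the sum [S] of the visits satisfies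
    [S <= (1 - e) * (1 + S)]. *)
Lemma visit_sum_arith (R : realFieldType) (q c l : nat -> R) (e : R) (n : nat) :
  0 < e -> (forall j, 0 <= q j) -> (forall j, 0 <= l j) -> e <= 1 ->
  (forall j, q j.+1 <= (1 - e) * (c j + q j)) ->
  (forall j, c j + l j.+1 <= l j) -> l 0%N + q 0%N <= 1 ->
  \sum_(j < n) q j.+1 <= e^-1 - 1.
Proof.
move=> e0 q0 l0 e1 hq hc h0.
have C : \sum_(j < n) c j + l n <= l 0%N.
  elim: n => [|n IH]; first by rewrite big_ord0 add0r.
  rewrite big_ord_recr /= -addrA; apply: le_trans IH.
  by rewrite lerD2l.
have Q : \sum_(j < n) q j <= q 0%N + \sum_(j < n) q j.+1.
  have -> : q 0%N + \sum_(j < n) q j.+1 = \sum_(j < n.+1) q j.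
    by rewrite big_ord_recl.
  by rewrite big_ord_recr /= lerDl.
set S := \sum_(j < n) q j.+1 in Q *.
have S1 : S <= (1 - e) * (\sum_(j < n) c j + \sum_(j < n) q j).
  by rewrite -big_split mulr_sumr; apply: ler_sum => j _; exact: hq.
have S2 : S <= (1 - e) * (1 + S).
  apply: le_trans S1 _; rewrite ler_wpM2l ?subr_ge0//.
  by have := l0 n; move: C Q h0; clear; lra.
rewrite lerBrDr -[leRHS]mul1r ler_pdivlMr//.
by move: S2; clear; lra.
Qed.

(* [27 z / 4 <= (1 + z)^3] at [z = 8 x / 3], together with
   [exp x - 1 <= x exp x]. *)
Lemma expR_nine (R : realType) (x : R) : 0 <= x ->
  18 * (expR x - 1) <= expR (9 * x).
Proof.
move=> x0.
have h1 : expR x - 1 <= x * expR x.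
  have h := expR_ge1Dx (- x).
  have := ler_wpM2r (expR_ge0 x) h.
  by rewrite -expRD addNr expR0; lra.
have h2 : 18 * x <= expR (8 * x).
  have -> : 8 * x = 8 * x / 3 + 8 * x / 3 + 8 * x / 3 by lra.
  rewrite !expRD.
  have h := expR_ge1Dx (8 * x / 3).
  set z := 8 * x / 3 in h *.
  have z0 : 0 <= z by rewrite /z; lra.
  have z1 : 0 <= 1 + z by lra.
  apply: (@le_trans _ _ ((1 + z) * (1 + z) * (1 + z))); last first.
    by apply: ler_pM => //; [exact: mulr_ge0|exact: ler_pM].
  have -> : 18 * x = 27 / 4 * z by rewrite /z; lra.
  rewrite -subr_ge0.
  have -> : (1 + z) * (1 + z) * (1 + z) - 27 / 4 * z = (z - 2^-1) ^+ 2 * (z + 4) by field.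
  by rewrite mulr_ge0 ?sqr_ge0//; lra.
have -> : 9 * x = 8 * x + x by lra.
rewrite expRD; apply: (@le_trans _ _ (18 * x * expR x)).
  by rewrite -mulrA ler_wpM2l.
by rewrite ler_wpM2r ?expR_ge0.
Qed.

Section product_law.
Context d (T : measurableType d) (R : realType) (P : probability T R).

(** The product measure is determined by its values on rectangles. The event [E] carries the
    conditions on later increments; the law restricted to [E] is normalised by [P E], the case
    [P E = 0] being treated apart. *)
Lemma pair_law (Y Z : {RV P >-> R}) (E : set T) : measurable E ->
  (forall A B, measurable A -> measurable B ->
    P (Y @^-1` A `&` (Z @^-1` B `&` E)) =
      (P (Y @^-1` A) * (P (Z @^-1` B) * P E))%E) ->
  forall C : set (R * R), measurable C ->
    P ((fun w => (Y w, Z w)) @^-1` C `&` E) =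
      ((distribution P Y \x distribution P Z) C * P E)%E.
Proof.
move=> mE H C mC.
have mYZ : measurable_fun setT (fun w => (Y w, Z w)) by exact: measurable_fun_pair.
have mYC : measurable ((fun w => (Y w, Z w)) @^-1` C) by rewrite -[X in measurable X]setTI; exact: mYZ.
have [PE0|PE0] := eqVneq (P E) 0%E.
  rewrite PE0 mule0; apply/eqP; rewrite -measure_le0 -[X in (_ <= X)%E]PE0.
  by apply: le_measure; rewrite ?inE//; exact: measurableI.
have PEfin : P E \is a fin_num by exact: fin_num_measure.
have PEr0 : fine (P E) != 0 by rewrite -eqe fineK.
have r0 : 0 <= (fine (P E))^-1 by rewrite invr_ge0 fine_ge0.
pose nu : measure (R * R)%type R :=
  measure_function_pushforward__canonical__measure_function_Measure (mrestr P mE) mYZ.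
pose m' : measure (R * R)%type R := mscale (NngNum r0) nu.
have m'E D : m' D = ((fine (P E))^-1%:E * P ((fun w => (Y w, Z w)) @^-1` D `&` E))%E by [].
have -> : P E = (fine (P E))%:E by rewrite fineK.
rewrite (@product_measure_unique _ _ _ _ R (distribution P Y) (distribution P Z) m')//.
  by rewrite m'E muleAC -EFinM mulVf// mul1e.
move=> A B mA mB; rewrite m'E.
have -> : (fun w => (Y w, Z w)) @^-1` (A `*` B) `&` E = Y @^-1` A `&` (Z @^-1` B `&` E).
  by rewrite setIA; congr (_ `&` _).
have cancel : (P E * (fine (P E))^-1%:E)%E = 1%E.
  by rewrite -[X in (X * _)%E]fineK// -EFinM mulfV.
by rewrite H// muleC -!muleA cancel mule1.
Qed.

Context (t : nat -> {RV P >-> R}).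
Local Notation incr := (interarrival (fun j => t j : T -> R)).

(* The arrival times are partial sums of the increments, so that each of them is
   independent of all the later increments. *)
Lemma partial_sum_independent :
  (forall w, t 0%N w = 0) ->
  (forall (s : seq nat) (B : nat -> set R), uniq s -> (forall i, measurable (B i)) ->
    P (\bigcap_(i in [set` s]) (incr i @^-1` B i)) =
      (\prod_(i <- s) P (incr i @^-1` B i))%E) ->
  forall j (s : seq nat) (A : set R) (B : nat -> set R), uniq s ->
    (forall i, i \in s -> (j <= i)%N) -> measurable A -> (forall i, measurable (B i)) ->
    P (t j @^-1` A `&`
       \bigcap_(i in [set` s]) (incr i @^-1` B i)) =
      (P (t j @^-1` A) *
       \prod_(i <- s) P (incr i @^-1` B i))%E.
Proof.
move=> t0 indep.
have mB (B : nat -> set R) i : (forall i, measurable (B i)) ->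
    measurable (incr i @^-1` B i).
  move=> mB; rewrite -[X in measurable X]setTI.
  exact: (measurable_funB (measurable_funPT (t i.+1)) (measurable_funPT (t i))).
have mcap (s : seq nat) (B : nat -> set R) : (forall i, measurable (B i)) ->
    measurable (\bigcap_(i in [set` s]) (incr i @^-1` B i)).
  by move=> h; apply: bigcap_measurableType => i _; exact: mB.
elim=> [|j IH] s A B us js mA hB.
  have [A0|A0] := pselect (A 0).
    have -> : t 0%N @^-1` A = setT.
      by apply/seteqP; split => // w _; rewrite /preimage/= t0.
    by rewrite setTI probability_setT mul1e indep.
  have -> : t 0%N @^-1` A = set0.
    by apply/seteqP; split => // w; rewrite /preimage/= t0.
  by rewrite set0I measure0 mul0e.
pose Z : {RV P >-> R} := t j.+1 - t j.
pose C := [set x : R * R | A (x.1 + x.2)].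
have mC : measurable C.
  rewrite -[X in measurable X]setTI.
  by apply: (measurable_funD measurable_fst measurable_snd) => //.
have CE : (fun w => (t j w, Z w)) @^-1` C = t j.+1 @^-1` A.
  by apply/seteqP; split => w; rewrite /C /preimage/= addrC subrK.
(* The product measure of [C] is left unevaluated; taking [s'] empty afterwards identifies it with
   the probability that [t j.+1] lies in [A]. *)
have key s' : uniq s' -> (forall i, i \in s' -> (j < i)%N) ->
    P (t j.+1 @^-1` A `&` \bigcap_(i in [set` s']) (incr i @^-1` B i)) =
    ((distribution P (t j) \x distribution P Z) C *
      \prod_(i <- s') P (incr i @^-1` B i))%E.
  move=> us' js'; rewrite -CE -indep//.
  have jns : j \notin s' by apply/negP => /js'; rewrite ltnn.
  apply: pair_law => [|A' B' mA' mB'|//]; first exact: mcap.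
  pose B2 i := if i == j then B' else B i.
  have hB2 i : measurable (B2 i) by rewrite /B2; case: ifP.
  have := IH (j :: s') A' B2 _ _ mA' hB2; rewrite /= jns us' => /(_ isT).
  have -> : [set` j :: s'] = j |` [set` s'].
    apply/seteqP; split => i /=; rewrite inE; first by move=> /predU1P.
    by move=> h; apply/predU1P.
  rewrite bigcap_setU1 big_cons.
  have BE i : i \in s' -> B2 i = B i.
    by move=> h; rewrite /B2; case: eqP => // ij; rewrite -ij h in jns.
  have -> : \bigcap_(i in [set` s']) (incr i @^-1` B2 i) =
      \bigcap_(i in [set` s']) (incr i @^-1` B i).
    by apply: eq_bigcapr => i h; rewrite BE.
  rewrite (@eq_big_seq _ _ _ _ s' _ (fun i => P (incr i @^-1` B i))); last first.
    by move=> i h /=; rewrite BE.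
  rewrite {1 2}/B2 eqxx -indep// => -> // i.
  by rewrite inE => /predU1P[->//|/js' /ltnW].
rewrite key//.
have := key [::] isT; rewrite set_nil bigcap_set0 setIT big_nil mule1 => -> //.
Qed.

Context (lambda : R) (lambda_gt0 : 0 < lambda).
Context (t0 : forall w, t 0%N w = 0)
  (tail_gt : forall j r, 0 <= r -> P [set w | r < incr j w] = (expR (- (lambda * r)))%:E)
  (indep : forall (s : seq nat) (B : nat -> set R), uniq s -> (forall i, measurable (B i)) ->
    P (\bigcap_(i in [set` s]) (incr i @^-1` B i)) =
      (\prod_(i <- s) P (incr i @^-1` B i))%E).

Lemma increment_independent j (A B : set R) : measurable A -> measurable B ->
  P (t j @^-1` A `&` incr j @^-1` B) = (P (t j @^-1` A) * P (incr j @^-1` B))%E.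
Proof.
move=> mA mB.
have := partial_sum_independent t0 indep (j := j) (s := [:: j]) (A := A) (B := fun=> B) isT.
rewrite big_seq1 set_cons1 bigcap_set1; apply => //.
by move=> i; rewrite inE => /eqP ->.
Qed.

Let Z j : {RV P >-> R} := t j.+1 - t j.

Lemma increment_pair_law j (C : set (R * R)) : measurable C ->
  P ((fun w => (t j w, Z j w)) @^-1` C) =
    (distribution P (t j) \x distribution P (Z j))%E C.
Proof.
move=> mC; rewrite -[LHS]/(P _) -[X in P X]setIT.
rewrite (@pair_law (t j) (Z j) setT)//; first by rewrite probability_setT mule1.
move=> A B mA mB; rewrite setIT probability_setT mule1.
exact: increment_independent.
Qed.

Lemma increment_tail_ge j r : 0 <= r ->
  ((expR (- (lambda * r)))%:E <= P (Z j @^-1` `[r, +oo[))%E.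
Proof.
move=> r0; rewrite -(tail_gt j r0); apply: le_measure; rewrite ?inE.
- have -> : [set w | r < incr j w] = Z j @^-1` `]r, +oo[.
    by apply/seteqP; split => w /=; rewrite in_itv/= andbT.
  exact: measurable_funPTI.
- exact: measurable_funPTI.
- by move=> w /= h; rewrite in_itv/= andbT ltW.
Qed.

(** The law is given through strict tails; the closed tail at [r] is contained in the strict ones at
    [x < r], and [x] tends to [r]. *)
Lemma increment_tail_le j r : 0 < r ->
  (P (Z j @^-1` `[r, +oo[) <= (expR (- (lambda * r)))%:E)%E.
Proof.
move=> r0; set F := P _.
have Ffin : F \is a fin_num by rewrite /F fin_num_measure//; exact: measurable_funPTI.
rewrite -(fineK Ffin) lee_fin.
have lim : expR (- (lambda * x)) @[x --> r^'-] --> expR (- (lambda * r)).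
  apply: cvg_at_left_filter.
  apply: (@continuous_comp _ _ _ (fun x : R => - (lambda * x)) (@expR R)).
    by apply: cvgN; apply: cvgMl_tmp; exact: cvg_id.
  exact: continuous_expR.
apply: (cvgr_to_ge lim); near=> x.
have x0 : 0 < x by near: x; exact: nbhs_left_gt.
rewrite -lee_fin fineK// -(tail_gt j (ltW x0)) /F; apply: le_measure; rewrite ?inE.
- exact: measurable_funPTI.
- have -> : [set w | x < incr j w] = Z j @^-1` `]x, +oo[.
    by apply/seteqP; split => w /=; rewrite in_itv/= andbT.
  exact: measurable_funPTI.
- by move=> w /=; rewrite in_itv/= andbT; exact: lt_le_trans.
Unshelve. all: by end_near.
Qed.

(* Memorylessness: given that the next arrival jumps over [a], it lands before
   [b] with probability at most [1 - exp (- lambda (b - a))]. *)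
Lemma cross_bound a b j : a <= b ->
  (P (t j @^-1` `]-oo, a[ `&` t j.+1 @^-1` `[a, b[) <=
    (1 - expR (- (lambda * (b - a))))%:E *
    P (t j @^-1` `]-oo, a[ `&` t j.+1 @^-1` `[a, +oo[))%E.
Proof.
move=> ab; set p := 1 - _.
have p0 : 0 <= p.
  by rewrite subr_ge0 -expR0 ler_expR oppr_le0 mulr_ge0 ?subr_ge0// ltW.
pose C1 : set (R * R) := [set x | x.1 < a /\ a <= x.1 + x.2 < b].
pose C2 : set (R * R) := [set x | x.1 < a /\ a <= x.1 + x.2].
have maddr : measurable_fun setT (fun x : R * R => x.1 + x.2).
  exact: (measurable_funD measurable_fst measurable_snd).
have mC1 : measurable C1.
  have -> : C1 = (fst @^-1` `]-oo, a[) `&` ((fun x : R * R => x.1 + x.2) @^-1` `[a, b[).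
    by apply/seteqP; split => x; rewrite /C1 /preimage/= !in_itv.
  apply: measurableI.
    by rewrite -[X in measurable X]setTI; exact: measurable_fst.
  by rewrite -[X in measurable X]setTI; exact: maddr.
have mC2 : measurable C2.
  have -> : C2 = (fst @^-1` `]-oo, a[) `&` ((fun x : R * R => x.1 + x.2) @^-1` `[a, +oo[).
    by apply/seteqP; split => x; rewrite /C2 /preimage/= !in_itv/= andbT.
  apply: measurableI.
    by rewrite -[X in measurable X]setTI; exact: measurable_fst.
  by rewrite -[X in measurable X]setTI; exact: maddr.
have -> : t j @^-1` `]-oo, a[ `&` t j.+1 @^-1` `[a, b[ =
    (fun w => (t j w, Z j w)) @^-1` C1.
  apply/seteqP; split => w; rewrite /C1 /preimage/= !in_itv/=.
    by rewrite addrC subrK.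
  by rewrite [_ + (_ - _)]addrC subrK.
have -> : t j @^-1` `]-oo, a[ `&` t j.+1 @^-1` `[a, +oo[ =
    (fun w => (t j w, Z j w)) @^-1` C2.
  apply/seteqP; split => w; rewrite /C2 /preimage/= !in_itv/= andbT.
    by rewrite addrC subrK.
  by rewrite [_ + (_ - _)]addrC subrK.
(* Both probabilities are integrals over the position [x] of the arrival of index [j], and the
   inequality holds slice by slice. *)
rewrite !increment_pair_law// /product_measure1.
rewrite -ge0_integralZl//; last exact: measurable_fun_xsection.
apply: ge0_le_integral => //.
- exact: measurable_fun_xsection.
- by apply: measurable_funeM; exact: measurable_fun_xsection.
move=> x _ /=.
have [xa|ax] := ltP x a; last first.
  rewrite (_ : xsection C1 x = set0) ?measure0 ?mule_ge0//.
  by apply/seteqP; split => // r; rewrite /xsection/= inE => -[/=]; rewrite ltNge ax.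
have S1 : xsection C1 x = `[a - x, b - x[%classic.
  apply/seteqP; split => r; rewrite /xsection/= inE /C1/= in_itv/= lerBlDl ltrBrDl.
    by case.
  by split.
have S2 : xsection C2 x = `[a - x, +oo[%classic.
  apply/seteqP; split => r; rewrite /xsection/= inE /C2/= in_itv/= lerBlDl andbT.
    by case.
  by split.
rewrite S1 S2.
have ax0 : 0 < a - x by rewrite subr_gt0.
have bx0 : 0 <= b - x by rewrite subr_ge0 (le_trans (ltW xa)).
pose I1 := `[a - x, +oo[%classic; pose I2 := `[a - x, b - x[%classic.
pose I3 := `[b - x, +oo[%classic.
have E : distribution P (Z j) I1 = (distribution P (Z j) I2 + distribution P (Z j) I3)%E.
  rewrite -measureU//.
    congr (distribution _ _ _); apply/seteqP; split => r; rewrite /I1 /I2 /I3 /= !in_itv/= !andbT.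
      by move=> h; have [h'|h'] := ltP r (b - x); [left; apply/andP|right].
    by move=> [/andP[]//|]; apply: le_trans; rewrite lerD2r.
  - exact: measurable_itv.
  - exact: measurable_itv.
  by apply/seteqP; split => // r; rewrite /I2 /I3 /= !in_itv/= andbT => -[/andP[_ h1]]; rewrite leNgt h1.
have F2 : distribution P (Z j) I2 \is a fin_num.
  by apply: fin_num_measure; exact: measurable_itv.
have F3 : distribution P (Z j) I3 \is a fin_num.
  by apply: fin_num_measure; exact: measurable_itv.
have h1 : expR (- (lambda * (b - x))) <= fine (distribution P (Z j) I3).
  by rewrite -lee_fin (fineK F3); exact: increment_tail_ge.
have h2 : fine (distribution P (Z j) I2) + fine (distribution P (Z j) I3) <=
    expR (- (lambda * (a - x))).
  by rewrite -lee_fin EFinD (fineK F2) (fineK F3) -E; exact: increment_tail_le.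
rewrite -/I1 -/I2 E -(fineK F2) -(fineK F3) -EFinD -EFinM lee_fin.
exact: memoryless_arith h1 h2.
Qed.

Let null j : set T := Z j @^-1` `]-oo, 0].

Let null0 j : P (null j) = 0%E.
Proof.
have -> : null j = ~` [set w | 0 < incr j w].
  by apply/seteqP; split => w; rewrite /null /= in_itv/= leNgt => /negP.
rewrite probability_setC; first by rewrite tail_gt// mulr0 oppr0 expR0 subee.
have -> : [set w | 0 < incr j w] = Z j @^-1` `]0, +oo[.
  by apply/seteqP; split => w /=; rewrite in_itv/= andbT.
exact: measurable_funPTI.
Qed.

(** A visit to [[a, b[] is either the landing of a step that jumps over [a], or a step shorter than
    [b - a] from a point already in [[a, b[]. Each has conditional probability at most
    [1 - exp (- lambda (b - a))]. *)
Lemma visit_step a b j : a <= b ->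
  (P (t j.+1 @^-1` `[a, b[) <= (1 - expR (- (lambda * (b - a))))%:E *
    (P (t j @^-1` `]-oo, a[ `&` t j.+1 @^-1` `[a, +oo[) + P (t j @^-1` `[a, b[)))%E.
Proof.
move=> ab; set p := 1 - _.
pose S1 := t j @^-1` `]-oo, a[ `&` t j.+1 @^-1` `[a, b[.
pose S2 := t j @^-1` `[a, b[ `&` incr j @^-1` `]-oo, b - a[.
have mS1 : measurable S1 by apply: measurableI; exact: measurable_funPTI.
have mi : measurable (incr j @^-1` `]-oo, b - a[).
  exact: (measurable_funPTI (Z j)).
have mS2 : measurable S2 by apply: measurableI => //; exact: measurable_funPTI.
have mN : measurable (null j) by exact: measurable_funPTI.
have sub : t j.+1 @^-1` `[a, b[ `<=` (S1 `|` S2) `|` null j.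
  move=> w /=; rewrite in_itv/= => /andP[h1 h2].
  have [ta|at_] := ltP (t j w) a.
    by left; left; split; rewrite /= in_itv/= ?h1.
  have [tb|bt] := ltP (t j w) b.
    left; right; split; rewrite /= in_itv/= ?at_//.
    by apply: (@lt_le_trans _ _ (b - t j w)); rewrite ?ltrD2r// lerD2l lerN2.
  right; rewrite /null /= in_itv/= /Z.
  by rewrite -[_ <= _]/(t j.+1 w - t j w <= 0) subr_le0 (le_trans (ltW h2)).
have le1 : (P (t j.+1 @^-1` `[a, b[) <= P S1 + P S2)%E.
  apply: (@le_trans _ _ (P ((S1 `|` S2) `|` null j))).
    by apply: le_measure; rewrite ?inE//; [exact: measurable_funPTI|
      apply: measurableU => //; exact: measurableU].
  rewrite (measureU0 _ mN (null0 j)); last exact: measurableU.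
  exact: measureU2.
apply: le_trans le1 _; rewrite ge0_muleDr//.
apply: leeD; first exact: cross_bound.
rewrite /S2 increment_independent// muleC; apply: lee_wpmul2r => //.
have -> : incr j @^-1` `]-oo, b - a[ = ~` (Z j @^-1` `[b - a, +oo[).
  apply/seteqP; split => w; rewrite /= !in_itv/= andbT ltNge => /negP //.
rewrite probability_setC; last exact: measurable_funPTI.
have ba0 : 0 <= b - a by rewrite subr_ge0.
by rewrite /p EFinB; apply: leeB => //; exact: increment_tail_ge.
Qed.

Lemma cross_step a j :
  (P (t j @^-1` `]-oo, a[ `&` t j.+1 @^-1` `[a, +oo[) + P (t j.+1 @^-1` `]-oo, a[) <=
    P (t j @^-1` `]-oo, a[))%E.
Proof.
have mA : measurable (t j @^-1` `]-oo, a[) by exact: measurable_funPTI.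
have mB : measurable (t j.+1 @^-1` `]-oo, a[) by exact: measurable_funPTI.
have mC : measurable (t j.+1 @^-1` `[a, +oo[) by exact: measurable_funPTI.
have -> : P (t j @^-1` `]-oo, a[) = (P (t j @^-1` `]-oo, a[ `&` t j.+1 @^-1` `[a, +oo[) +
    P (t j @^-1` `]-oo, a[ `&` t j.+1 @^-1` `]-oo, a[))%E.
  rewrite -measureU; [|exact: measurableI|exact: measurableI|].
    congr (P _); rewrite -setIUr -preimage_setU.
    apply/seteqP; split => [w h|w []//]; split => //=.
    by rewrite !in_itv/= andbT; have [h'|h'] := ltP (t j.+1 w) a; [right|left].
  apply/seteqP; split => // w [[_ h1] [_ h2]]; move: h1 h2.
  by rewrite /= !in_itv/= andbT leNgt => /negP.
apply: leeD => //.
apply: (@le_trans _ _ (P ((t j @^-1` `]-oo, a[ `&` t j.+1 @^-1` `]-oo, a[) `|` null j))).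
  apply: le_measure; rewrite ?inE//.
    by apply: measurableU; [exact: measurableI|exact: measurable_funPTI].
  move=> w /= h; have [h'|h'] := ltP (t j w) a; [left|right].
    by split => //; rewrite /= in_itv.
  rewrite /null /= in_itv/= -[_ <= _]/(t j.+1 w - t j w <= 0) subr_le0.
  by move: h; rewrite in_itv/= => /ltW /le_trans; exact.
have mN : measurable (null j) by exact: measurable_funPTI.
by rewrite (measureU0 _ mN (null0 j))//; exact: measurableI.
Qed.

(** The number of visits is compared with a geometric variable, which avoids computing the laws of
    the arrival times. *)
Lemma visit_bound a b n : a <= b ->
  (\sum_(j < n) P (t j.+1 @^-1` `[a, b[) <= (expR (lambda * (b - a)) - 1)%:E)%E.
Proof.
move=> ab; set e := expR (- (lambda * (b - a))).
have -> : expR (lambda * (b - a)) = e^-1 by rewrite /e -expRN opprK.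
have fin A : measurable A -> (fine (P A))%:E = P A by move=> mA; rewrite fineK// fin_num_measure.
have mv j : measurable (t j @^-1` `[a, b[) by exact: measurable_funPTI.
have ml j : measurable (t j @^-1` `]-oo, a[) by exact: measurable_funPTI.
have mc j : measurable (t j @^-1` `]-oo, a[ `&` t j.+1 @^-1` `[a, +oo[).
  by apply: measurableI; exact: measurable_funPTI.
pose q j := fine (P (t j @^-1` `[a, b[)).
pose c j := fine (P (t j @^-1` `]-oo, a[ `&` t j.+1 @^-1` `[a, +oo[)).
pose l j := fine (P (t j @^-1` `]-oo, a[)).
have -> : (\sum_(j < n) P (t j.+1 @^-1` `[a, b[) = (\sum_(j < n) q j.+1)%:E)%E.
  by rewrite -sumEFin; apply: eq_bigr => j _; rewrite fin.
rewrite lee_fin; apply: (@visit_sum_arith _ q c l) => //.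
- exact: expR_gt0.
- by move=> j; exact: fine_ge0.
- by move=> j; exact: fine_ge0.
- by rewrite -expR0 ler_expR oppr_le0 mulr_ge0 ?subr_ge0// ltW.
- by move=> j; rewrite -lee_fin EFinM (EFinD (c j)) !fin//; exact: visit_step.
- by move=> j; rewrite -lee_fin EFinD !fin//; exact: cross_step.
- rewrite -lee_fin EFinD !fin// -measureU//; first exact: probability_le1 (measurableU _ _ _ _).
  by apply/seteqP; split => // w [] /=; rewrite !in_itv/= ltNge => /negP h /andP[/h].
Qed.

Lemma split_itv (x : nat -> R) (Y : {RV P >-> R}) m :
  (P (Y @^-1` `[x 0%N, x m[) <= \sum_(k < m) P (Y @^-1` `[x k, x k.+1[))%E.
Proof.
elim: m => [|m IH].
  by rewrite big_ord0 set_itvco0 preimage_set0 measure0.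
rewrite big_ord_recr /=; apply: le_trans (leeD2r _ IH).
apply: le_trans (measureU2 _ _ _); [|exact: measurable_funPTI|exact: measurable_funPTI].
apply: le_measure; rewrite ?inE; [exact: measurable_funPTI| |].
  by apply: measurableU; exact: measurable_funPTI.
move=> w /=; rewrite !in_itv/= => /andP[h1 h2].
by have [h|h] := ltP (Y w) (x m); [left|right]; apply/andP.
Qed.

(** The bound [expR (lambda * tau) - 1] given by [visit_bound] on the whole interval can exceed half
    of the exponential; on equal pieces the sum of the bounds decreases towards [lambda * tau],
    which lies below that half. *)
Lemma arrivals_bound (a tau : R) n : 0 <= tau ->
  (\sum_(j < n) P (t j.+1 @^-1` `[a, (a + tau)%R[) <= (expR (lambda * tau) / 2)%:E)%E.
Proof.
move=> tau0.
pose x (k : nat) := a + k%:R * (tau / 9).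
have xE k : x k.+1 - x k = tau / 9 by rewrite /x -natr1; ring.
have x0 : x 0%N = a by rewrite /x mul0r addr0.
have x9 : x 9%N = a + tau by rewrite /x mulrC divfK.
have xx k : x k <= x k.+1 by rewrite -subr_ge0 xE divr_ge0.
apply: (@le_trans _ _ (\sum_(j < n) \sum_(k < 9) P (t j.+1 @^-1` `[x k, x k.+1[))%E).
  by apply: lee_sum => j _; rewrite -x9 -x0; exact: split_itv.
rewrite exchange_big /=.
apply: (@le_trans _ _ (\sum_(k < 9) (expR (lambda * (tau / 9)) - 1)%:E)%E).
  by apply: lee_sum => k _; rewrite -(xE k); exact: visit_bound.
rewrite sumEFin lee_fin sumr_const card_ord ler_pdivlMr//.
set e := expR (lambda * (tau / 9)).
have -> : (e - 1) *+ 9 * 2 = 18 * (e - 1) by ring.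
rewrite {}/e.
have := @expR_nine R (lambda * (tau / 9)).
rewrite mulr_ge0 ?divr_ge0 ?(ltW lambda_gt0)// => /(_ isT).
by have -> : 9 * (lambda * (tau / 9)) = lambda * tau by field.
Qed.

Lemma arrivals_increase : {ae P, forall w, forall j, t j w < t j.+1 w}.
Proof.
apply: ae_foralln => j; exists (null j); split; [exact: measurable_funPTI|exact: null0|].
move=> w /= /negP; rewrite -leNgt -subr_le0 => h.
by rewrite /null /= in_itv.
Qed.

(** If all arrivals stayed in [[0, s[] on an event [A], each of the first [n] probabilities would be
    at least [P A], and [n * P A] would remain below the bound of [arrivals_bound], which does not
    depend on [n]. *)
Lemma arrivals_unbounded s : 0 <= s -> {ae P, forall w, exists K, s <= t K w}.
Proof.
move=> s0.
pose A := \bigcap_j (t j.+1 @^-1` `[0, s[).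
have mA : measurable A.
  by apply: bigcap_measurableType => j _; exact: measurable_funPTI.
have A0 : P A = 0%E.
  have Afin : P A \is a fin_num by exact: fin_num_measure.
  rewrite -(fineK Afin); congr EFin; apply/eqP; rewrite eq_le fine_ge0// andbT.
  pose C := expR (lambda * s) / 2.
  have bound n : fine (P A) * n%:R <= C.
    rewrite -lee_fin; have := arrivals_bound 0 n s0; rewrite add0r; apply: le_trans.
    rewrite mulr_natr -[n in _ *+ n]card_ord -sumr_const -sumEFin.
    apply: lee_sum => j _; rewrite fineK//; apply: le_measure; rewrite ?inE//.
      exact: measurable_funPTI.
    by move=> w /(_ j I).
  rewrite leNgt; apply/negP => pA.
  have C0 : 0 <= C / fine (P A) by rewrite !divr_ge0 ?expR_ge0 ?(ltW pA).
  have := archi_boundP C0; rewrite ltr_pdivrMr// mulrC.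
  by rewrite ltNge bound.
have nA : {ae P, forall w, ~ A w} by exists A; split => // w /= /contrapT.
apply: filterS2 arrivals_increase nA => w inc nAw; apply: contrapT => nK.
apply: nAw => j _; rewrite /= in_itv/=; apply/andP; split.
  elim: j => [|j]; first by rewrite -(t0 w) ltW.
  by move=> /le_trans; apply; exact: ltW.
by rewrite ltNge; apply/negP => h; apply: nK; exists j.+1.
Qed.

End product_law.

(** * The expected total variation *)

(* [f] need not be measurable. *)
Lemma ae_le_integral_ge0 d (T : measurableType d) (R : realType)
    (mu : {measure set T -> \bar R}) (f g : T -> \bar R) :
  (forall x, 0 <= f x)%E -> (forall x, 0 <= g x)%E -> measurable_fun setT g ->
  {ae mu, forall x, (f x <= g x)%E} -> (\int[mu]_x f x <= \int[mu]_x g x)%E.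
Proof.
move=> f0 g0 mg [N [mN N0 sub]].
(* Adding [+oo] on the null set makes the inequality valid everywhere without changing the integral
   of [g]; then every simple function below [f] is below [g + k]. *)
pose k x := (+oo * (\1_N x : R)%:E)%E.
have k0 x : (0 <= k x)%E by rewrite mule_ge0// lee_fin indicE.
have mI : measurable_fun setT (fun x => (\1_N x : R)%:E).
  by apply/measurable_EFinP; exact: measurable_indic.
have mk : measurable_fun setT k by exact: measurable_funeM.
have -> : (\int[mu]_x g x = \int[mu]_x (g x + k x))%E.
  rewrite ge0_integralD// /k ge0_integralZl//.
  by rewrite integral_indic// setIT N0 mule0 adde0.
rewrite !ge0_integralTE//; last by move=> x; rewrite adde_ge0.
apply: ereal_sup_le => _ [h hf <-]; exists h => // x; apply: le_trans (hf x) _.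
have [xN|xN] := pselect (N x).
  by rewrite /k indicE mem_set// mule1 addey ?leey// gt_eqF// (lt_le_trans _ (g0 x)).
have : (f x <= g x)%E by apply: contrapT => h'; apply: xN; exact: sub.
by move=> /le_trans; apply; rewrite leeDl.
Qed.

Theorem proposition4p1 (R : realType) (d : measure_display)
  (T : measurableType d) (P : probability T R)
  (alpha beta betas delta L lambda u0 : R) (f g : R -> R)
  (delta_gt0 : 0 < delta) (L_gt0 : 0 < L) (lambda_gt0 : 0 < lambda)
  (A1 : assumption_A1 alpha beta betas f g)
  (u0_range : 0 < u0 < alpha)
  (t X : nat -> {RV P >-> R})
  (tX_poisson : poisson_data lambda L_gt0 t X)
  (u : T -> R -> R -> R)
  (u_sol : random_solution alpha beta delta L u0 f g t X u)
  (s : R) (s_gt0 : 0 < s) :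
  (\int[P]_w total_variation 0 L (u w s)
    <= (2 * alpha * (1 + expR (lambda * L / (alpha * betas))))%:E)%E.
Proof.
have [t0 tail _ indep] := tX_poisson.
have [alpha0 _ betas0 _ _] := A1_facts A1.
have indep' (r : seq nat) (B : nat -> set R) : uniq r -> (forall i, measurable (B i)) ->
    P (\bigcap_(i in [set` r]) (interarrival (fun j => t j : T -> R) i @^-1` B i)) =
      (\prod_(i <- r) P (interarrival (fun j => t j : T -> R) i @^-1` B i))%E.
  move=> ur mB.
  (* The positions are given the whole space, which restricts the independence of all the data to
     the increments. *)
  pose B' (k : nat + nat) := if k is inl i then B i else setT.
  have mB' k : measurable (B' k) by case: k => [i|i] /=; [exact: mB|exact: measurableT].
  have := indep [seq inl i | i <- r] B'.
  rewrite map_inj_uniq; last by move=> i j [].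
  move=> /(_ ur mB'); rewrite big_map /= => <-.
  congr (P _); apply/seteqP; split => w h.
    by move=> _ /= /mapP[i ir ->]; exact: h.
  by move=> i ir; apply: (h (inl i)); rewrite /= map_f.
pose tau := L / (alpha * betas).
have tau0 : 0 < tau by rewrite divr_gt0// mulr_gt0.
pose V j := t j.+1 @^-1` `[s - tau, s[.
have mV j : measurable (V j) by exact: measurable_funPTI.
(* The number of arrivals in the window, written as a series because the index [K] of
   [spike_total_variation] depends on [w]; the expectation is then taken term by term. *)
pose N w := (\sum_(0 <= j <oo) (\1_(V j) w : R)%:E)%E.
have V0 j w : (0 <= (\1_(V j) w : R)%:E)%E by rewrite lee_fin indicE.
have mI j : measurable_fun setT (fun w => (\1_(V j) w : R)%:E).
  by apply/measurable_EFinP; exact: measurable_indic.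
have N0 w : (0 <= N w)%E by apply: nneseries_ge0.
have mN : measurable_fun setT N by exact: ge0_emeasurable_sum.
pose G w := ((2 * alpha)%:E + (4 * alpha)%:E * N w)%E.
have a2 : 0 <= 2 * alpha by rewrite mulr_ge0// ltW.
have a4 : 0 <= 4 * alpha by rewrite mulr_ge0// ltW.
have mG : measurable_fun setT G.
  by apply: emeasurable_funD => //; exact: measurable_funeM.
have G0 w : (0 <= G w)%E by rewrite adde_ge0// mule_ge0.
have TVG : {ae P, forall w, (total_variation 0 L (u w s) <= G w)%E}.
  have inc := arrivals_increase tail.
  have unb := arrivals_unbounded lambda_gt0 t0 tail indep' (ltW s_gt0).
  apply: filterS3 u_sol inc unb => w sol incw [K sK].
  have := spike_total_variation delta_gt0 L_gt0 A1 sol (t0 w) incw tau0 s_gt0 sK.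
  move=> /le_trans; apply.
  rewrite mulrDr EFinD.
  have -> : 2 * (L / (betas * tau)) = 2 * alpha.
    by rewrite /tau; field; rewrite !gt_eqF.
  apply: leeD => //.
  have -> : 2 * (alpha * (2 * \sum_(i < K) (s - tau <= t i.+1 w < s)%R%:R)) =
      4 * alpha * \sum_(i < K) (s - tau <= t i.+1 w < s)%R%:R by ring.
  rewrite EFinM lee_wpmul2l//.
  apply: (@le_trans _ _ (\sum_(0 <= i < K) (\1_(V i) w : R)%:E)%E); last first.
    by apply: nneseries_lim_ge => i _ _; exact: V0.
  rewrite big_mkord sumEFin lee_fin ler_sum// => i _.
  rewrite indicE /V; case: (boolP (s - tau <= t i.+1 w < s)) => // h.
  by rewrite mem_set//= in_itv.
apply: le_trans (ae_le_integral_ge0 _ G0 mG TVG) _.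
  by move=> w; apply: total_variation_ge0; exact: ltW.
rewrite ge0_integralD//; [|by move=> w _; exact: mule_ge0|exact: measurable_funeM].
rewrite integral_cst// [X in (_ * X + _)%E](probability_setT P) mule1.
rewrite ge0_integralZl// integral_nneseries//.
have -> : lambda * L / (alpha * betas) = lambda * tau by rewrite /tau mulrA.
have -> : 2 * alpha * (1 + expR (lambda * tau)) =
    2 * alpha + 4 * alpha * (expR (lambda * tau) / 2) by field.
rewrite EFinD; apply: leeD => //; rewrite (EFinM (4 * alpha)) lee_wpmul2l//.
apply: lime_le; first by apply: is_cvg_nneseries => n _ _; exact: integral_ge0.
apply: nearW => n; rewrite big_mkord.
have := arrivals_bound lambda_gt0 t0 tail indep' (s - tau) n (ltW tau0).
rewrite subrK; apply: le_trans.
by apply: lee_sum => j _; rewrite integral_indic// setIT.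
Qed.
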